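(* Let $(\sigma^n_t)_{t\in[0,\infty)}$ be the birth Mallows process on $\mathcal{S}_n$, and for $i\in[n]$ and $t\in\mathbb{R}$ let $X_i^n(t)=\frac1n\sigma^n_{e^{t/n}}(i)$. For $T>0$ let $Y^n=(Y^n_t)_{t\in[-T,T]}$ be the random particle process obtained by choosing $i\in[n]$ uniformly at random (independently of $\sigma^n$) and setting $Y^n_t=X_i^n(t)$, regarded as a random path in the Skorokhod space $D([-T,T],[0,1])$. Then for any $T>0$ we have convergence in distribution $$Y^n\xrightarrow{d}Z\quad\text{as } n\to\infty,$$ where $Z=(z_{X,A}(t))_{t\in[-T,T]}$ with $X,A$ independent and uniformly distributed on $[0,1]$, and for $x,a\in[0,1]$ $$z_{x,a}(t)=\frac1t\log\left(\frac{e^{xt}(1-a)+ae^t}{e^{xt}(1-a)+a}\right)\ (t\ne0),\qquad z_{x,a}(0)=a.$$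
   Context: $\mathcal{S}_n$ is the group of permutations of $[n]=\{1,\dots,n\}$. For $\sigma\in\mathcal{S}_n$ and $i\in[n]$, the number of left inversions of $i$ is $\ell_i(\sigma)=|\{j\in\{1,\dots,i-1\}:\sigma(j)>\sigma(i)\}|$. The map $\sigma\mapsto(\ell_1(\sigma),\dots,\ell_n(\sigma))$ is a bijection from $\mathcal{S}_n$ onto $\{0\}\times\{0,1\}\times\dots\times\{0,1,\dots,n-1\}$. Birth Mallows process: for each $i\in[n]$ let $(\ell^n_i(t))_{t\in[0,\infty)}$ be a càdlàg time-inhomogeneous Markov birth process with values in $\{0,\dots,i-1\}$, started at $\ell_i^n(0)=0$, whose rate of jumping from $j$ to $j+1$ at time $t$ is $$p_i(j,t)=\frac1{1-t}\left(j+1-\frac{i\,t^{i-j-1}(t^{j+1}-1)}{t^i-1}\right)\ (t\neq1),\qquad p_i(j,1)=\tfrac12(j+1)(i-j-1),$$ for $j=0,\dots,i-1$ (with $0^0=1$), the processes being independent over $i\in[n]$. The birth Mallows process $(\sigma^n_t)_{t\in[0,\infty)}$ is defined by letting $\sigma^n_t$ be the unique permutation in $\mathcal{S}_n$ with $(\ell_1(\sigma^n_t),\dots,\ell_n(\sigma^n_t))=(\ell^n_1(t),\dots,\ell^n_n(t))$. *)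

(* Defs.v *)
From HB Require Import structures.
From mathcomp Require Import all_boot all_order all_algebra perm.
From mathcomp Require Import all_classical all_reals all_analysis.
From mathcomp Require Import ring lra zify.

Set Implicit Arguments.
Unset Strict Implicit.
Unset Printing Implicit Defensive.

Import Order.TTheory GRing.Theory Num.Theory.
Import numFieldNormedType.Exports.

Local Open Scope classical_set_scope.
Local Open Scope ring_scope.

(* Indices: the element [i : 'I_n] stands for the element i.+1 of {1, ..., n},
   and likewise for the values of a permutation. *)
Definition left_inv (n : nat) (s : 'S_n) (i : 'I_n) : nat :=
  #|[pred j : 'I_n | (j < i)%N && (s i < s j)%N]|.

Lemma left_inv_inj (n : nat) (s1 s2 : 'S_n) :
  left_inv s1 =1 left_inv s2 -> s1 = s2.
Proof.
move=> eqL.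
have up_eq (U V : {set 'I_n}) : U \subset V \/ V \subset U -> #|U| = #|V| -> U = V.
  by case=> sUV cUV; [|apply/esym]; apply/eqP; rewrite eqEcard sUV cUV leqnn.
have flip (s : 'S_n) (a b : 'I_n) : a <> b :> nat ->
    (s a < s b)%N = ~~ (s b < s a)%N.
  move=> ab; rewrite -leqNgt ltn_neqAle; case: eqP => // /val_inj/perm_inj.
  by move/(congr1 val).
have L (i : 'I_n) : forall j k : 'I_n, (j <= i)%N -> (k < j)%N ->
    (s1 j < s1 k)%N = (s2 j < s2 k)%N.
  case: i => i; elim: i => [|i IH] ilt j k /= ji kj.
    by move: kj; rewrite ltnNge (leq_trans ji).
  case: (ltnP j i.+1) => [jlt|ij].
    by apply: (IH (ltnW ilt)).
  have ord (a b : 'I_n) : (a <= i)%N -> (b <= i)%N ->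
      (s1 a < s1 b)%N = (s2 a < s2 b)%N.
    move=> ai bi; case: (ltngtP a b) => [ab|ba|/val_inj ->]; [| |by rewrite !ltnn].
    + have nab : a <> b :> nat by move=> E; rewrite E ltnn in ab.
    by rewrite (flip s1 _ _ nab) (flip s2 _ _ nab) (IH (ltnW ilt) b a bi ab).
    + exact: (IH (ltnW ilt) a b ai ba).
  pose U (s : 'S_n) := [set k : 'I_n | (k < j)%N && (s j < s k)%N]%SET.
  have UE s : left_inv s j = #|U s| by rewrite /left_inv cardsE.
  have : U s1 = U s2.
    apply: up_eq; last by rewrite -!UE eqL.
    case: (boolP (U s1 \subset U s2)) => [|/subsetPn[x]]; first by left.
    rewrite !inE => /andP[xj jx]; rewrite xj /= -leqNgt => x2; right.
    apply/fintype.subsetP => y; rewrite !inE => /andP[yj jy]; rewrite yj /=.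
    apply: (ltn_trans jx); rewrite ord; last 2 first.
    - by rewrite -ltnS (leq_trans xj).
    - by rewrite -ltnS (leq_trans yj).
    exact: leq_ltn_trans jy.
  by move=> /setP/(_ k); rewrite !inE kj.
have ord (a b : 'I_n) : (s1 a < s1 b)%N = (s2 a < s2 b)%N.
  case: (ltngtP a b) => [ab|ba|/val_inj ->]; [| |by rewrite !ltnn].
  - have nab : a <> b :> nat by move=> E; rewrite E ltnn in ab.
    by rewrite (flip s1 _ _ nab) (flip s2 _ _ nab) (L b b a (leqnn _) ab).
  - exact: (L a a b (leqnn _) ba).
have cnt (s : 'S_n) i : nat_of_ord (s i) = #|[set k : 'I_n | (s k < s i)%N]%SET|.
  rewrite -(card_imset _ (@perm_inj _ s)).
  have -> : s @: [set k : 'I_n | (s k < s i)%N]%SET = [set k : 'I_n | (k < s i)%N]%SET.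
    apply/setP => k; rewrite inE; apply/imsetP/idP => [[x]|ki].
      by rewrite inE => ? ->.
    by exists ((s^-1)%g k); rewrite ?inE permKV.
  have wi := ltnW (ltn_ord (s i)).
  have -> : [set k : 'I_n | (k < s i)%N]%SET = widen_ord wi @: [set: 'I_(s i)]%SET.
    apply/setP => k; rewrite inE; apply/idP/imsetP => [ki|[x _ ->]] //=.
    by exists (Ordinal ki); [rewrite finset.in_setT | apply: val_inj].
  rewrite card_imset ?cardsT ?card_ord// => x y /(congr1 val) /= xy.
  exact: val_inj.
apply/permP => i; apply: val_inj; rewrite /= (cnt s1) (cnt s2).
congr (#|pred_of_set _|); apply/setP => k; rewrite !finset.inE; exact: ord.
Qed.

(* At an end point of [D] one of the two filters is improper and the
   corresponding requirement is void. *)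
Definition cadlag_on (R : realType) (D : set R) (f : R -> R) : Prop :=
  forall t, D t ->
    f x @[x --> within D (at_right t)] --> f t /\
    exists l : R, f x @[x --> within D (at_left t)] --> l.

(* For countable [S], the sigma-algebra generated by the [X t], [t] in [D]. *)
Definition history (R : realType) (W S : Type) (X : R -> W -> S) (D : set R) :
    set (set W) :=
  <<s [set B : set W | exists t y, D t /\ B = X t @^-1` [set y]] >>.

Section birth_mallows.
Variable R : realType.

(* [0 ^+ 0 = 1]; [i] is the index in {1, ..., n}. *)
Definition birth_rate (i j : nat) (t : R) : R :=
  if t == 1 then 2^-1 * j.+1%:R * (i - j - 1)%:R
  else (1 - t)^-1 *
    (j.+1%:R - i%:R * t ^+ (i - j - 1) * (t ^+ j.+1 - 1) / (t ^+ i - 1)).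

Definition birth_generator (m : nat) (p : nat -> R -> R) (t : R) : 'M[R]_m :=
  \matrix_(j, k) if k == j :> nat then - p j t
                 else if k == j.+1 :> nat then p j t else 0.

Definition stochastic_mx (m : nat) (K : 'M[R]_m) : Prop :=
  (forall j k, 0 <= K j k) /\ (forall j, \sum_k K j k = 1).

(* [K s u j k] is the probability of going from [j] at time [s] to [k] at time
   [u]. In the last clause the rates at time [t] are read off on short intervals
   [s, u] around [t]: looking only at [t, t + h] would not exclude jumps at
   deterministic times. *)
Definition transition_function (m : nat) (G : R -> 'M[R]_m)
    (K : R -> R -> 'M[R]_m) : Prop :=
  [/\ forall s u, 0 <= s -> s <= u -> stochastic_mx (K s u),
      forall s t u, 0 <= s -> s <= t -> t <= u -> K s u = K s t *m K t u &
      forall t j k, 0 <= t -> forall e : R, 0 < e ->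
        exists2 h : R, 0 < h &
          forall s u, 0 <= s -> s <= t -> t <= u -> u - s < h ->
            `|K s u j k - ((j == k)%:R + (u - s) * G t j k)| <= e * (u - s)].

Definition markov_process (m : nat) (d : measure_display)
    (W : measurableType d) (P : probability W R)
    (X : R -> W -> 'I_m) (G : R -> 'M[R]_m) : Prop :=
  (forall t j, 0 <= t -> measurable (X t @^-1` [set j])) /\
  exists K, transition_function G K /\
    forall s u, 0 <= s -> s <= u ->
    forall A, history X [set v | 0 <= v <= s] A ->
    forall j k,
      P (A `&` X s @^-1` [set j] `&` X u @^-1` [set k]) =
      (P (A `&` X s @^-1` [set j]) * (K s u j k)%:E)%E.

Definition birth_process (m : nat) (d : measure_display) (W : measurableType d)
    (P : probability W R) (X : R -> W -> 'I_m) (p : nat -> R -> R) : Prop :=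
  [/\ forall w, X 0 w = 0%N :> nat,
      forall w, cadlag_on [set t | 0 <= t] (fun t => (X t w : nat)%:R) &
      markov_process P X (birth_generator m p)].

(* Each [F i] is meant to be a sigma-algebra; as it contains [setT], the product
   rule for the full index set contains those for its subsets. *)
Definition independent_family (I : finType) (d : measure_display)
    (W : measurableType d) (P : probability W R) (F : I -> set (set W)) : Prop :=
  forall A : I -> set W, (forall i, F i (A i)) ->
    P (\bigcap_i A i) = (\prod_i P (A i))%E.

Definition birth_mallows_process (n : nat) (d : measure_display)
    (W : measurableType d) (P : probability W R) (sigma : R -> W -> 'S_n) :
    Prop :=
  exists l : forall i : 'I_n, R -> W -> 'I_i.+1,
    [/\ forall i, birth_process P (l i) (birth_rate i.+1),
        independent_family P (fun i => history (l i) [set t | 0 <= t]) &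
        forall t w i, 0 <= t -> left_inv (sigma t w) i = l i t w].

Definition uniform_index (n : nat) (d : measure_display)
    (W : measurableType d) (P : probability W R) (I : W -> 'I_n) : Prop :=
  forall i, measurable (I @^-1` [set i]) /\ P (I @^-1` [set i]) = (n%:R^-1)%:E.

Definition index_independent (n : nat) (d : measure_display)
    (W : measurableType d) (P : probability W R) (I : W -> 'I_n)
    (sigma : R -> W -> 'S_n) : Prop :=
  forall i A, history sigma [set t | 0 <= t] A ->
    P (I @^-1` [set i] `&` A) = (P (I @^-1` [set i]) * P A)%E.

Definition independent_RV (d : measure_display) (W : measurableType d)
    (P : probability W R) (X Y : W -> R) : Prop :=
  forall B C, measurable B -> measurable C ->
    P (X @^-1` B `&` Y @^-1` C) = (P (X @^-1` B) * P (Y @^-1` C))%E.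

Definition uniform01 (d : measure_display) (W : measurableType d)
    (P : probability W R) (X : {RV P >-> R}) : Prop :=
  forall B, measurable B -> distribution P X B = uniform_prob (@ltr01 R) B.

End birth_mallows.

(* The Skorokhod space D([a, b], [0, 1]). Paths are encoded as functions on [R]
   vanishing outside [a, b], so that paths agreeing on [a, b] are equal. *)
Record skorokhod (R : realType) (a b : R) := Skorokhod {
  sk_fun :> R -> R ;
  sk_cadlag : cadlag_on `[a, b] sk_fun ;
  sk_range : forall t, t \in `[a, b] -> 0 <= sk_fun t <= 1 ;
  sk_out : forall t, t \notin `[a, b] -> sk_fun t = 0 }.

(* An increasing bijection of [a, b] is a homeomorphism. *)
Definition time_change (R : realType) (a b : R) (l : R -> R) : Prop :=
  set_bij `[a, b] `[a, b] l /\
  {in `[a, b] &, {homo l : s t / s < t}}.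

(* Balls of Skorokhod's J1 metric
   inf_l max (sup_t |l t - t|) (sup_t |x t - y (l t)|), up to replacing [<]
   by [<=] in the bounds on the suprema. *)
Definition J1_ball (R : realType) (a b : R) (x : skorokhod a b) (e : R)
    (y : skorokhod a b) : Prop :=
  exists l, time_change a b l /\
    forall t, t \in `[a, b] -> `|l t - t| < e /\ `|x t - y (l t)| < e.

Section J1_topology.
Variables (R : realType) (a b : R).
Local Notation D := (skorokhod a b).

Let J1_ball_center (x : D) (e : R) : 0 < e -> J1_ball x e x.
Proof.
move=> e0; exists id; split.
  split; last by [].
  by split=> // t ?; exists t.
by move=> t _; rewrite !subrr normr0.
Qed.

Let J1_ball_sym (x y : D) (e : R) : J1_ball x e y -> J1_ball y e x.
Proof.
move=> [l [[[lf li ls] lm] lxy]].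
have hs t : exists s, t \in `[a, b] -> s \in `[a, b] /\ l s = t.
  case: (pselect (t \in `[a, b])) => [tab|ntab]; last by exists 0.
  by have [s sab <-] := ls t tab; exists s.
have [g gP] := choice hs.
have gK s : s \in `[a, b] -> g (l s) = s.
  move=> sab; have [gab gl] := gP (l s) (lf s sab).
  by apply: li; rewrite ?inE.
exists g; split; first split; first split.
- by move=> t /gP[].
- move=> s t; rewrite !inE => /gP[_ es] /gP[_ et] est.
  by rewrite -es est et.
- by move=> s sab; exists (l s); [exact: lf | exact: gK].
- move=> s t sab tab st.
  have [gs es] := gP s sab; have [gt et] := gP t tab.
  rewrite ltNge; apply/negP; rewrite le_eqVlt => /predU1P[ets|tls].
    by move: st; rewrite -es -et ets ltxx.
  by have := lm _ _ gt gs tls; rewrite es et ltNge (ltW st).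
move=> t /gP[gt et]; have [h1 h2] := lxy _ gt.
by rewrite et in h1 h2; rewrite distrC h1 distrC h2.
Qed.

Let J1_ball_triangle (x y z : D) (e1 e2 : R) :
  J1_ball x e1 y -> J1_ball y e2 z -> J1_ball x (e1 + e2) z.
Proof.
move=> [l [[lb lm] lxy]] [g [[gb gm] gyz]].
have lf t : t \in `[a, b] -> l t \in `[a, b] by case: lb => + _ _; apply.
exists (g \o l); split; first split.
- exact: set_bij_comp lb gb.
- by move=> s t sab tab st /=; apply: gm; [exact: lf | exact: lf | exact: lm].
move=> t tab; have [h1 h2] := lxy t tab; have [h3 h4] := gyz _ (lf t tab).
split.
  by rewrite (le_lt_trans (ler_distD (l t) _ _))//= addrC ltrD.
by rewrite (le_lt_trans (ler_distD (y (l t)) _ _))//= ltrD.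
Qed.

HB.instance Definition _ := gen_eqMixin D.
HB.instance Definition _ := gen_choiceMixin D.
HB.instance Definition _ := hasNbhs.Build D
  (nbhs_ (entourage_ (@J1_ball R a b))).
HB.instance Definition _ := Nbhs_isPseudoMetric.Build R D
  (erefl : nbhs = nbhs_ (entourage_ (@J1_ball R a b)))
  J1_ball_center J1_ball_sym J1_ball_triangle erefl.

End J1_topology.

Definition borel_measurable (S : topologicalType) (d : measure_display)
    (W : measurableType d) (Y : W -> S) : Prop :=
  forall B, <<s [set U : set S | open U] >> B -> measurable (Y @^-1` B).

Definition cvg_in_distribution (R : realType) (S : topologicalType)
    (d : nat -> measure_display) (W : forall n, measurableType (d n))
    (P : forall n, probability (W n) R) (Y : forall n, W n -> S)
    (d' : measure_display) (W' : measurableType d') (Q : probability W' R)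
    (Z : W' -> S) : Prop :=
  [/\ forall n, borel_measurable (Y n),
      borel_measurable Z &
      forall f : S -> R, continuous f -> (exists M, forall x, `|f x| <= M) ->
        ('E_(P n)[f \o Y n] @[n --> \oo] --> 'E_Q[f \o Z])%E].

Section paths.
Variable R : realType.

Lemma cadlag_restrict (D : set R) (f : R -> R) :
  cadlag_on D f -> cadlag_on D (f \_ D).
Proof.
move=> fD t Dt; have [fr [l fl]] := fD t Dt.
have E (F : set_system R) : Filter F ->
    \forall x \near within D F, f x = (f \_ D) x.
  by move=> FF; apply: (@filterE _ F FF (fun x => D x -> f x = (f \_ D) x)) => x Dx; rewrite patchE mem_set.
split; last exists l.
  rewrite [X in _ --> X](_ : _ = f t); last by rewrite patchE mem_set.
  exact: cvg_trans (near_eq_cvg (E _ _)) fr.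
exact: cvg_trans (near_eq_cvg (E _ _)) fl.
Qed.

Definition skorokhod_of (a b : R) (f : R -> R) (fc : cadlag_on `[a, b] f)
    (f01 : forall t, t \in `[a, b] -> 0 <= f t <= 1) : skorokhod a b.
Proof.
apply: (@Skorokhod R a b (f \_ `[a, b])).
- exact: cadlag_restrict.
- by move=> t tab; rewrite patchE mem_set//; exact: f01.
- by move=> t tab; rewrite patchE memNset//; exact/negP.
Defined.

Lemma skorokhod_ofE (a b : R) (f : R -> R) fc f01 t :
  t \in `[a, b] -> @skorokhod_of a b f fc f01 t = f t.
Proof. by move=> tab; rewrite /= patchE mem_set. Qed.

Lemma cvg_nat_near (F : set_system R) (FF : Filter F) (g : R -> nat) (l : R) :
  (g x)%:R @[x --> F] --> l ->
  exists c, (forall k, l = k%:R -> c = k) /\ \forall x \near F, g x = c.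
Proof.
move=> /cvgrPdist_lt/(_ 2^-1); rewrite invr_gt0 ltr0n => /(_ isT) gl.
have uniqn (c k : nat) : `|l - c%:R| < 2^-1 -> `|l - k%:R| < 2^-1 -> c = k.
  rewrite !ltr_distl => /andP[c1 c2] /andP[k1 k2].
  case: (ltngtP c k) => // ck; exfalso.
    have : c.+1%:R <= k%:R :> R by rewrite ler_nat.
    rewrite -natr1; lra.
  have : k.+1%:R <= c%:R :> R by rewrite ler_nat.
    rewrite -natr1; lra.
case: (pselect (exists c : nat, `|l - c%:R| < 2^-1)) => [[c cl]|nc].
  exists c; split; last by near=> x; apply: (uniqn) => //; near: x.
  by move=> k lk; apply: uniqn => //; rewrite lk subrr normr0 invr_gt0 ltr0n.
exists 0%N; split.
  by move=> k lk; exfalso; apply: nc; exists k; rewrite lk subrr normr0 invr_gt0 ltr0n.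
by near=> x; exfalso; apply: nc; exists (g x); near: x.
Unshelve. all: by end_near. Qed.

(* X_i^n(t); the [.+1] converts the value of the permutation to {1, ..., n}. *)
Definition particle (n : nat) (W : Type) (sigma : R -> W -> 'S_n) (w : W)
    (i : 'I_n) (t : R) : R :=
  n%:R^-1 * (sigma (expR (t / n%:R)) w i).+1%:R.

Lemma particle_range (n : nat) (W : Type) (sigma : R -> W -> 'S_n) w i t :
  0 <= particle sigma w i t <= 1.
Proof.
have n0 : 0 < n%:R :> R by rewrite ltr0n (leq_ltn_trans _ (ltn_ord i)).
rewrite /particle mulr_ge0//= ?invr_ge0 ?(ltW n0)//=.
by rewrite mulrC ler_pdivrMr// mul1r ler_nat ltn_ord.
Qed.

Lemma particle_cadlag (n : nat) (d : measure_display) (W : measurableType d)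
    (P : probability W R) (sigma : R -> W -> 'S_n) w i (D : set R) :
  birth_mallows_process P sigma -> cadlag_on D (particle sigma w i).
Proof.
move=> [l [lb _ ls]] t _.
have n0 : 0 < n%:R :> R by rewrite ltr0n (leq_ltn_trans _ (ltn_ord i)).
pose phi x := expR (x / n%:R) : R.
have phi0 x : 0 <= phi x by exact: expR_ge0.
have phi_lt x y : (phi x < phi y) = (x < y).
  by rewrite /phi ltr_expR ltr_pM2r// invr_gt0.
have phic : phi x @[x --> t] --> phi t.
  apply: (@cvg_comp _ _ _ (fun x => x / n%:R) expR _ (nbhs (t / n%:R))).
    by apply: cvgM; [exact: cvg_id | exact: cvg_cst].
  exact: continuous_expR.
have near_r (Q : set R) :
    (\forall y \near within [set y | 0 <= y] (at_right (phi t)), Q y) ->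
    \forall x \near within D (at_right t), Q (phi x).
  move=> H; have {}H : \forall y \near nbhs (phi t), phi t < y -> 0 <= y -> Q y by exact: H.
  have H' : \forall x \near nbhs t, phi t < phi x -> 0 <= phi x -> Q (phi x).
    exact: phic _ H.
  suff : \forall x \near nbhs t, t < x -> D x -> Q (phi x) by [].
  apply: filterS H' => x /= H1 tx _; apply: H1 => //.
  by rewrite phi_lt.
have near_l (Q : set R) :
    (\forall y \near within [set y | 0 <= y] (at_left (phi t)), Q y) ->
    \forall x \near within D (at_left t), Q (phi x).
  move=> H; have {}H : \forall y \near nbhs (phi t), y < phi t -> 0 <= y -> Q y by exact: H.
  have H' : \forall x \near nbhs t, phi x < phi t -> 0 <= phi x -> Q (phi x).
    exact: phic _ H.
  suff : \forall x \near nbhs t, x < t -> D x -> Q (phi x) by [].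
  apply: filterS H' => x /= H1 tx _; apply: H1 => //.
  by rewrite phi_lt.
have lcad j := let: And3 _ H _ := lb j in H w (phi t) (phi0 t).
split.
  have : \forall x \near within D (at_right t), forall j, l j (phi x) w = l j (phi t) w.
    apply: filter_forall => j; apply: (near_r (fun y => l j y w = l j (phi t) w)).
    have [/cvg_nat_near[c [ck cn]] _] := lcad j.
    apply: filterS cn => y yc; apply: val_inj => /=.
    by rewrite yc; exact: ck.
  move=> H; have C : cst (particle sigma w i t) x @[x --> within D (at_right t)] --> particle sigma w i t.
    exact: cvg_cst.
  apply: cvg_trans C.
  apply: near_eq_cvg; apply: filterS H => x Hx.
  rewrite /cst /particle -/(phi x) -/(phi t).
  suff -> : sigma (phi x) w = sigma (phi t) w by [].
  by apply: left_inv_inj => j; rewrite !ls// Hx.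
have [c cE] : exists c : 'I_n -> nat,
    forall j, \forall x \near within D (at_left t), l j (phi x) w = c j :> nat.
  have H j : exists c : nat, \forall x \near within D (at_left t), l j (phi x) w = c :> nat.
    have [_ [l' /cvg_nat_near[c [_ cn]]]] := lcad j.
    by exists c; apply: (near_l (fun y => l j y w = c :> nat)).
  by have [c cE] := choice H; exists c.
have {}cE : \forall x \near within D (at_left t), forall j, l j (phi x) w = c j :> nat.
  exact: filter_forall.
case: (pselect (exists s : 'S_n, left_inv s =1 c)) => [[s sc]|nc].
  exists (n%:R^-1 * (s i).+1%:R).
  have C : cst (n%:R^-1 * (s i).+1%:R : R) x @[x --> within D (at_left t)] --> (n%:R^-1 * (s i).+1%:R : R).
    exact: cvg_cst.
  apply: cvg_trans C.
  apply: near_eq_cvg; apply: filterS cE => x Hx.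
  rewrite /cst /particle -/(phi x).
  suff -> : sigma (phi x) w = s by [].
  by apply: left_inv_inj => j; rewrite !ls// Hx sc.
exists 0 => A _.
have : \forall x \near within D (at_left t), False.
  by apply: filterS cE => x Hx; apply: nc; exists (sigma (phi x) w) => j; rewrite ls.
by apply: filterS.
Qed.

Definition zpath (x a t : R) : R :=
  if t == 0 then a
  else t^-1 * ln ((expR (x * t) * (1 - a) + a * expR t) /
                  (expR (x * t) * (1 - a) + a)).

Lemma zpath_den_gt0 (x a t u : R) : 0 < u -> 0 <= a <= 1 ->
  0 < expR (x * t) * (1 - a) + a * u.
Proof.
move=> u0 /andP[a0 a1]; have := expR_gt0 (x * t); set e := expR _ => e0.
have [->|an0] := eqVneq a 0; first by rewrite subr0 mulr1 mul0r addr0.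
rewrite ltr_wpDl//; first by rewrite mulr_ge0 ?subr_ge0// ltW.
by rewrite mulr_gt0// lt_def an0.
Qed.

Lemma zpath_range (x a t : R) : 0 <= a <= 1 -> 0 <= zpath x a t <= 1.
Proof.
move=> a01; rewrite /zpath; case: eqVneq => // t0.
have N0 := zpath_den_gt0 x t (expR_gt0 t) a01.
have D0 := zpath_den_gt0 x t ltr01 a01; rewrite mulr1 in D0.
have e0 := expR_gt0 (x * t); have [a0 a1] := andP a01.
set N := (X in X / _); set M := (X in _ / X).
have q0 : N / M \is Num.pos by rewrite posrE divr_gt0.
have [tp|tn|] := ltgtP t 0; last by move/eqP; rewrite (negbTE t0).
- rewrite mulr_le0 ?invr_le0 ?(ltW tp)//=; last first.
    rewrite -ln1 ler_ln ?posrE ?ltr01// ler_pdivrMr// mul1r lerD2l.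
    by rewrite ler_piMr// expR_le1 ltW.
  rewrite mulrC ler_ndivrMr// mul1r -{1}(expRK t) ler_ln ?posrE ?expR_gt0//.
  rewrite ler_pdivlMr// /N /M mulrDr [a * _]mulrC lerD2r.
  have e1 : expR t <= 1 by rewrite expR_le1 ltW.
  have b0 : 0 <= expR (x * t) * (1 - a) by rewrite mulr_ge0 ?subr_ge0// ltW.
  exact: ler_piMl.
- rewrite mulr_ge0 ?invr_ge0 ?(ltW tn)//=; last first.
    rewrite -ln1 ler_ln ?posrE ?ltr01// ler_pdivlMr// mul1r lerD2l.
    by rewrite ler_peMr// ltW// expR_gt1.
  rewrite mulrC ler_pdivrMr// mul1r -[leRHS]expRK ler_ln ?posrE ?expR_gt0//.
  rewrite ler_pdivrMr// /N /M [expR t * (_ + _)]mulrDr [a * _]mulrC lerD2r.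
  have e1 : 1 <= expR t by rewrite ltW// expR_gt1.
  have b0 : 0 <= expR (x * t) * (1 - a) by rewrite mulr_ge0 ?subr_ge0// ltW.
  exact: ler_peMl.
Qed.

Lemma zpath_continuous (x a : R) : 0 <= a <= 1 -> continuous (zpath x a).
Proof.
move=> a01.
pose g t := ln (expR (x * t) * (1 - a) + a * expR t) - ln (expR (x * t) * (1 - a) + a).
have dE (t : R) : is_derive t 1 (fun s => expR (x * s)) (x * expR (x * t)).
  have h : is_derive t 1 (fun s => x * s) x.
    have := @is_deriveZ _ _ _ (@id R) x t 1 1 (is_derive_id _ _).
    by move=> /is_derive_eq; apply; rewrite /GRing.scale/= mulr1.
  by have := is_derive1_comp (is_derive_expR (x * t)) h; rewrite mulrC.
have dL (p q t : R) : 0 < expR (x * t) * (1 - a) + (p * expR t + q) ->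
    is_derive t 1 (fun s => ln (expR (x * s) * (1 - a) + (p * expR s + q)))
      ((expR (x * t) * (1 - a) + (p * expR t + q))^-1 *
       (x * expR (x * t) * (1 - a) + p * expR t)).
  move=> pos.
  have H1 := @is_deriveZ _ _ _ _ (1 - a) t 1 _ (dE t).
  have H2 := @is_deriveZ _ _ _ _ p t 1 _ (is_derive_expR t).
  have H := is_deriveD H1 (is_deriveD H2 (is_derive_cst q t 1)).
  have Hi : is_derive t 1 (fun s => expR (x * s) * (1 - a) + (p * expR s + q))
      (x * expR (x * t) * (1 - a) + p * expR t).
    rewrite (_ : (fun s => _) = (1 - a) *: (fun s => expR (x * s)) + (p *: expR + cst q)).
      by apply: is_derive_eq; rewrite /GRing.scale/= addr0 [(1 - a) * _]mulrC.
    by apply/funext => s /=; rewrite mulrC.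
  have Hl := is_derive1_ln pos.
  have HH := (@is_derive1_comp R (@ln R) (fun s => expR (x * s) * (1 - a) + (p * expR s + q)) t _ _ Hl Hi).
  exact: HH.
have gd (t : R) : is_derive t 1 g
   ((expR (x * t) * (1 - a) + a * expR t)^-1 *
       (x * expR (x * t) * (1 - a) + a * expR t) -
    (expR (x * t) * (1 - a) + a)^-1 * (x * expR (x * t) * (1 - a))).
  have N0 := zpath_den_gt0 x t (expR_gt0 t) a01.
  have D0 := zpath_den_gt0 x t ltr01 a01; rewrite mulr1 in D0.
  have := dL a 0 t; rewrite addr0 => /(_ N0) H1.
  have := dL 0 a t; rewrite mul0r add0r => /(_ D0) H2.
  have gE : g = (fun s => ln (expR (x * s) * (1 - a) + (a * expR s + 0))) -
      (fun s => ln (expR (x * s) * (1 - a) + (0 * expR s + a))).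
    by apply/funext => s; rewrite /g -[RHS]/(_ - _) mul0r add0r addr0.
  rewrite gE; have H3 := is_deriveB H1 H2.
  apply: (is_derive_eq H3).
  by rewrite addr0.
have g0 : is_derive (0 : R) 1 g a.
  apply: (is_derive_eq (gd 0)).
  by rewrite !mulr0 !expR0 !mul1r !mulr1; field; lra.
have [h [hE hc h0]] := (is_derive1_caratheodory _ _ _).1 g0.
have zE t : t != 0 -> zpath x a t = t^-1 * g t.
  move=> t0; rewrite /zpath (negbTE t0) /g ln_div// posrE.
    exact: zpath_den_gt0 (expR_gt0 t) a01.
  by have := zpath_den_gt0 x t ltr01 a01; rewrite mulr1.
move=> t; have [->|t0] := eqVneq t 0.
  have hz : h = zpath x a.
    apply/funext => s; have [->|s0] := eqVneq s 0; first by rewrite h0 /zpath eqxx.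
    rewrite zE//; have := hE s; rewrite subr0 => hs.
    have -> : g s = h s * s by rewrite -hs /g !mulr0 !expR0 mulr1 !mul1r subrr subr0.
    by rewrite mulrC mulfK.
  by rewrite -hz.
have cg : (fun s => s^-1 * g s) s @[s --> t] --> t^-1 * g t.
  apply: cvgM; first exact: inv_continuous.
  by apply/differentiable_continuous/derivable1_diffP; have [] := gd t.
rewrite /continuous_at zE//; apply: cvg_trans cg; apply: near_eq_cvg.
have H : \forall s \near nbhs t, s != 0.
  by apply: open_nbhs_nbhs; split => //; exact: open_neq.
by apply: filterS H => s s0; rewrite /= zE.
Qed.

Lemma continuous_cadlag (D : set R) (f : R -> R) : continuous f -> cadlag_on D f.
Proof.
move=> fc t _; split; last exists (f t).
  by apply: cvg_trans (cvg_app f (cvg_within _)) _; exact/cvg_at_right_filter/fc.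
by apply: cvg_trans (cvg_app f (cvg_within _)) _; exact/cvg_at_left_filter/fc.
Qed.

Definition particle_path (n : nat) (d : measure_display) (W : measurableType d)
    (P : probability W R) (sigma : R -> W -> 'S_n)
    (hs : birth_mallows_process P sigma) (T : R) (I : W -> 'I_n) (w : W) :
    skorokhod (- T) T :=
  skorokhod_of (particle_cadlag w (I w) hs)
    (fun t _ => particle_range sigma w (I w) t).

Definition zpath_of (T x a : R) (a01 : 0 <= a <= 1) : skorokhod (- T) T :=
  skorokhod_of (continuous_cadlag (@zpath_continuous x a a01))
    (fun t _ => @zpath_range x a t a01).
End paths.

(* Main.v *)
(* At a fixed time the left inversions are independent truncated geometric
   variables: a transition matrix with the given rates preserves the solution
   [tgeom] of the forward equation. Writing [t = exp (s / n)], [q = 1 / t] and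
   [[m]_t = 1 + t + ... + t^(m-1)], three quantities are almost conserved.

   Along time: the cumulative distribution function of [l_i(t)], evaluated at
   [l_i(t)], has drift O(1); as it is almost uniform at every time, its second
   moment is almost constant, so its increments have variance O(1/i).

   Along positions: the number [m_k] of values larger than [sigma(i)] among the
   first [k] positions satisfies [m_k = m_(k-1) + (l_k <= m_(k-1))], so that
   [[m_k + 1]_q / [k + 1]_q] is a martingale, whose variance is O(1/i).

   Hence [[m_n + 1]_q / [n + 1]_q ~ [l_i + 1]_q / [i + 1]_q], where
   [[l_i + 1]_t / [i]_t] is close to its value at [t = 1], which is close to
   [1 - sigma_1(i) / n]; solving for [m_n = n - sigma(i)] gives [z_(x,a)(s)].
   Between the times of a finite grid the left inversions are monotone, and the
   recursion for [m_k] is monotone in them, which makes the estimate uniform in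
   [s]. Finally [(i, sigma_1(i))] is uniform on the grid. *)
Require Import Defs.
From HB Require Import structures.
From mathcomp Require Import all_boot all_order all_algebra perm.
From mathcomp Require Import all_classical all_reals all_analysis.
From mathcomp Require Import measurable_realfun.
From mathcomp Require Import ring lra zify.

Set Implicit Arguments.
Unset Strict Implicit.
Unset Printing Implicit Defensive.

Import Order.TTheory GRing.Theory Num.Theory.
Import numFieldNormedType.Exports.

Local Open Scope classical_set_scope.
Local Open Scope ring_scope.

(** * Transition functions *)

(** There is no tightness argument: outside an event of small probability the particle is close in
    sup norm to the limit path with parameters (i / n, sigma_1(i) / n). These parameters form a
    uniform pair on a grid, and rounding (X, A) to the same grid gives exactly that law, so both
    expectations are compared with one finite sum. The particle itself is not monotone in time:
    births raise l_i, which increases m_n, and also the l_k of later positions, which decreases it.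
    The sandwich between grid times therefore mixes two times, one for l_i and one for the later
    positions, and the martingale bound is proved for such mixed data. The variances are of order 1
    / i and say nothing for small i; averaging over the uniform index turns 1 / i into the mean of
    the first terms of the harmonic sequence, which tends to 0. A continuous test function need not
    be uniformly continuous on the path space; compactness of the family of limit paths supplies the
    uniformity. *)

Lemma subadditive_le0 (R : realType) (D : R -> R -> R) (a b : R) : a <= b ->
  (forall x y z, a <= x -> x <= y -> y <= z -> z <= b -> D x z <= D x y + D y z) ->
  (forall t, a <= t -> t <= b -> exists2 h, 0 < h &
     forall v w, a <= v -> v <= t -> t <= w -> w <= b -> w - v < h -> D v w <= 0) ->
  D a b <= 0.
Proof.
move=> ab sub loc.
(* Continuous induction: the local hypothesis on intervals containing [sup S] shows that [sup S]
   belongs to [S] and cannot lie below [b]. *)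
pose S := [set x | a <= x <= b /\ D a x <= 0].
have Sa : S a.
  split; first by rewrite lexx.
  by have [h h0] := loc a (lexx _) ab; apply; rewrite ?subrr.
have Sub : has_sup S by split; [exists a | exists b => x [/andP[]]].
have ac : a <= sup S by exact: ub_le_sup Sub.2 _ Sa.
have cb : sup S <= b by apply: ge_sup; [exists a | move=> x [/andP[]]].
have [h h0 hl] := loc (sup S) ac cb.
have [x [/andP[ax xb] Dx] hx] := sup_adherent h0 Sub.
have xc : x <= sup S by apply: ub_le_sup Sub.2 _ _; split => //; rewrite ax.
have key y : sup S <= y -> y <= b -> y < x + h -> D a y <= 0.
  move=> cy yb yx; apply: (le_trans (sub a x y (lexx _) ax (le_trans xc cy) yb)).
  by rewrite -(addr0 0) lerD// hl//; lra.
have [cltb|] := ltP (sup S) b; last by move=> bc; apply: key => //; lra.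
pose y := Num.min b ((sup S + (x + h)) / 2).
have yb : y <= b by rewrite /y ge_min lexx.
have cy : sup S < y by rewrite /y lt_min cltb/=; lra.
have yx : y < x + h by rewrite /y gt_min; apply/orP; right; lra.
have : y <= sup S.
  apply: ub_le_sup Sub.2 _ _; split; last exact: key (ltW cy) yb yx.
  by rewrite yb (le_trans ac (ltW cy)).
by rewrite leNgt cy.
Qed.

(* Increments over intervals containing [t], as in [transition_function]. *)
Definition straddle_derive (R : realType) (f : R -> R) (t l : R) : Prop :=
  forall e : R, 0 < e -> \forall h \near 0^'+, forall x y, x <= t -> t <= y ->
    y - x < h -> `|f y - f x - (y - x) * l| <= e * (y - x).

Lemma near_right_exists (R : realType) (Q : R -> Prop) :
  (forall h h', h <= h' -> Q h' -> Q h) ->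
  (exists2 h, 0 < h & Q h) -> \forall h \near (0 : R)^'+, Q h.
Proof.
move=> mono [h h0 Qh]; near=> k; apply: mono Qh; near: k.
exact: nbhs_right_le.
Unshelve. all: by end_near. Qed.

(** Cut at [t]: the errors on the two sides carry the nonnegative weights [y - t] and [t - x], and
    so add up to at most [e * (y - x)]. *)
Lemma is_derive_straddle (R : realType) (f : R -> R) (t l : R) :
  is_derive t 1 f l -> straddle_derive f t l.
Proof.
move=> fl e e0; have [g [fE gc gt]] := (is_derive1_caratheodory _ _ _).1 fl.
move: gc => /cvgrPdist_le/(_ e e0); rewrite gt.
move=> /nbhs_ballP[h /= h0 H].
apply: near_right_exists; first by move=> h1 h2 h12 H2 x y xt ty /lt_le_trans/(_ h12)/H2; exact.
exists h => // x y xt ty yx.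
have gx : `|l - g x| <= e by apply: H; rewrite /ball/= ger0_norm; lra.
have gy : `|l - g y| <= e by apply: H; rewrite /ball/= ler0_norm; lra.
have -> : f y - f x - (y - x) * l = (g y - l) * (y - t) + (g x - l) * (t - x).
  have := fE y; have := fE x; move=> Ex Ey.
  have -> : f y - f x = (f y - f t) - (f x - f t) by ring.
  by rewrite Ex Ey; ring.
apply: (le_trans (ler_normD _ _)); rewrite !normrM (ger0_norm (_ : 0 <= y - t)) ?(ger0_norm (_ : 0 <= t - x)); try lra.
rewrite (_ : e * (y - x) = e * (y - t) + e * (t - x)); last by ring.
by apply: lerD; apply: ler_wpM2r; rewrite ?subr_ge0// distrC.
Qed.

Section transition.
Variables (R : realType) (m : nat) (G : R -> 'M[R]_m) (K : R -> R -> 'M[R]_m).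
Hypothesis GK : transition_function G K.

Lemma transition_ge0 s u j k : 0 <= s -> s <= u -> 0 <= K s u j k.
Proof. by move=> s0 su; have [+ _ _] := GK => /(_ s u s0 su)[]. Qed.

Lemma transition_sum1 s u j : 0 <= s -> s <= u -> \sum_k K s u j k = 1.
Proof. by move=> s0 su; have [+ _ _] := GK => /(_ s u s0 su)[]. Qed.

Lemma transition_le1 s u j k : 0 <= s -> s <= u -> K s u j k <= 1.
Proof.
move=> s0 su; rewrite -(transition_sum1 j s0 su) (bigD1 k)//= lerDl.
by apply: sumr_ge0 => l _; exact: transition_ge0.
Qed.

(** On the degenerate interval [[s, s]] the generator clause has error bound 0. *)
Lemma transition_id s j k : 0 <= s -> K s s j k = (j == k)%:R.
Proof.
move=> s0; have [_ _ /(_ s j k s0 1 ltr01)[h h0 /(_ s s s0 (lexx _) (lexx _))]] := GK.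
rewrite subrr mul0r addr0 mulr0 => /(_ h0); rewrite normr_le0 subr_eq0.
by move/eqP.
Qed.

Lemma transition_near t e : 0 <= t -> 0 < e -> \forall h \near 0^'+,
  forall j k x y, 0 <= x -> x <= t -> t <= y -> y - x < h ->
    `|K x y j k - ((j == k)%:R + (y - x) * G t j k)| <= e * (y - x).
Proof.
move=> t0 e0.
apply: (@filter_forall _ _ (fun j h => forall k x y, 0 <= x -> x <= t -> t <= y ->
  y - x < h -> `|K x y j k - ((j == k)%:R + (y - x) * G t j k)| <= e * (y - x))) => j.
apply: (@filter_forall _ _ (fun k h => forall x y, 0 <= x -> x <= t -> t <= y ->
  y - x < h -> `|K x y j k - ((j == k)%:R + (y - x) * G t j k)| <= e * (y - x))) => k.
have [_ _ /(_ t j k t0 e e0)[h h0 H]] := GK.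
apply: near_right_exists; last by exists h.
by move=> h1 h2 h12 H2 x y x0 xt ty yx; apply: H2 => //; exact: lt_le_trans h12.
Qed.

(** An inequality form of Dynkin's formula. By Chapman-Kolmogorov the increment of [W] over a short
    interval is an average of increments of [v], each bounded locally by the drift. Applied to [- v]
    it yields lower bounds. *)
Lemma backward_equation_le (v dv : R -> 'I_m -> R) (s u rho : R) :
  0 <= s -> s <= u ->
  (forall t k, s <= t <= u -> straddle_derive (v ^~ k) t (dv t k)) ->
  (forall t j, s <= t <= u -> dv t j + \sum_k G t j k * v t k <= rho) ->
  forall j, \sum_k K s u j k * v u k <= v s j + rho * (u - s).
Proof.
move=> s0 su vd vG i.
apply/ler_addgt0Pl => e' e'0.
pose e := e' / (u - s + 1).
have e0 : 0 < e by rewrite divr_gt0//; lra.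
pose W x := \sum_k K s x i k * v x k.
suff : W u - W s - (rho + e) * (u - s) <= 0.
  have -> : W s = v s i.
    rewrite /W (bigD1 i)//= transition_id// eqxx mul1r big1 ?addr0// => k ki.
    by rewrite transition_id// eq_sym (negbTE ki) mul0r.
  rewrite /W => H.
  have : e * (u - s) <= e'.
    by rewrite /e mulrAC ler_pdivrMr ?ler_pM2l//; lra.
  rewrite mulrDl in H; lra.
apply: (@subadditive_le0 R (fun x y => W y - W x - (rho + e) * (y - x))) => //.
  by move=> x y z _ _ _ _; rewrite le_eqVlt; apply/orP; left; apply/eqP; ring.
move=> t st tu; have t0 : 0 <= t by exact: le_trans st.
(* One summand for each source of error: [K] against its generator, [v] against its derivative, and
   the variation of [v] inside the generator term. *)
pose C := \sum_k (`|v t k| + 1) + 1 + \sum_j \sum_k `|G t j k|.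
have C0 : 0 < C.
  rewrite /C ltr_wpDr ?sumr_ge0// => [j _|]; first exact: sumr_ge0.
  by rewrite ltr_wpDl// sumr_ge0// => k _; rewrite addr_ge0.
pose d := e / C; have d0 : 0 < d by exact: divr_gt0.
suff : \forall h \near 0^'+, forall x y, s <= x -> x <= t -> t <= y -> y <= u -> y - x < h ->
    forall j, \sum_k K x y j k * v y k - v x j <= (rho + e) * (y - x).
  case/nbhs_ballP => h /= h0 H.
  exists (h / 2); first lra.
  move=> x y sx xt ty yu yx.
  have {}H j : \sum_k K x y j k * v y k - v x j <= (rho + e) * (y - x).
    by apply: (H (h / 2)) => //; rewrite /ball/= ?sub0r ?normrN ?ger0_norm; lra.
  have x0 : 0 <= x by exact: le_trans sx.
  have -> : W y = \sum_j K s x i j * \sum_k K x y j k * v y k.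
    rewrite /W; have [_ /(_ s x y s0 sx (le_trans xt ty)) -> _] := GK.
    under eq_bigr => k _ do rewrite mxE big_distrl /=.
    rewrite exchange_big /=; apply: eq_bigr => j _; rewrite big_distrr /=.
    by apply: eq_bigr => k _; rewrite mulrA.
  rewrite /W -sumrB subr_le0.
  apply: (@le_trans _ _ (\sum_j K s x i j * ((rho + e) * (y - x)))).
    by apply: ler_sum => j _; rewrite -mulrBr ler_wpM2l// transition_ge0.
  by rewrite -big_distrl /= transition_sum1// mul1r.
have nv c : 0 < c -> \forall h \near 0^'+, forall k x y, x <= t -> t <= y ->
    y - x < h -> `|v y k - v x k - (y - x) * dv t k| <= c * (y - x).
  move=> c0; apply: (@filter_forall _ _ (fun k h => forall x y, x <= t -> t <= y ->
    y - x < h -> `|v y k - v x k - (y - x) * dv t k| <= c * (y - x))) => k.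
  by apply: vd => //; rewrite st.
pose B := \sum_k `|dv t k| + 1.
have B0 : 0 < B by rewrite ltr_wpDl// sumr_ge0.
(* [d1 <= 1] keeps [v] within 1 of its value at [t]; [d1 <= d] makes its variation negligible. *)
pose d1 := Num.min d 1; have d10 : 0 < d1 by rewrite lt_min d0 ltr01.
near=> h.
have H1 : forall k x y, x <= t -> t <= y ->
    y - x < h -> `|v y k - v x k - (y - x) * dv t k| <= d * (y - x).
  by near: h; exact: nv.
have H2 : forall k x y, x <= t -> t <= y ->
    y - x < h -> `|v y k - v x k - (y - x) * dv t k| <= 1 * (y - x).
  by near: h; apply: nv.
have H3 : forall j k x y, 0 <= x -> x <= t -> t <= y -> y - x < h ->
    `|K x y j k - ((j == k)%:R + (y - x) * G t j k)| <= d * (y - x).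
  by near: h; exact: transition_near.
have hB : h <= d1 / B by near: h; apply: nbhs_right_le; exact: divr_gt0.
move=> x y sx xt ty yu yx j.
have x0 : 0 <= x by exact: le_trans sx.
have xy : 0 <= y - x by lra.
have vyt k : `|v y k - v t k| <= d1.
  have : `|v y k - v t k - (y - t) * dv t k| <= 1 * (y - t) by apply: H2 => //; lra.
  rewrite mul1r => H.
  have h1 : `|v y k - v t k| <= (y - t) * B.
    rewrite -[X in `|X|](subrK ((y - t) * dv t k)); apply: (le_trans (ler_normD _ _)).
    rewrite normrM (ger0_norm (_ : 0 <= y - t)); last lra.
    have : `|dv t k| <= \sum_k `|dv t k| by rewrite (bigD1 k)//= lerDl sumr_ge0.
    move=> H'; have := ler_wpM2l (_ : 0 <= y - t) H'; rewrite /B => /(_ ltac:(lra)); lra.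
  apply: (le_trans h1); rewrite -ler_pdivlMr//; lra.
have vy k : `|v y k| <= `|v t k| + 1.
  have := ler_normD (v y k - v t k) (v t k); rewrite subrK => h1.
  have := vyt k; have : d1 <= 1 by rewrite ge_min lexx orbT.
  by lra.
have E : \sum_k K x y j k * v y k - v x j =
   \sum_k (K x y j k - ((j == k)%:R + (y - x) * G t j k)) * v y k
   + (v y j - v x j - (y - x) * dv t j)
   + (y - x) * (\sum_k G t j k * (v y k - v t k))
   + (y - x) * (dv t j + \sum_k G t j k * v t k).
  have h1 : \sum_k (K x y j k - ((j == k)%:R + (y - x) * G t j k)) * v y k =
      \sum_k K x y j k * v y k - v y j - (y - x) * \sum_k G t j k * v y k.
    transitivity (\sum_k (K x y j k * v y k - (j == k)%:R * v y k - (y - x) * (G t j k * v y k))).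
      by apply: eq_bigr => k _; ring.
    rewrite !sumrB -mulr_sumr; congr (_ - _ - _).
    rewrite (bigD1 j)//= eqxx mul1r big1 ?addr0// => k kj.
    by rewrite eq_sym (negbTE kj) mul0r.
  have h2 : \sum_k G t j k * (v y k - v t k) = \sum_k G t j k * v y k - \sum_k G t j k * v t k.
    by rewrite -sumrB; apply: eq_bigr => k _; ring.
  by rewrite h1 h2; ring.
rewrite E (_ : (rho + e) * (y - x) = e * (y - x) + rho * (y - x)); last by ring.
apply: lerD; last first.
  by rewrite mulrC; apply: ler_wpM2r => //; apply: vG; rewrite st.
have -> : e = d * C by rewrite /d divfK// gt_eqF.
apply: (le_trans (ler_norm _)).
have b1 : `|\sum_k (K x y j k - ((j == k)%:R + (y - x) * G t j k)) * v y k|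
    <= d * (y - x) * \sum_k (`|v t k| + 1).
  apply: (le_trans (ler_norm_sum _ _ _)); rewrite mulr_sumr; apply: ler_sum => k _.
  by rewrite normrM ler_pM// H3.
have b2 : `|v y j - v x j - (y - x) * dv t j| <= d * (y - x) by apply: H1.
have b3 : `|(y - x) * (\sum_k G t j k * (v y k - v t k))| <=
    d * (y - x) * \sum_j \sum_k `|G t j k|.
  rewrite normrM ger0_norm// [d * _]mulrC -mulrA ler_wpM2l//.
  apply: (le_trans (ler_norm_sum _ _ _)).
  apply: (@le_trans _ _ (\sum_k d * `|G t j k|)).
    apply: ler_sum => k _; rewrite normrM mulrC ler_wpM2r//.
    by apply: le_trans (vyt k) _; rewrite ge_min lexx.
  rewrite -mulr_sumr ler_wpM2l ?(ltW d0)// [leRHS](bigD1 j)//= lerDl.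
  by apply: sumr_ge0 => l _; exact: sumr_ge0.
have := ler_normD (\sum_k (K x y j k - ((j == k)%:R + (y - x) * G t j k)) * v y k
   + (v y j - v x j - (y - x) * dv t j)) ((y - x) * (\sum_k G t j k * (v y k - v t k))).
have := ler_normD (\sum_k (K x y j k - ((j == k)%:R + (y - x) * G t j k)) * v y k)
   (v y j - v x j - (y - x) * dv t j).
rewrite (_ : d * C * (y - x) = d * (y - x) * (\sum_k (`|v t k| + 1)) + d * (y - x)
  + d * (y - x) * (\sum_j \sum_k `|G t j k|)); last by rewrite /C; ring.
lra.
Unshelve. all: by end_near. Qed.

(** [Z] interpolates: at [x = s] it is the left-hand side, at [x = u] it is [f u i]. Its increments
    vanish to first order because [f] solves the equation locally and the entries of [K] are at most
    1. *)
Lemma forward_equation (f df : R -> 'I_m -> R) (s u : R) :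
  0 <= s -> s <= u ->
  (forall t k, s <= t <= u -> straddle_derive (f ^~ k) t (df t k)) ->
  (forall t k, s <= t <= u -> df t k = \sum_j f t j * G t j k) ->
  forall k, \sum_j f s j * K s u j k = f u k.
Proof.
move=> s0 su fd fG i.
apply/eqP; rewrite -subr_eq0 -normr_le0 distrC; apply/ler_addgt0Pl => e' e'0.
rewrite addr0.
pose e := e' / (u - s + 1).
have e0 : 0 < e by rewrite divr_gt0//; lra.
pose Z x := \sum_j f x j * K x u j i.
suff : `|Z u - Z s| - e * (u - s) <= 0.
  have -> : Z u = f u i.
    have u0 : 0 <= u by exact: le_trans su.
    rewrite /Z (bigD1 i)//= transition_id// eqxx mulr1 big1 ?addr0// => k ki.
    by rewrite transition_id// (negbTE ki) mulr0.
  rewrite /Z => H.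
  have : e * (u - s) <= e'.
    by rewrite /e mulrAC ler_pdivrMr ?ler_pM2l//; lra.
  lra.
apply: (@subadditive_le0 R (fun x y => `|Z y - Z x| - e * (y - x))) => //.
  move=> x y z _ _ _ _; have := ler_distD (Z y) (Z z) (Z x); lra.
move=> t st tu; have t0 : 0 <= t by exact: le_trans st.
pose C := \sum_k (`|f t k| + 1) + 1 + \sum_j \sum_k `|G t j k|.
have C0 : 0 < C.
  rewrite /C ltr_wpDr ?sumr_ge0// => [j _|]; first exact: sumr_ge0.
  by rewrite ltr_wpDl// sumr_ge0// => k _; rewrite addr_ge0.
(* The error is summed over the [m] states; [m.+1] keeps the divisor positive when [m = 0]. *)
pose d := e / (C * m.+1%:R).
have d0 : 0 < d by rewrite divr_gt0// mulr_gt0.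
suff : \forall h \near 0^'+, forall x y, s <= x -> x <= t -> t <= y -> y <= u -> y - x < h ->
    forall k, `|\sum_j f x j * K x y j k - f y k| <= d * C * (y - x).
  case/nbhs_ballP => h /= h0 H.
  exists (h / 2); first lra.
  move=> x y sx xt ty yu yx.
  have {}H k : `|\sum_j f x j * K x y j k - f y k| <= d * C * (y - x).
    by apply: (H (h / 2)) => //; rewrite /ball/= ?sub0r ?normrN ?ger0_norm; lra.
  have x0 : 0 <= x by exact: le_trans sx.
  have y0 : 0 <= y by lra.
  have -> : Z x = \sum_k (\sum_j f x j * K x y j k) * K y u k i.
    rewrite /Z; have [_ /(_ x y u x0 (le_trans xt ty) yu) -> _] := GK.
    under eq_bigr => k _ do rewrite mxE big_distrr /=.
    rewrite exchange_big /=; apply: eq_bigr => j _; rewrite big_distrl /=.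
    by apply: eq_bigr => k _; rewrite mulrA.
  rewrite distrC /Z -sumrB subr_le0.
  apply: (le_trans (ler_norm_sum _ _ _)).
  apply: (@le_trans _ _ (\sum_(k < m) d * C * (y - x))).
    apply: ler_sum => k _; rewrite -mulrBl normrM -[leRHS]mulr1 ler_pM//.
    by rewrite ger0_norm ?transition_ge0// transition_le1.
  rewrite sumr_const card_ord -mulr_natr mulrAC ler_wpM2r//; first lra.
  rewrite /d (_ : _ * C * _ = e * (m%:R / m.+1%:R)); last first.
    by field; rewrite nat1r pnatr_eq0/= gt_eqF.
  by rewrite ler_piMr ?(ltW e0)// ler_pdivrMr// mul1r ler_nat.
have nf c : 0 < c -> \forall h \near 0^'+, forall k x y, x <= t -> t <= y ->
    y - x < h -> `|f y k - f x k - (y - x) * df t k| <= c * (y - x).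
  move=> c0; apply: (@filter_forall _ _ (fun k h => forall x y, x <= t -> t <= y ->
    y - x < h -> `|f y k - f x k - (y - x) * df t k| <= c * (y - x))) => k.
  by apply: fd => //; rewrite st.
pose B := \sum_k `|df t k| + 1.
have B0 : 0 < B by rewrite ltr_wpDl// sumr_ge0.
pose d1 := Num.min d 1; have d10 : 0 < d1 by rewrite lt_min d0 ltr01.
near=> h.
have H1 : forall k x y, x <= t -> t <= y ->
    y - x < h -> `|f y k - f x k - (y - x) * df t k| <= d * (y - x).
  by near: h; exact: nf.
have H2 : forall k x y, x <= t -> t <= y ->
    y - x < h -> `|f y k - f x k - (y - x) * df t k| <= 1 * (y - x).
  by near: h; apply: nf.
have H3 : forall j k x y, 0 <= x -> x <= t -> t <= y -> y - x < h ->
    `|K x y j k - ((j == k)%:R + (y - x) * G t j k)| <= d * (y - x).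
  by near: h; exact: transition_near.
have hB : h <= d1 / B by near: h; apply: nbhs_right_le; exact: divr_gt0.
move=> x y sx xt ty yu yx k.
have x0 : 0 <= x by exact: le_trans sx.
have xy : 0 <= y - x by lra.
have fxt j : `|f x j - f t j| <= d1.
  have : `|f t j - f x j - (t - x) * df t j| <= 1 * (t - x) by apply: H2 => //; lra.
  rewrite mul1r => H.
  have h1 : `|f t j - f x j| <= (t - x) * B.
    rewrite -[X in `|X|](subrK ((t - x) * df t j)); apply: (le_trans (ler_normD _ _)).
    rewrite normrM (ger0_norm (_ : 0 <= t - x)); last lra.
    have : `|df t j| <= \sum_k `|df t k| by rewrite (bigD1 j)//= lerDl sumr_ge0.
    move=> H'; have := ler_wpM2l (_ : 0 <= t - x) H'; rewrite /B => /(_ ltac:(lra)); lra.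
  rewrite distrC; apply: (le_trans h1); rewrite -ler_pdivlMr//; lra.
have fx j : `|f x j| <= `|f t j| + 1.
  have := ler_normD (f x j - f t j) (f t j); rewrite subrK => h1.
  have := fxt j; have : d1 <= 1 by rewrite ge_min lexx orbT.
  by lra.
have E : \sum_j f x j * K x y j k - f y k =
   \sum_j f x j * (K x y j k - ((j == k)%:R + (y - x) * G t j k))
   - (f y k - f x k - (y - x) * df t k)
   + (y - x) * (\sum_j (f x j - f t j) * G t j k).
  have h1 : \sum_j f x j * (K x y j k - ((j == k)%:R + (y - x) * G t j k)) =
      \sum_j f x j * K x y j k - f x k - (y - x) * \sum_j f x j * G t j k.
    transitivity (\sum_j (f x j * K x y j k - f x j * (j == k)%:R - (y - x) * (f x j * G t j k))).
      by apply: eq_bigr => j _; ring.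
    rewrite !sumrB -mulr_sumr; congr (_ - _ - _).
    rewrite (bigD1 k)//= eqxx mulr1 big1 ?addr0// => j jk.
    by rewrite (negbTE jk) mulr0.
  have h2 : \sum_j (f x j - f t j) * G t j k = \sum_j f x j * G t j k - \sum_j f t j * G t j k.
    by rewrite -sumrB; apply: eq_bigr => j _; ring.
  by rewrite h1 h2 fG ?st//; ring.
rewrite E.
have b1 : `|\sum_j f x j * (K x y j k - ((j == k)%:R + (y - x) * G t j k))|
    <= d * (y - x) * \sum_k (`|f t k| + 1).
  apply: (le_trans (ler_norm_sum _ _ _)); rewrite mulr_sumr; apply: ler_sum => j _.
  by rewrite normrM mulrC ler_pM// H3.
have b2 : `|f y k - f x k - (y - x) * df t k| <= d * (y - x) by apply: H1.
have b3 : `|(y - x) * (\sum_j (f x j - f t j) * G t j k)| <=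
    d * (y - x) * \sum_j \sum_k `|G t j k|.
  rewrite normrM ger0_norm// [d * _]mulrC -mulrA ler_wpM2l//.
  apply: (le_trans (ler_norm_sum _ _ _)).
  rewrite mulr_sumr; apply: ler_sum => j _; rewrite normrM ler_pM//.
    by apply: le_trans (fxt j) _; rewrite ge_min lexx.
  by rewrite (bigD1 k)//= lerDl sumr_ge0.
apply: (le_trans (ler_normD _ _)).
have := ler_normB (\sum_j f x j * (K x y j k - ((j == k)%:R + (y - x) * G t j k)))
   (f y k - f x k - (y - x) * df t k).
rewrite (_ : d * C * (y - x) = d * (y - x) * (\sum_k (`|f t k| + 1)) + d * (y - x)
  + d * (y - x) * (\sum_j \sum_k `|G t j k|)); last by rewrite /C; ring.
lra.
Unshelve. all: by end_near. Qed.

End transition.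

(** * Truncated geometric laws and birth rates *)

Section qnat.
Variable R : realType.
Implicit Types (t : R) (m k : nat).

(** The q-integer [[m]_t], written as a polynomial so that [t = 1] is no special case. *)
Definition qnat t m : R := \sum_(a < m) t ^+ a.
Definition dqnat t m : R := \sum_(a < m) a%:R * t ^+ a.-1.

Lemma qnat0 t : qnat t 0 = 0. Proof. by rewrite /qnat big_ord0. Qed.

Lemma qnatS t m : qnat t m.+1 = qnat t m + t ^+ m.
Proof. by rewrite /qnat big_ord_recr. Qed.

Lemma dqnatS t m : dqnat t m.+1 = dqnat t m + m%:R * t ^+ m.-1.
Proof. by rewrite /dqnat big_ord_recr. Qed.

Lemma qnat1 m : qnat 1 m = m%:R.
Proof.
by rewrite /qnat (eq_bigr (fun=> 1)) ?sumr_const ?card_ord// => a _; rewrite expr1n.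
Qed.

Lemma qnatE t m : qnat t m * (t - 1) = t ^+ m - 1.
Proof. by rewrite subrX1 mulrC. Qed.

Lemma dqnatE t m : dqnat t m * (t - 1) + qnat t m = m%:R * t ^+ m.-1.
Proof.
elim: m => [|m IH]; first by rewrite /dqnat qnat0 big_ord0 !mul0r addr0.
rewrite dqnatS qnatS mulrDl addrACA IH /= -natr1.
by case: m {IH} => [|m] /=; rewrite ?exprS; ring.
Qed.

Lemma qnat_ge0 t m : 0 <= t -> 0 <= qnat t m.
Proof. by move=> t0; apply: sumr_ge0 => a _; exact: exprn_ge0. Qed.

Lemma dqnat_ge0 t m : 0 <= t -> 0 <= dqnat t m.
Proof. by move=> t0; apply: sumr_ge0 => a _; rewrite mulr_ge0// exprn_ge0. Qed.

Lemma qnat_gt0 t m : 0 <= t -> 0 < qnat t m.+1.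
Proof.
move=> t0; rewrite /qnat big_ord_recl expr0 ltr_wpDr// sumr_ge0// => a _.
exact: exprn_ge0.
Qed.

Lemma ler_qnat t : 0 <= t -> {homo qnat t : k m / (k <= m)%N >-> k <= m}.
Proof.
move=> t0; apply: homo_leq => [//|x y z xy|m]; first exact: le_trans.
by rewrite qnatS lerDl exprn_ge0.
Qed.

Lemma is_derive_qnat t m : is_derive t 1 (fun x => qnat x m) (dqnat t m).
Proof.
rewrite (_ : (fun x => qnat x m) = \sum_(a < m) (id : R -> R) ^+ a); last first.
  apply/funext => x; rewrite fct_sumE /qnat; apply: eq_bigr => a _.
  elim: (a : nat) => [|b IH]; first by rewrite !expr0.
  by rewrite !exprS IH.
apply: is_derive_eq.
by apply: eq_bigr => a _; rewrite /GRing.scale/= mulr1.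
Qed.

(** Raising [m] by one adds the sum over [a < k] of [(m - a) t^(a + m - 1)], whose terms are
    nonnegative. It expresses that [[k]_t / [m]_t] does not increase with [t], which makes the rates
    nonnegative. *)
Lemma dqnat_wronskian t m k : 0 <= t -> (k <= m)%N ->
  0 <= qnat t k * dqnat t m - dqnat t k * qnat t m.
Proof.
move=> t0; elim: m => [|m IH]; first by rewrite leqn0 => /eqP ->; rewrite mulrC subrr.
rewrite leq_eqVlt => /predU1P[->|]; first by rewrite mulrC subrr.
rewrite ltnS => km; rewrite dqnatS qnatS !mulrDr opprD addrACA.
rewrite -[leLHS](addr0 0) lerD ?IH//.
rewrite /qnat /dqnat !mulr_suml -sumrB sumr_ge0// => -[a ak] _ /=.
have am : (a <= m)%N by exact: leq_trans (ltnW ak) km.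
case: m km am IH => [|m] km am IH /=.
  by move: am; rewrite leqn0 => /eqP->; rewrite expr0 !mul0r mulr0 subrr.
case: a ak am => [|a] ak am /=.
  by rewrite !mul0r subr0 !mulr_ge0// exprn_ge0.
rewrite subr_ge0 mulrCA -!mulrA -!exprD addnS addSn.
by rewrite ler_wpM2r ?exprn_ge0// ler_nat.
Qed.

(** The right-hand side is the numerator of minus the derivative of [[k+1]_t / [m]_t]. Cleared of
    denominators, the identity extends across the singularity of the rate formula at [t = 1], where
    it is checked separately. *)
Lemma birth_rate_qnat t m k : 0 <= t -> (k < m)%N ->
  birth_rate m k t * t ^+ k * qnat t m =
  qnat t k.+1 * dqnat t m - dqnat t k.+1 * qnat t m.
Proof.
move=> t0 km; rewrite /birth_rate; have mE : (m = (m - k - 1) + k.+1)%N by lia.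
case: eqVneq => [->|t1].
  rewrite !qnat1 expr1n mulr1.
  have d1 l : dqnat 1 l = 2^-1 * l%:R * l%:R - 2^-1 * l%:R.
    elim: l => [|l IH]; first by rewrite /dqnat big_ord0; ring.
    by rewrite dqnatS IH expr1n -natr1; field.
  have mR : m%:R = (m - k - 1)%:R + k.+1%:R :> R by rewrite -natrD -mE.
  by rewrite !d1 mR; move: (m - k - 1)%N => r; field.
have u0 : t - 1 != 0 by rewrite subr_eq0.
have u0' : 1 - t != 0 by rewrite subr_eq0 eq_sym.
have A0 : t ^+ m - 1 != 0.
  by rewrite subr_eq0 pexpr_eq1//; exact: leq_ltn_trans km.
have qE l : qnat t l = (t ^+ l - 1) / (t - 1) by rewrite -qnatE mulfK.
have dE l : dqnat t l = (l%:R * t ^+ l.-1 - qnat t l) / (t - 1).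
  by rewrite -dqnatE addrK mulfK.
have mP : t ^+ m.-1 = t ^+ (m - k - 1) * t ^+ k by rewrite -exprD; congr (_ ^+ _); lia.
rewrite !dE !qE mP.
by field; rewrite u0 u0' A0.
Qed.

Lemma birth_rate_top t m : 0 <= t -> birth_rate m.+1 m t = 0.
Proof.
move=> t0; rewrite /birth_rate subSn// subnn subnn.
case: eqVneq => [_|t1]; first by rewrite mulr0.
have A0 : t ^+ m.+1 - 1 != 0 by rewrite subr_eq0 pexpr_eq1.
by rewrite expr0 mulr1 mulfK// subrr mulr0.
Qed.

Lemma birth_rate_ge0 t m k : 0 <= t -> (k < m)%N -> 0 <= birth_rate m k t.
Proof.
(* At [t = 0] the factor [t ^+ k] cannot be cancelled; with [0 ^+ 0 = 1] the rate is 0 at the top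
   state and [k.+1] below it. *)
move=> t0 km; have [->|tn0] := eqVneq t 0.
  rewrite /birth_rate eq_sym oner_eq0 subr0 invr1 mul1r !expr0n.
  have [E|] := eqVneq (m - k - 1)%N 0%N.
    have -> : m = k.+1 by lia.
    by rewrite mulr1 mulfK ?subrr//= sub0r oppr_eq0 oner_eq0.
  by rewrite mulr0 !mul0r subr0.
have tp : 0 < t by rewrite lt_def tn0.
case: m km => // m km.
rewrite -(pmulr_lge0 _ (exprn_gt0 k tp)) -(pmulr_lge0 _ (qnat_gt0 m t0)).
by rewrite birth_rate_qnat// dqnat_wronskian.
Qed.

(** The value at [k] is the mass of [{0, ..., k - 1}], so the distribution function at [k] is read
    at [k.+1]. *)
Definition tgeom_cdf m t k : R := qnat t k / qnat t m.
Definition tgeom m t k : R := t ^+ k / qnat t m.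

Lemma tgeom_cdfS m t k : tgeom_cdf m t k.+1 - tgeom_cdf m t k = tgeom m t k.
Proof. by rewrite /tgeom_cdf /tgeom -mulrBl qnatS addrAC subrr add0r. Qed.

Lemma tgeom_ge0 m t k : 0 <= t -> 0 <= tgeom m t k.
Proof. by move=> t0; rewrite mulr_ge0 ?invr_ge0 ?exprn_ge0 ?qnat_ge0. Qed.

Lemma tgeom_cdf_ge0 m t k : 0 <= t -> 0 <= tgeom_cdf m t k.
Proof. by move=> t0; rewrite mulr_ge0 ?invr_ge0 ?qnat_ge0. Qed.

Lemma tgeom_cdf_le1 m t k : 0 <= t -> (k <= m)%N -> tgeom_cdf m t k <= 1.
Proof.
move=> t0; case: m => [|m] km; first by rewrite /tgeom_cdf qnat0 invr0 mulr0.
by rewrite ler_pdivrMr ?qnat_gt0// mul1r ler_qnat.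
Qed.

Lemma tgeom_cdf0 m t : tgeom_cdf m t 0 = 0.
Proof. by rewrite /tgeom_cdf qnat0 mul0r. Qed.

Lemma tgeom_cdf1 m t : 0 <= t -> tgeom_cdf m.+1 t m.+1 = 1.
Proof. by move=> t0; rewrite /tgeom_cdf divff// gt_eqF ?qnat_gt0. Qed.

Lemma sum_tgeom m t k : \sum_(j < k) tgeom m t j = tgeom_cdf m t k.
Proof.
elim: k => [|k IH]; first by rewrite big_ord0 tgeom_cdf0.
by rewrite big_ord_recr/= IH -tgeom_cdfS addrC subrK.
Qed.

(** Mass leaves [{0, ..., k}] only by the jump from [k] to [k.+1]: this is the forward equation in
    summed form. *)
Lemma is_derive_tgeom_cdf m t k : 0 <= t -> (k < m)%N ->
  is_derive t 1 (fun x => tgeom_cdf m x k.+1) (- (birth_rate m k t * tgeom m t k)).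
Proof.
move=> t0 km; case: m km => // m km.
have q0 : qnat t m.+1 != 0 by rewrite gt_eqF ?qnat_gt0.
have dV := @is_deriveV R _ _ _ _ q0 (is_derive_qnat t m.+1).
have dM := is_deriveM (is_derive_qnat t k.+1) dV.
apply: (is_derive_eq dM).
have <- : birth_rate m.+1 k t * t ^+ k * qnat t m.+1 / qnat t m.+1 ^+ 2 =
  birth_rate m.+1 k t * tgeom m.+1 t k by rewrite /tgeom; field.
by rewrite birth_rate_qnat// /GRing.scale/=; field.
Qed.

Lemma birth_flux_ge0 m t k : 0 <= t -> (k < m)%N ->
  0 <= birth_rate m k t * tgeom m t k.
Proof. by move=> t0 km; rewrite mulr_ge0 ?birth_rate_ge0 ?tgeom_ge0. Qed.

Section bounds.
Variables (m : nat) (t B : R).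
Hypotheses (t0 : 0 <= t) (B0 : 0 < B).
Hypothesis tB : forall a, (a <= m)%N -> B^-1 <= t ^+ a <= B.

Lemma qnat_lower k : (k <= m)%N -> k%:R / B <= qnat t k.
Proof.
move=> km; rewrite mulr_natl -[X in _ *+ X]card_ord -sumr_const.
by apply: ler_sum => a _; have /andP[] := tB (leq_trans (ltnW (ltn_ord a)) km).
Qed.

Lemma tgeom_le k : (k < m)%N -> tgeom m t k <= B ^+ 2 / m%:R.
Proof.
move=> km; have m0 : 0 < m%:R :> R by rewrite ltr0n; exact: leq_ltn_trans km.
have q0 : 0 < m%:R / B by exact: divr_gt0.
have qm := qnat_lower (leqnn m).
have /andP[_ tk] := tB (ltnW km).
rewrite /tgeom ler_pdivrMr; last exact: lt_le_trans qm.
apply: (le_trans tk); rewrite -[leLHS](_ : B ^+ 2 / m%:R * (m%:R / B) = B).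
  by apply: ler_wpM2l => //; rewrite divr_ge0 ?exprn_ge0// ltW.
by field; rewrite !gt_eqF.
Qed.

Lemma birth_flux_le k : (k < m)%N ->
  birth_rate m k t * tgeom m t k <= m%:R * B ^+ 2.
Proof.
move=> km; have m0 : 0 < m%:R :> R by rewrite ltr0n; exact: leq_ltn_trans km.
have q0 : 0 < m%:R / B by exact: divr_gt0.
have qm := qnat_lower (leqnn m).
have qp : 0 < qnat t m by exact: lt_le_trans qm.
have dm : dqnat t m <= m%:R * (m%:R * B).
  rewrite mulr_natl -[X in _ *+ X]card_ord -sumr_const; apply: ler_sum => a _.
  have /andP[ta1 ta2] := tB (leq_trans (leq_pred a) (ltnW (ltn_ord a))).
  by rewrite ler_pM ?exprn_ge0// ler_nat ltnW.
have -> : birth_rate m k t * tgeom m t k =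
    birth_rate m k t * t ^+ k * qnat t m / qnat t m ^+ 2.
  by rewrite /tgeom; field; rewrite gt_eqF.
rewrite birth_rate_qnat// ler_pdivrMr ?exprn_gt0//.
apply: (@le_trans _ _ (qnat t m * (m%:R * (m%:R * B)))).
  apply: (@le_trans _ _ (qnat t k.+1 * dqnat t m)).
    by rewrite gerBl mulr_ge0 ?qnat_ge0 ?dqnat_ge0.
  by rewrite ler_pM ?qnat_ge0 ?dqnat_ge0// ler_qnat.
rewrite [X in _ <= X](_ : _ = qnat t m * (m%:R * B ^+ 2 * qnat t m)); last by ring.
apply: ler_wpM2l; first exact: ltW.
apply: (@le_trans _ _ (m%:R * B ^+ 2 * (m%:R / B))).
  by rewrite le_eqVlt; apply/orP; left; apply/eqP; field; rewrite gt_eqF.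
by apply: ler_wpM2l => //; rewrite mulr_ge0 ?exprn_ge0// ltW.
Qed.

(** A uniform variable has second moment 1/3. Each term is compared with a third of the increment of
    [g ^+ 3], a telescoping sum; it exceeds it by at most the atom times the bound on the largest
    atom. *)
Lemma tgeom_second_moment : (0 < m)%N ->
  3^-1 <= \sum_(k < m) tgeom m t k * tgeom_cdf m t k.+1 ^+ 2
       <= 3^-1 + B ^+ 2 / m%:R.
Proof.
move=> m0.
pose g k : R := tgeom_cdf m t k.
have tele : \sum_(k < m) (g k.+1 ^+ 3 - g k ^+ 3) = 1.
  have gm : g m = 1 by rewrite /g -(prednK m0) tgeom_cdf1.
  rewrite -(big_mkord xpredT (fun k => g k.+1 ^+ 3 - g k ^+ 3)) telescope_sumr//.
  by rewrite gm /g tgeom_cdf0 expr1n expr0n subr0.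
have g0 k : 0 <= g k by exact: tgeom_cdf_ge0.
have gS k : g k.+1 = g k + tgeom m t k by rewrite -tgeom_cdfS addrC subrK.
have f0 k : 0 <= tgeom m t k by exact: tgeom_ge0.
apply/andP; split.
  apply: (@le_trans _ _ (3^-1 * \sum_(k < m) (g k.+1 ^+ 3 - g k ^+ 3))).
    by rewrite tele mulr1.
  rewrite mulr_sumr; apply: ler_sum => k _.
  rewrite -/(g k.+1) gS; set a := g k; set f := tgeom m t k.
  rewrite -subr_ge0 (_ : _ - _ = f ^+ 2 * (a + 2 / 3 * f)); last by field.
  by rewrite mulr_ge0 ?sqr_ge0// addr_ge0 ?g0// mulr_ge0 ?f0.
pose M : R := B ^+ 2 / m%:R.
apply: (@le_trans _ _ (\sum_(k < m) (3^-1 * (g k.+1 ^+ 3 - g k ^+ 3) + tgeom m t k * M))).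
  apply: ler_sum => k _; rewrite -/(g k.+1) gS.
  have fM : tgeom m t k <= M by exact: tgeom_le.
  have g1 : g k + tgeom m t k <= 1 by rewrite -gS tgeom_cdf_le1.
  have := g0 k; have := f0 k; move: g1 fM; set a := g k; set f := tgeom m t k.
  move=> g1 fM f0' a0.
  rewrite -subr_ge0 (_ : _ - _ = f * (M - f * (a + 2 / 3 * f))); last by field.
  rewrite mulr_ge0// subr_ge0; apply: le_trans fM; rewrite ler_piMr//; lra.
rewrite big_split/= -mulr_sumr tele -mulr_suml sum_tgeom mulr1 lerD2l.
by rewrite ler_piMl ?tgeom_cdf_le1// divr_ge0// exprn_ge0// ltW.
Qed.

End bounds.
End qnat.

Section birth_transition.
Variables (R : realType) (m : nat) (K : R -> R -> 'M[R]_m.+1).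
Local Notation p := (@birth_rate R m.+1).
Local Notation G := (birth_generator m.+1 p).
Hypothesis GK : transition_function G K.

(** At the top state, [v j.+1] lies outside the state space and is multiplied by a vanishing
    rate. *)
Lemma birth_generator_mulr (t : R) (v : nat -> R) (j : 'I_m.+1) : 0 <= t ->
  \sum_(k < m.+1) G t j k * v k = p j t * (v j.+1 - v j).
Proof.
move=> t0; rewrite (bigD1 j)//= mxE eqxx mulrBr mulNr addrC; congr (_ - _).
have [jm|] := ltnP j m; last first.
  move=> mj; have jE : j = m :> nat by apply/eqP; rewrite eqn_leq mj -ltnS ltn_ord.
  rewrite jE birth_rate_top// mul0r big1// => k kj; rewrite mxE.
  rewrite ifN; last by apply: contra kj => /eqP/val_inj->.
  by rewrite ifN ?mul0r//; have := ltn_ord k; rewrite jE; lia.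
have jlt : (j.+1 < m.+1)%N by [].
rewrite (bigD1 (Ordinal jlt)) /=; last by rewrite -val_eqE/=; lia.
rewrite mxE /= eqxx ifN; last lia.
rewrite big1 ?addr0// => k /andP[kj kj1]; rewrite mxE.
rewrite ifN; last by apply: contra kj => /eqP/val_inj->.
by rewrite ifN ?mul0r//; apply: contra kj1 => /eqP E; apply/eqP/val_inj.
Qed.

Lemma birth_generator_mull (t : R) (f : nat -> R) (k : 'I_m.+1) :
  \sum_(j < m.+1) f j * G t j k =
  (if val k is k'.+1 then p k' t * f k' else 0) - p k t * f k.
Proof.
rewrite (bigD1 k)//= mxE eqxx mulrN addrC [f k * _]mulrC; congr (_ - _).
case: k => -[|k] klt /=.
  rewrite big1// => j jk; rewrite mxE /= ifN; last first.
    by apply: contra jk => /eqP E; apply/eqP/val_inj; rewrite /= E.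
  by rewrite mulr0.
rewrite (bigD1 (Ordinal (ltnW klt))) /=; last by rewrite -val_eqE/=; lia.
rewrite mxE /= eqxx ifN; last lia.
rewrite big1 ?addr0 1?mulrC// => j /andP[jk jk1]; rewrite mxE /=.
rewrite ifN; last by apply: contra jk => /eqP E; apply/eqP/val_inj.
rewrite ifN ?mulr0//; apply: contra jk1 => /eqP[E]; apply/eqP/val_inj => /=.
by rewrite E.
Qed.

(** Jumps go upwards only, so the indicator of [{0, ..., k}] has nonpositive drift; it vanishes at
    [j]. *)
Lemma birth_transition_lower (s u : R) (j k : 'I_m.+1) : 0 <= s -> s <= u ->
  (k < j)%N -> K s u j k = 0.
Proof.
move=> s0 su kj; apply/eqP; rewrite eq_le (transition_ge0 GK)// andbT.
pose v (i : nat) : R := (i <= k)%:R.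
have := @backward_equation_le R m.+1 G K GK (fun _ i => v i) (fun _ _ => 0) s u 0 s0 su.
have H1 : forall t (i : 'I_m.+1), s <= t <= u -> straddle_derive (fun _ => v i) t 0.
  move=> t i _ e e0; near=> h => x y xt ty _.
  by rewrite subrr mulr0 subr0 normr0 mulr_ge0// ?(ltW e0)//; lra.
move=> /(_ H1) H; have {}H := H _ j.
have : \sum_(i < m.+1) K s u j i * v i <= v j + 0 * (u - s).
  apply: H => t i /andP[st tu]; have t0 : 0 <= t by exact: le_trans st.
  rewrite add0r birth_generator_mulr// mulr_ge0_le0 ?birth_rate_ge0//.
  by rewrite subr_le0 ler_nat; case: ltnP => // /ltnW ->.
rewrite mul0r addr0 {2}/v leqNgt kj /=; apply: le_trans.
rewrite (bigD1 k)//= {1}/v leqnn mulr1 lerDl sumr_ge0// => i _.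
by rewrite mulr_ge0 ?(transition_ge0 GK)// ler0n.
Unshelve. all: by end_near. Qed.

(** At time 0 the truncated geometric law is the point mass at 0, and from there on it solves the
    forward equation. *)
Lemma birth_law (u : R) (k : 'I_m.+1) : 0 <= u -> K 0 u ord0 k = tgeom m.+1 u k.
Proof.
move=> u0.
pose dF (t : R) (i : nat) : R := if i is i'.+1 then - (p i' t * tgeom m.+1 t i') else 0.
have dFE (t : R) (i : nat) : 0 <= t -> (i <= m.+1)%N ->
    is_derive t 1 (fun x => tgeom_cdf m.+1 x i) (dF t i).
  case: i => [|i] t0 im /=; last exact: is_derive_tgeom_cdf.
  have -> : (fun x => tgeom_cdf m.+1 x 0) = cst (0 : R).
    by apply/funext => x; rewrite tgeom_cdf0.
  exact: is_derive_cst.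
have <- := @forward_equation R m.+1 G K GK (fun t i => tgeom m.+1 t i)
  (fun t i => dF t i.+1 - dF t i) 0 u (lexx _) u0 _ _ k.
- rewrite (bigD1 ord0)//= big1 ?addr0.
    by rewrite /tgeom expr0 /qnat big_ord_recl big1 ?addr0 ?invr1 ?mul1r// => i _; rewrite expr0n.
  move=> i i0; rewrite /tgeom expr0n.
  by rewrite (_ : (i == 0 :> nat) = false) ?mul0r//; apply: negbTE.
- move=> t i /andP[t0 _].
  have -> : (fun x => tgeom m.+1 x i) =
      ((fun x => tgeom_cdf m.+1 x i.+1) \- (fun x => tgeom_cdf m.+1 x i) : R -> R).
    by apply/funext => x; rewrite /= -tgeom_cdfS.
  apply: is_derive_straddle; apply: is_deriveB; apply: dFE => //.
  exact: ltnW.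
- move=> t i /andP[t0 _]; rewrite birth_generator_mull addrC; congr (_ + _).
  by case: i => -[|i] ilt /=; rewrite ?oppr0 ?opprK.
Qed.

Section quantile.
Variables (s u B kappa : R).
Hypotheses (s0 : 0 <= s) (su : s <= u) (B0 : 0 < B).
Hypothesis tB : forall t a, s <= t <= u -> (a <= m.+1)%N -> B^-1 <= t ^+ a <= B.
Hypothesis tk : forall t, s <= t <= u -> `|t - 1| <= kappa.

(* The drift of [tgeom_cdf] along the process is [flux * (t - 1)]. *)
Lemma birth_quantile_drift (j : 'I_m.+1) :
  tgeom_cdf m.+1 s j.+1 - m.+1%:R * B ^+ 2 * kappa * (u - s) <=
  \sum_(k < m.+1) K s u j k * tgeom_cdf m.+1 u k.+1.
Proof.
have := @backward_equation_le R m.+1 G K GK (fun t i => - tgeom_cdf m.+1 t i.+1)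
  (fun t i => p i t * tgeom m.+1 t i) s u (m.+1%:R * B ^+ 2 * kappa) s0 su.
have H1 : forall t (k : 'I_m.+1), s <= t <= u ->
    straddle_derive (fun x => - tgeom_cdf m.+1 x k.+1) t (p k t * tgeom m.+1 t k).
  move=> t k /andP[st _]; apply: is_derive_straddle.
  have := is_deriveN (is_derive_tgeom_cdf (le_trans s0 st) (ltn_ord k)).
  by rewrite opprK.
move=> /(_ H1) H; have {}H := H _ j.
suff : forall t (i : 'I_m.+1), s <= t <= u -> p i t * tgeom m.+1 t i +
    \sum_(k < m.+1) G t i k * - tgeom_cdf m.+1 t k.+1 <= m.+1%:R * B ^+ 2 * kappa.
  move=> /H; rewrite (eq_bigr (fun k => - (K s u j k * tgeom_cdf m.+1 u k.+1))).
    by rewrite sumrN; lra.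
  by move=> k _; rewrite mulrN.
move=> t i tsu; have /andP[st tu] := tsu; have t0 : 0 <= t by exact: le_trans st.
rewrite (birth_generator_mulr (fun k => - tgeom_cdf m.+1 t k.+1))//.
have fE : - tgeom_cdf m.+1 t i.+2 - - tgeom_cdf m.+1 t i.+1 = - tgeom m.+1 t i * t.
  have := tgeom_cdfS m.+1 t i.+1; have -> : tgeom m.+1 t i.+1 = tgeom m.+1 t i * t.
    by rewrite /tgeom exprSr mulrAC.
  lra.
rewrite fE (_ : _ + _ = p i t * tgeom m.+1 t i * (1 - t)); last by ring.
apply: (@le_trans _ _ (p i t * tgeom m.+1 t i * `|t - 1|)).
  by rewrite ler_wpM2l ?birth_flux_ge0// distrC ler_norm.
apply: ler_pM => //; [exact: birth_flux_ge0 | | exact: tk].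
by apply: birth_flux_le => // a am; exact: tB.
Qed.

(** Expand the square. The second moment at [u] is at most 1/3 plus the atom bound, the one at [s]
    is at least 1/3, and by the drift bound the mixed moment is at least the second moment at [s]
    minus [rho]; the thirds cancel. *)
Lemma birth_quantile_var :
  \sum_(j < m.+1) \sum_(k < m.+1) tgeom m.+1 s j * K s u j k *
     (tgeom_cdf m.+1 u k.+1 - tgeom_cdf m.+1 s j.+1) ^+ 2 <=
  B ^+ 2 / m.+1%:R + 2 * (m.+1%:R * B ^+ 2 * kappa * (u - s)).
Proof.
have u0 : 0 <= u by exact: le_trans su.
set rho := m.+1%:R * B ^+ 2 * kappa * (u - s).
pose Fs (j : nat) := tgeom_cdf m.+1 s j.+1; pose Fu (j : nat) := tgeom_cdf m.+1 u j.+1.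
have rho0 : 0 <= rho.
  have k0 : 0 <= kappa by apply: le_trans (tk (t := s) _) => //; rewrite lexx.
  by rewrite !mulr_ge0// ?exprn_ge0 ?(ltW B0)// subr_ge0.
have lawu k : \sum_(j < m.+1) tgeom m.+1 s j * K s u j k = tgeom m.+1 u k.
  rewrite -birth_law//; have [_ /(_ 0 s u (lexx _) s0 su) -> _] := GK.
  by rewrite mxE; apply: eq_bigr => j _; rewrite birth_law.
have -> : \sum_(j < m.+1) \sum_(k < m.+1) tgeom m.+1 s j * K s u j k * (Fu k - Fs j) ^+ 2 =
    \sum_(k < m.+1) tgeom m.+1 u k * Fu k ^+ 2 + \sum_(j < m.+1) tgeom m.+1 s j * Fs j ^+ 2
    - 2 * \sum_(j < m.+1) tgeom m.+1 s j * Fs j * \sum_(k < m.+1) K s u j k * Fu k.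
  have -> : \sum_(k < m.+1) tgeom m.+1 u k * Fu k ^+ 2 =
      \sum_(j < m.+1) \sum_(k < m.+1) tgeom m.+1 s j * K s u j k * Fu k ^+ 2.
    rewrite exchange_big/=; apply: eq_bigr => k _.
    by rewrite -lawu big_distrl.
  rewrite mulr_sumr -big_split /= -sumrB; apply: eq_bigr => j _.
  have -> : tgeom m.+1 s j * Fs j ^+ 2 = \sum_(k < m.+1) tgeom m.+1 s j * K s u j k * Fs j ^+ 2.
    by rewrite -big_distrl -big_distrr /= (transition_sum1 GK)// mulr1.
  rewrite !mulr_sumr -big_split -sumrB /=; apply: eq_bigr => k _; ring.
have /andP[_ Su] := tgeom_second_moment u0 B0 (fun a => @tB u a ltac:(by rewrite su lexx)) (ltn0Sn m).
have /andP[Ss _] := tgeom_second_moment s0 B0 (fun a => @tB s a ltac:(by rewrite su lexx)) (ltn0Sn m).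
have cross : \sum_(j < m.+1) tgeom m.+1 s j * Fs j ^+ 2 - rho <=
    \sum_(j < m.+1) tgeom m.+1 s j * Fs j * \sum_(k < m.+1) K s u j k * Fu k.
  have f0 (j : nat) : 0 <= tgeom m.+1 s j by exact: tgeom_ge0.
  have F0 (j : nat) : 0 <= Fs j by exact: tgeom_cdf_ge0.
  apply: (@le_trans _ _ (\sum_(j < m.+1) (tgeom m.+1 s j * Fs j ^+ 2 - tgeom m.+1 s j * rho))).
    by rewrite sumrB -mulr_suml sum_tgeom tgeom_cdf1// mul1r.
  apply: ler_sum => j _.
  have -> : tgeom m.+1 s j * Fs j ^+ 2 - tgeom m.+1 s j * rho =
      tgeom m.+1 s j * (Fs j * Fs j - rho) by ring.
  rewrite -mulrA; apply: ler_wpM2l => //.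
  apply: (@le_trans _ _ (Fs j * (Fs j - rho))).
    have : Fs j <= 1 by apply: tgeom_cdf_le1.
    by move=> F1; rewrite mulrBr lerD2l lerN2 ler_piMl.
  by apply: ler_wpM2l => //; exact: birth_quantile_drift.
move: Su Ss cross; rewrite -/rho /Fs /Fu.
set a := \sum_(k < _) _; set b := \sum_(j < _) _; set c := \sum_(j < _) _; set M := _ / _.
lra.
Qed.

End quantile.
End birth_transition.

(** * Probabilities for the birth processes *)

Section finite_probability.
Variables (R : realType) (d : measure_display) (W : measurableType d).
Variable P : probability W R.

Definition prob (A : set W) : R := fine (P A).
Local Notation pr := prob.

Lemma prE A : measurable A -> P A = (pr A)%:E.
Proof. by move=> mA; rewrite /pr fineK// fin_num_measure. Qed.

Lemma pr_ge0 A : 0 <= pr A.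
Proof. by rewrite fine_ge0. Qed.

Lemma pr_setT : pr setT = 1. Proof. by rewrite /pr probability_setT. Qed.

Lemma prU A B : measurable A -> measurable B -> pr (A `|` B) <= pr A + pr B.
Proof.
move=> mA mB; rewrite -lee_fin EFinD -!prE//; first exact: measureU2.
exact: measurableU.
Qed.

Lemma pr_bigU (I : Type) (r : seq I) (F : I -> set W) :
  (forall i, measurable (F i)) ->
  pr (\big[setU/set0]_(i <- r) F i) <= \sum_(i <- r) pr (F i).
Proof.
move=> mF; elim: r => [|i r IH]; first by rewrite !big_nil /pr measure0.
rewrite !big_cons; apply: le_trans (prU _ _) _ => //; last by rewrite lerD2l.
exact: bigsetU_measurable.
Qed.

Section finite_valued.
Variables (T : finType) (h : W -> T).
Hypothesis mh : forall t, measurable (h @^-1` [set t]).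

Lemma measurable_finite_preimage (B : set T) : measurable (h @^-1` B).
Proof.
rewrite (_ : h @^-1` B = \bigcup_(t in B) (h @^-1` [set t])).
  by apply: fin_bigcup_measurable.
by apply/seteqP; split => [w Bw|w [t Bt] /= ->//]; exists (h w).
Qed.

Lemma pr_finite (B : pred T) :
  pr (h @^-1` [set t | B t]) = \sum_(t | B t) pr (h @^-1` [set t]).
Proof.
have H r : uniq r -> pr (h @^-1` [set` r]) = \sum_(t <- r) pr (h @^-1` [set t]).
  elim: r => [_|t r IH /andP[tr ur]].
    rewrite big_nil (_ : _ @^-1` _ = set0) ?/pr ?measure0//.
    by apply/seteqP; split.
  rewrite big_cons -IH//; apply: EFin_inj; rewrite EFinD -!prE//; try exact: measurable_finite_preimage.
  rewrite -measureU//; last 2 first.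
  - exact: measurable_finite_preimage.
  - by apply/seteqP; split => // w /= [->]; rewrite (negbTE tr).
  congr (P _); apply/seteqP; split => w /=; rewrite inE.
    by case/orP => [/eqP|]; [left|right].
  by case=> [->|->]; rewrite ?eqxx ?orbT.
transitivity (\sum_(t <- enum B) pr (h @^-1` [set t])).
  rewrite -H ?enum_uniq//.
  by congr pr; apply/seteqP; split => w /=; rewrite mem_enum.
by rewrite big_enum; apply: eq_bigl.
Qed.

Lemma sum_pr_finite : \sum_t pr (h @^-1` [set t]) = 1.
Proof.
rewrite -(pr_finite xpredT) -pr_setT; congr pr.
by apply/seteqP; split.
Qed.

Lemma pr_finite_chebyshev (phi : T -> R) (eta V : R) : 0 < eta ->
  \sum_t pr (h @^-1` [set t]) * phi t ^+ 2 <= V ->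
  pr [set w | eta <= `|phi (h w)|] <= V / eta ^+ 2.
Proof.
move=> eta0 hV; have -> : [set w | eta <= `|phi (h w)|] = h @^-1` [set t | eta <= `|phi t|] by [].
rewrite pr_finite ler_pdivlMr ?exprn_gt0//; apply: le_trans hV.
rewrite mulr_suml big_mkcond /=; apply: ler_sum => t _.
case: ifP => [et|_]; last by rewrite mulr_ge0 ?pr_ge0 ?sqr_ge0.
rewrite ler_wpM2l ?pr_ge0// -(real_normK (num_real (phi t))).
by rewrite ler_pXn2r ?nnegrE// ltW.
Qed.

End finite_valued.
End finite_probability.

Section birth_probability.
Variables (R : realType) (m : nat) (d : measure_display) (W : measurableType d).
Variables (P : probability W R) (X : R -> W -> 'I_m.+1).
Hypothesis bX : birth_process P X (birth_rate m.+1).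
Local Notation pr := (prob P).

Lemma birth_measurable t j : 0 <= t -> measurable (X t @^-1` [set j]).
Proof. by case: bX => _ _ [mX _]; exact: mX. Qed.

(** The Markov property is used with the sure event as the past; the law at [s] is the transition
    from the sure state 0 at time 0. *)
Lemma birth_joint_law : exists2 K,
  transition_function (birth_generator m.+1 (birth_rate m.+1)) K &
  forall s u j k, 0 <= s -> s <= u ->
    pr (X s @^-1` [set j] `&` X u @^-1` [set k]) = tgeom m.+1 s j * K s u j k.
Proof.
have [X0 _ [mX [K [GK PK]]]] := bX; exists K => //.
have step s u j k : 0 <= s -> s <= u ->
    pr (X s @^-1` [set j] `&` X u @^-1` [set k]) = pr (X s @^-1` [set j]) * K s u j k.
  move=> s0 su; have u0 : 0 <= u by exact: le_trans su.
  have hT : history X [set v | 0 <= v <= s] setT.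
    by rewrite -setC0; apply: sigma_algebraC; exact: sigma_algebra0.
  have := PK s u s0 su setT hT j k; rewrite setTI !prE//.
  - by rewrite -EFinM => -[].
  - exact: mX.
  - by apply: measurableI; exact: mX.
have law0 s j : 0 <= s -> pr (X s @^-1` [set j]) = tgeom m.+1 s j.
  move=> s0; rewrite -(birth_law GK)// -[RHS]mul1r.
  have X0E : X 0 @^-1` [set ord0] = setT.
    by apply/seteqP; split => // w _; apply: val_inj; rewrite /= X0.
  by have := step 0 s ord0 j (lexx _) s0; rewrite X0E setTI pr_setT.
by move=> s u j k s0 su; rewrite step// law0.
Qed.

Lemma birth_pr t j : 0 <= t -> pr (X t @^-1` [set j]) = tgeom m.+1 t j.
Proof.
move=> t0; have [K GK PK] := birth_joint_law.
have := PK t t j j t0 (lexx _); rewrite setIid => ->.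
by rewrite (transition_id GK)// eqxx mulr1.
Qed.

Lemma measurable_birth_pair s u (B : 'I_m.+1 -> 'I_m.+1 -> Prop) :
  0 <= s -> 0 <= u -> measurable [set w | B (X s w) (X u w)].
Proof.
move=> s0 u0.
have mh jk : measurable ((fun w => (X s w, X u w)) @^-1` [set jk]).
  rewrite (_ : _ @^-1` _ = X s @^-1` [set jk.1] `&` X u @^-1` [set jk.2]).
    by apply: measurableI; exact: birth_measurable.
  by case: jk => j k; apply/seteqP; split => w /= [-> ->].
exact: (measurable_finite_preimage mh [set jk | B jk.1 jk.2]).
Qed.

Lemma birth_decrease0 s u : 0 <= s -> s <= u ->
  pr [set w | (X u w < X s w)%N] = 0.
Proof.
move=> s0 su; have u0 : 0 <= u by exact: le_trans su.
have [K GK PK] := birth_joint_law.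
have E jk : (fun w => (X s w, X u w)) @^-1` [set jk] = X s @^-1` [set jk.1] `&` X u @^-1` [set jk.2].
  by case: jk => j k; apply/seteqP; split => w /= [-> ->].
have mh jk : measurable ((fun w => (X s w, X u w)) @^-1` [set jk]).
  by rewrite E; apply: measurableI; exact: birth_measurable.
rewrite (pr_finite P mh (fun jk => jk.2 < jk.1)%N) big1// => -[j k] /= kj.
by rewrite E/= PK// (birth_transition_lower GK)// mulr0.
Qed.

(** A decrease between two given times is a null event, so countably many null events cover the
    rational times. Integer values and right-continuity make the path constant just after any
    [t < v], hence equal to its value at a rational time. *)
Lemma birth_monotone u v : 0 <= u -> u <= v -> exists N : set W,
  [/\ measurable N, pr N = 0 &
      forall w, ~ N w -> forall t, u <= t <= v -> (X u w <= X t w <= X v w)%N].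
Proof.
move=> u0 uv; have v0 : 0 <= v by exact: le_trans uv.
pose D s t := [set w | (X t w < X s w)%N].
have mD s t : 0 <= s -> s <= t -> measurable (D s t).
  move=> s0 st; apply: (measurable_birth_pair (fun j k => (k < j)%N)) => //.
  exact: le_trans st.
(* [unpickle] enumerates the rationals; a number that encodes none, or one outside [[u, v]],
   contributes the empty set. *)
pose F (n : nat) := if unpickle n is Some q then
  let t : R := ratr q in if u <= t <= v then D u t `|` D t v else set0 else set0.
have mF n : measurable (F n).
  rewrite /F; case: unpickle => // q; case: ifP => // /andP[uq qv].
  by apply: measurableU; apply: mD => //; exact: le_trans uq.
have F0 n : P (F n) = 0%E.
  rewrite prE//; congr EFin; rewrite /F; case: unpickle => [q|]; last by rewrite /prob measure0.
  case: ifP => [/andP[uq qv]|_]; last by rewrite /prob measure0.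
  have q0 : 0 <= ratr q :> R by exact: le_trans uq.
  apply/eqP; rewrite eq_le pr_ge0 andbT; apply: le_trans (prU _ _ _) _; try exact: mD.
  by rewrite !birth_decrease0// addr0.
pose N := \bigcup_n F n `|` D u v.
have mN : measurable N.
  by apply: measurableU; [exact: bigcupT_measurable | exact: mD].
have pD : pr (D u v) = 0 by exact: birth_decrease0.
have pF : P (\bigcup_n F n) = 0%E.
  apply/eqP; rewrite eq_le measure_ge0 andbT.
  have := @measure_sigma_subadditive _ _ _ P (\bigcup_n F n) F mF
    (bigcupT_measurable _ mF) (fun w => id).
  by move=> /le_trans; apply; rewrite eseries0// => n _ _; exact: F0.
exists N; split => //.
  apply/eqP; rewrite eq_le pr_ge0 andbT; apply: le_trans (prU _ _ _) _.
  - exact: bigcupT_measurable.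
  - exact: mD.
  - by rewrite pD addr0 /prob pF.
move=> w nN; have nD : (X u w <= X v w)%N.
  by rewrite leqNgt; apply/negP => h; apply: nN; right.
have nF (q : rat) : u <= ratr q <= v -> (X u w <= X (ratr q) w <= X v w)%N.
  move=> uqv; have [n nE] : exists n, unpickle n = Some q by exists (pickle q); exact: pickleK.
  have {}nN : ~ F n w by move=> h; apply: nN; left; exists n.
  rewrite /F nE uqv in nN.
  apply/andP; split; rewrite leqNgt; apply/negP => h; apply: nN; by [left | right].
move=> t /andP[ut tv]; have [->|tltv] := eqVneq t v; first by rewrite nD leqnn.
have {}tltv : t < v by rewrite lt_neqAle tltv.
have t0 : 0 <= t by exact: le_trans ut.
have [_ cad _] := bX; have [/cvg_nat_near[c [/(_ _ erefl) cE ct]] _] := cad w t t0.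
move: ct; rewrite cE => {c cE} /nbhs_ballP[e /= e0 He].
have lt_te : t < Num.min v (t + e) by rewrite lt_min tltv/= ltrDl.
have [q] := rat_in_itvoo lt_te; rewrite in_itv/= lt_min => /and3P[tq qv qe].
have <- : X (ratr q) w = X t w.
  apply: val_inj; apply: He => //=; last exact: le_trans t0 (ltW tq).
  by rewrite /ball/= ltr_distlC; apply/andP; split; lra.
by apply: nF; rewrite (le_trans ut (ltW tq)) ltW.
Qed.

End birth_probability.

(** * Ranks along positions *)

(* [c] is the number of larger values to the left of a fixed particle among the
   first [k0 + r] positions; position [k] adds one to it iff [l k <= c]. *)
Fixpoint rank_chain (l : nat -> nat) (c0 k0 r : nat) : nat :=
  if r is r'.+1 then
    let c := rank_chain l c0 k0 r' in (c + (l (k0 + r) <= c))%N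
  else c0.

Lemma rank_chain_le l c0 k0 r : (rank_chain l c0 k0 r <= c0 + r)%N.
Proof.
elim: r => [|r IH] /=; first by rewrite addn0.
by case: (l _ <= _)%N => /=; lia.
Qed.

(** A chain that is strictly ahead cannot be overtaken in one step, since a step adds at most 1;
    from equal positions the smaller [l] makes the larger step. *)
Lemma rank_chain_homo l l' c c' k0 r : (c <= c')%N ->
  (forall k, (k0 < k <= k0 + r)%N -> (l' k <= l k)%N) ->
  (rank_chain l c k0 r <= rank_chain l' c' k0 r)%N.
Proof.
move=> cc; elim: r => [//|r IH] ll /=.
have {}IH : (rank_chain l c k0 r <= rank_chain l' c' k0 r)%N.
  by apply: IH => k /andP[k1 k2]; apply: ll; rewrite k1 addnS ltnW.
have := ll (k0 + r.+1)%N; rewrite leqnn andbT addnS ltnS leq_addr => /(_ isT) lr.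
rewrite -addnS in lr *.
move: IH; rewrite leq_eqVlt => /predU1P[->|IH].
  rewrite leq_add2l; case: (leqP (l _)) => // h1.
  by rewrite (leq_trans lr h1).
by move: IH; case: (l _ <= _)%N; case: (l' _ <= _)%N => /=; lia.
Qed.

Lemma eq_rank_chain l l' c k0 r :
  (forall k, (k0 < k <= k0 + r)%N -> l k = l' k) ->
  rank_chain l c k0 r = rank_chain l' c k0 r.
Proof.
move=> ll; apply/eqP; rewrite eqn_leq !rank_chain_homo// => k /ll ->//.
Qed.

(** If [s i < s k], the larger values to the left of [k] are among those counted for [i], so
    [l_k <= c]. If [s k < s i], they include all of these and also the value at [i], so
    [l_k > c]. *)
Lemma left_inv_rank_chain (n : nat) (s : 'S_n.+1) (i : 'I_n.+1) (r : nat) :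
  (i + r <= n)%N ->
  rank_chain (fun k => left_inv s (inord k)) (left_inv s i) i r =
  #|[pred j : 'I_n.+1 | (j <= i + r)%N && (s i < s j)%N]|.
Proof.
elim: r => [_|r IH irn] /=.
  apply: eq_card => j; rewrite !inE addn0 (leq_eqVlt j i).
  case: (eqVneq (nat_of_ord j) i) => [E|_] //=.
  by rewrite (val_inj E) !ltnn.
rewrite IH; last by rewrite addnS in irn; exact: ltnW.
set A := [pred j : 'I_n.+1 | _]; pose k : 'I_n.+1 := inord (i + r.+1).
have kE : k = (i + r.+1)%N :> nat by rewrite inordK.
have ik : (i < k)%N by rewrite kE addnS ltnS leq_addr.
rewrite [RHS](cardD1 k) [in RHS]inE kE leqnn /= addnC; congr (_ + _)%N; last first.
  apply: eq_card => j; rewrite !inE -(inj_eq val_inj) /= kE.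
  by case: (s i < s j)%N; rewrite ?andbF// !andbT; lia.
rewrite -/k; congr (nat_of_bool _).
have nik : s i != s k :> nat.
  by apply: contraTN ik => /eqP E; rewrite (perm_inj (val_inj E)) ltnn.
case: (ltngtP (s i) (s k)) nik => // sik _.
  apply: subset_leq_card; apply/fintype.subsetP => j; rewrite !inE => /andP[jk skj].
  rewrite (ltn_trans sik skj) andbT; move: jk; rewrite kE addnS ltnS => ->//.
apply/negbTE; rewrite -ltnNge; apply: (@leq_trans (#|[predU1 i & A]|)).
  by rewrite cardU1 !inE ltnn andbF add1n.
apply: subset_leq_card; apply/fintype.subsetP => j; rewrite !inE => /orP[/eqP->|/andP[ji sij]].
  by rewrite ik.
by rewrite kE addnS ltnS ji (ltn_trans sik sij).
Qed.

Lemma left_inv_rank (n : nat) (s : 'S_n.+1) (i : 'I_n.+1) :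
  (s i + rank_chain (fun k => left_inv s (inord k)) (left_inv s i) i (n - i) = n)%N.
Proof.
have ilen : (i <= n)%N by rewrite -ltnS.
rewrite left_inv_rank_chain subnKC//.
have -> : #|[pred j : 'I_n.+1 | (j <= n)%N && (s i < s j)%N]| = (\sum_(j < n.+1) (s i < j))%N.
  rewrite -sum1_card big_mkcond /= [RHS](reindex_inj (@perm_inj _ s)) /=.
  by apply: eq_bigr => j _; rewrite inE -ltnS ltn_ord /=; case: ltnP.
suff H N : (\sum_(j < N) (s i < j))%N = (N - (s i).+1)%N.
  by rewrite H subSS subnKC// -ltnS.
elim: N => [|N IH]; first by rewrite big_ord0.
by rewrite big_ord_recr /= IH; case: ltnP; lia.
Qed.

(** * Product laws and the rank martingale *)

Section product_weights.
Variables (R : comNzRingType) (I J : finType) (w : I -> J -> R).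
Hypothesis w1 : forall i, \sum_v w i v = 1.

Definition ffun_upd (x : {ffun I -> J}) (l : I) (v : J) : {ffun I -> J} :=
  [ffun k => if k == l then v else x k].

Lemma sum_product_weights : \sum_(x : {ffun I -> J}) \prod_k w k (x k) = 1.
Proof. by rewrite -(bigA_distr_bigA w) big1. Qed.

(* Swapping the old and the new value of coordinate [l] is an involution. *)
Lemma product_weights_resample (l : I) (g : {ffun I -> J} -> R) :
  \sum_(x : {ffun I -> J}) (\prod_k w k (x k)) * g x =
  \sum_(x : {ffun I -> J}) (\prod_k w k (x k)) * \sum_v w l v * g (ffun_upd x l v).
Proof.
pose Wl (x : {ffun I -> J}) := \prod_(k | k != l) w k (x k).
have WE (x : {ffun I -> J}) : \prod_k w k (x k) = w l (x l) * Wl x by rewrite (bigD1 l).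
have Wlu x v : Wl (ffun_upd x l v) = Wl x.
  by apply: eq_bigr => k /negbTE kl; rewrite ffunE kl.
transitivity (\sum_(xv : {ffun I -> J} * J) w l (xv.1 l) * Wl xv.1 * w l xv.2 * g xv.1).
  rewrite -(pair_bigA _ (fun (x : {ffun I -> J}) v => w l (x l) * Wl x * w l v * g x)) /=.
  apply: eq_bigr => x _; rewrite WE -mulr_suml -mulr_sumr w1 mulr1//.
rewrite (reindex_inj (h := fun xv : {ffun I -> J} * J => (ffun_upd xv.1 l xv.2, xv.1 l))) /=.
  rewrite -(pair_bigA _ (fun (x : {ffun I -> J}) v => w l (ffun_upd x l v l) * Wl (ffun_upd x l v) * w l (x l) * g (ffun_upd x l v))) /=.
  apply: eq_bigr => x _; rewrite WE mulr_sumr; apply: eq_bigr => v _.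
  by rewrite Wlu ffunE eqxx; ring.
apply: (can_inj (g := fun xv : {ffun I -> J} * J => (ffun_upd xv.1 l xv.2, xv.1 l))).
move=> [x v] /=; rewrite ffunE eqxx; congr (_, _).
by apply/ffunP => k; rewrite !ffunE; case: eqP => // ->.
Qed.

End product_weights.

Section rank_martingale.
Variables (R : realType) (n : nat) (i : 'I_n.+1) (t B : R).
Variable w : 'I_n.+1 -> 'I_n.+1 -> R.
Local Notation q := (t^-1).
Hypotheses (t0 : 0 < t) (B1 : 1 <= B).
Hypothesis qB : forall a, (a <= n.+2)%N -> B^-1 <= q ^+ a <= B.
Hypothesis w_ge0 : forall k v, 0 <= w k v.
Hypothesis w_sum1 : forall k, \sum_v w k v = 1.
Hypothesis wi : forall v : 'I_n.+1, (i < v)%N -> w i v = 0.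
Hypothesis wE : forall k v : 'I_n.+1, (i < k)%N ->
  w k v = if (v <= k)%N then tgeom k.+1 t v else 0.
Local Notation fT := {ffun 'I_n.+1 -> 'I_n.+1}.

Let q0 : 0 < q. Proof. by rewrite invr_gt0. Qed.

Definition ffun_chain (r : nat) (x : fT) : nat :=
  rank_chain (fun k => x (inord k)) (x i) i r.

(** The index [k] stands for position [k.+1], so the denominator [[k + 1]_q] of the formula with
    positions counted from 1 becomes [[k + 2]_q]. *)
Definition rank_ratio (k m : nat) : R := qnat q m.+1 / qnat q k.+2.

Let psi (k m v : nat) : R := rank_ratio k (m + (v <= m))%N - rank_ratio k.-1 m.

Lemma qnat_inv k : qnat q k = q ^+ k.-1 * qnat t k.
Proof.
rewrite /qnat mulr_sumr (reindex_inj rev_ord_inj) /=; apply: eq_bigr => a _.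
case: k a => [[]//|k] a; rewrite /= subSS; move: (nat_of_ord a) (ltnSE (ltn_ord a)) => b bk.
by rewrite -{2}(subnK bk) exprD -mulrA -exprMn mulVf ?gt_eqF// expr1n mulr1.
Qed.

(** The chain steps up with probability [[m+1]_t / [k+1]_t], which equals [q^(k-m) [m+1]_q /
    [k+1]_q]. The gain [q^(m+1)] in the numerator then balances exactly the growth of the
    denominator from [[k+1]_q] to [[k+2]_q]; this is why the parameter is [1 / t]. *)
Let psi_mean (k : 'I_n.+1) (m : nat) : (i < k)%N -> (m < k)%N ->
  \sum_(v < n.+1) w k v * psi k m v = 0.
Proof.
move=> ik mk.
have k1 : k = k.-1.+1 :> nat by rewrite prednK//; exact: leq_ltn_trans ik.
have -> : \sum_(v < n.+1) w k v * psi k m v =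
   \sum_(v < n.+1) w k v * (rank_ratio k m - rank_ratio k.-1 m) +
   \sum_(v < n.+1) w k v * (v <= m)%:R * (q ^+ m.+1 / qnat q k.+2).
  rewrite -big_split /=; apply: eq_bigr => v _; rewrite /psi -mulrA -mulrDr.
  congr (_ * _); rewrite /rank_ratio; case: (v <= m)%N.
    by rewrite addn1 (qnatS _ m.+1) mul1r; ring.
  by rewrite addn0 mul0r addr0.
rewrite -!mulr_suml w_sum1 mul1r.
have -> : \sum_(v < n.+1) w k v * (v <= m)%:R = tgeom_cdf k.+1 t m.+1.
  have mn : (m < n.+1)%N by rewrite (ltn_trans mk).
  rewrite -sum_tgeom (big_ord_widen _ (fun j => tgeom k.+1 t j) mn) [RHS]big_mkcond.
  apply: eq_bigr => v _; rewrite wE//; have [vm|mv] := leqP v m; last by rewrite mulr0 ltnS leqNgt mv.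
  by rewrite (leq_trans vm (ltnW mk)) mulr1 ltnS vm.
rewrite /tgeom_cdf /rank_ratio -k1.
have Q1 := qnat_inv k.+1; have Q2 := qnat_inv m.+1; rewrite /= in Q1 Q2.
have P1 : qnat t k.+1 != 0 by rewrite gt_eqF ?qnat_gt0 ?ltW.
have P2 : qnat q k.+1 != 0 by rewrite gt_eqF ?qnat_gt0 ?ltW.
have P3 : qnat q k.+2 != 0 by rewrite gt_eqF ?qnat_gt0 ?ltW.
have P4 : qnat q k.+2 = qnat q k.+1 + q * q ^+ k by rewrite qnatS exprS.
have e0 : q ^+ k != 0 by rewrite expf_neq0// gt_eqF.
have e1 : q ^+ m != 0 by rewrite expf_neq0// gt_eqF.
have tk : qnat t k.+1 = qnat q k.+1 / q ^+ k by rewrite Q1 mulrC mulKf.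
have tm : qnat t m.+1 = qnat q m.+1 / q ^+ m by rewrite Q2 mulrC mulKf.
rewrite tk tm exprS; rewrite P4 in P3 *.
move: (t^-1) P2 P3 e0 e1 => z P2 P3 e0 e1.
by field; rewrite P2 P3 e0 e1.
Qed.

(** A step is the difference of two numbers in [[0, B]] divided by [[k+2]_q], which is at least
    [(k+2) / B]. The bound on the square is written as a difference so that it telescopes. *)
Let psi_bound (k : 'I_n.+1) (m v : nat) : (i < k)%N -> (m < k)%N ->
  psi k m v ^+ 2 <= B ^+ 4 * (k.+1%:R^-1 - k.+2%:R^-1).
Proof.
move=> ik mk.
have k1 : k = k.-1.+1 :> nat by rewrite prednK//; exact: leq_ltn_trans ik.
have B0 : 0 < B by exact: lt_le_trans ltr01 B1.
have lek : (k.+2 <= n.+2)%N by rewrite ltnS ltn_ord.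
have qa a : (a <= k.+1)%N -> 0 <= q ^+ a <= B.
  move=> ak; have /andP[_ ->] := qB (leq_trans ak (ltnW lek)).
  by rewrite exprn_ge0// ltW.
have Qk : 0 < qnat q k.+1 by rewrite qnat_gt0// ltW.
have Qk2 : 0 < qnat q k.+2 by rewrite qnat_gt0// ltW.
have low : k.+2%:R / B <= qnat q k.+2.
  by apply: (qnat_lower (m := k.+2)) => // a ak; apply: qB; exact: leq_trans lek.
suff h : `|psi k m v| <= B ^+ 2 / k.+2%:R.
  rewrite -(real_normK (num_real _)).
  apply: (@le_trans _ _ ((B ^+ 2 / k.+2%:R) ^+ 2)).
    by rewrite ler_pXn2r ?nnegrE// divr_ge0// exprn_ge0// ltW.
  rewrite expr_div_n -exprM ler_pM2l ?exprn_gt0//.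
  have -> : k.+1%:R^-1 - k.+2%:R^-1 = (k.+1%:R * k.+2%:R)^-1 :> R.
    rewrite -[in LHS](natr1 k.+1) -[in RHS](natr1 k.+1).
    have : 0 < k.+1%:R :> R by [].
    by move: (k.+1%:R : R) => a a0; clear k1; field; lra.
  by rewrite lef_pV2 ?posrE ?mulr_gt0 ?exprn_gt0// expr2 ler_wpM2r// ler_nat.
apply: (@le_trans _ _ (B / qnat q k.+2)); last first.
  rewrite expr2 -mulrA ler_wpM2l ?(ltW B0)//.
  by rewrite -[leRHS]invf_div lef_pV2 ?posrE// divr_gt0.
have -> : psi k m v = (q ^+ m.+1 * (v <= m)%:R - q ^+ k.+1 * (qnat q m.+1 / qnat q k.+1)) / qnat q k.+2.
  rewrite /psi /rank_ratio -k1; have -> : qnat q (m + (v <= m)).+1 = qnat q m.+1 + q ^+ m.+1 * (v <= m)%:R.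
    by case: (v <= m)%N; rewrite ?addn0 ?addn1 ?mulr0 ?addr0 ?mulr1// (qnatS _ m.+1).
  have P4 : qnat q k.+2 = qnat q k.+1 + q ^+ k.+1 by rewrite qnatS.
  by rewrite P4 in Qk2 *; field; rewrite !gt_eqF.
rewrite normrM [`|_^-1|]ger0_norm ?invr_ge0 ?(ltW Qk2)// ler_wpM2r ?invr_ge0 ?(ltW Qk2)//.
have /andP[a0 aB] := qa m.+1 (leqW mk).
have /andP[b0 bB] := qa k.+1 (leqnn _).
have c0 : 0 <= qnat q m.+1 / qnat q k.+1 by rewrite divr_ge0 ?qnat_ge0 ?ltW.
have c1 : qnat q m.+1 / qnat q k.+1 <= 1.
  by rewrite ler_pdivrMr// mul1r ler_qnat ?(ltW q0)// ltnW.
rewrite ler_norml; apply/andP; split.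
  have : q ^+ k.+1 * (qnat q m.+1 / qnat q k.+1) <= B by rewrite -[B]mulr1 ler_pM.
  have : 0 <= q ^+ m.+1 * (v <= m)%:R by rewrite mulr_ge0.
  clear k1; lra.
have : q ^+ m.+1 * (v <= m)%:R <= B by rewrite -[B]mulr1 ler_pM// lern1 leq_b1.
have : 0 <= q ^+ k.+1 * (qnat q m.+1 / qnat q k.+1) by rewrite mulr_ge0.
clear k1; lra.
Qed.

(** Martingale increments are orthogonal: resampling coordinate [k] leaves the earlier part of the
    chain unchanged, and averaging over the new value kills the mixed term. *)
Lemma rank_martingale_var (r : nat) : (i + r <= n)%N ->
  \sum_(x : fT) (\prod_k w k (x k)) *
    (rank_ratio (i + r) (ffun_chain r x) - rank_ratio i (x i)) ^+ 2 <=
  B ^+ 4 * (i.+2%:R^-1 - (i + r).+2%:R^-1).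
Proof.
have W0 (x : fT) : 0 <= \prod_k w k (x k) by apply: prodr_ge0.
elim: r => [_|r IH irn].
  rewrite addn0 subrr mulr0 big1// => x _; rewrite /ffun_chain /= subrr expr0n mulr0//.
have ir : (i + r < n)%N by rewrite -addnS.
pose k : 'I_n.+1 := inord (i + r.+1).
have kE : k = (i + r).+1 :> nat by rewrite inordK addnS.
have ik : (i < k)%N by rewrite kE ltnS leq_addr.
pose H r (x : fT) := rank_ratio (i + r) (ffun_chain r x) - rank_ratio i (x i).
have HS x : H r.+1 x = H r x + psi k (ffun_chain r x) (x k).
  rewrite /H /psi kE /= -addnS; rewrite /ffun_chain /= -/k; ring.
have chain_upd (x : fT) v : ffun_chain r (ffun_upd x k v) = ffun_chain r x.
  rewrite /ffun_chain ffunE ifN; last by apply: contraTneq ik => ->; rewrite ltnn.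
  apply: eq_rank_chain => j /andP[ij jr]; rewrite ffunE ifN//.
  by rewrite -(inj_eq val_inj)/= kE inordK; lia.
have Hupd (x : fT) v : H r (ffun_upd x k v) = H r x.
  rewrite /H chain_upd ffunE ifN//; by apply: contraTneq ik => ->; rewrite ltnn.
have chain_lt (x : fT) : (x i <= i)%N -> (ffun_chain r x < k)%N.
  move=> xi; rewrite kE ltnS; apply: leq_trans (rank_chain_le _ _ _ _) _.
  by rewrite leq_add2r.
(* The facts about [psi] hold while the chain is below [k], which follows from [x i <= i]; tables
   violating this have weight 0. *)
have Wi (x : fT) (a b : R) : ((x i <= i)%N -> a <= b) ->
    (\prod_k w k (x k)) * a <= (\prod_k w k (x k)) * b.
  move=> ab; have [/ab|xi] := leqP (x i) i; first exact: ler_wpM2l.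
  by rewrite (bigD1 i)//= wi// !mul0r.
have cross : \sum_(x : fT) (\prod_k w k (x k)) * (H r x * psi k (ffun_chain r x) (x k)) = 0.
  rewrite (product_weights_resample w_sum1 k) big1// => x _.
  under [X in _ * X]eq_bigr => v _ do rewrite Hupd chain_upd ffunE eqxx mulrCA.
  rewrite -mulr_sumr; have [xi|xi] := leqP (x i) i.
    by rewrite psi_mean ?chain_lt// !mulr0.
  by rewrite (bigD1 i)//= wi// !mul0r.
have -> : \sum_(x : fT) (\prod_k w k (x k)) * H r.+1 x ^+ 2 =
   \sum_(x : fT) (\prod_k w k (x k)) * H r x ^+ 2 +
   \sum_(x : fT) (\prod_k w k (x k)) * psi k (ffun_chain r x) (x k) ^+ 2.
  transitivity (\sum_(x : fT) (\prod_k w k (x k)) * H r x ^+ 2 +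
     \sum_(x : fT) (\prod_k w k (x k)) * psi k (ffun_chain r x) (x k) ^+ 2 +
     2 * \sum_(x : fT) (\prod_k w k (x k)) * (H r x * psi k (ffun_chain r x) (x k))).
    by rewrite mulr_sumr -!big_split /=; apply: eq_bigr => x _; rewrite HS; ring.
  by rewrite cross mulr0 addr0.
have {}IH := IH (ltnW ir).
have step : \sum_(x : fT) (\prod_k w k (x k)) * psi k (ffun_chain r x) (x k) ^+ 2 <=
    B ^+ 4 * (k.+1%:R^-1 - k.+2%:R^-1).
  apply: (@le_trans _ _ (\sum_(x : fT) (\prod_k w k (x k)) * (B ^+ 4 * (k.+1%:R^-1 - k.+2%:R^-1)))).
    by apply: ler_sum => x _; apply: Wi => xi; apply: psi_bound => //; exact: chain_lt.
  by rewrite -mulr_suml (sum_product_weights w_sum1) mul1r.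
apply: le_trans (lerD IH step) _; rewrite -mulrDr kE addnS; set a := _^-1; set b := _^-1; set c := _^-1.
by rewrite [_ + _](_ : _ = a - c)//; ring.
Qed.

End rank_martingale.

(** * Concentration for the Mallows process *)

Section window.
Variables (R : realType) (n : nat) (T : R).
Hypothesis T0 : 0 <= T.
Local Notation N := (n.+1%:R : R).
Local Notation B := (expR (2 * T)).

Definition window (t : R) : Prop := expR (- (T / N)) <= t <= expR (T / N).

Let N0 : 0 < N. Proof. by rewrite ltr0n. Qed.

Lemma window_gt0 t : window t -> 0 < t.
Proof. by case/andP => + _; apply: lt_le_trans; exact: expR_gt0. Qed.

Lemma window_inv t : window t -> window t^-1.
Proof.
move=> wt; have t0 := window_gt0 wt; have /andP[t1 t2] := wt.
rewrite /window -[expR (T / N)]invrK -expRN; apply/andP; split.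
  by rewrite -lef_pV2 ?posrE ?invr_gt0 ?expR_gt0// invrK -expRN opprK.
by rewrite lef_pV2 ?posrE ?expR_gt0.
Qed.

Lemma window_exp s : `|s| <= T -> window (expR (s / N)).
Proof.
rewrite ler_norml => /andP[s1 s2]; rewrite /window !ler_expR -mulNr.
by rewrite !ler_pM2r ?invr_gt0// s1 s2.
Qed.

Lemma window1 : window 1.
Proof. by have := @window_exp 0; rewrite mul0r expR0 normr0; apply. Qed.

Lemma window_between t t' x : window t -> window t' -> t <= x <= t' -> window x.
Proof.
case/andP=> a1 _ /andP[_ b2] /andP[a b]; apply/andP; split.
  exact: le_trans a1 a.
exact: le_trans b b2.
Qed.

(** The exponent may reach [n.+2], and [n.+2 <= 2 * n.+1] is the origin of the 2 in
    [B = expR (2 * T)]. *)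
Lemma window_pow t a : window t -> (a <= n.+2)%N -> B^-1 <= t ^+ a <= B.
Proof.
have up x : window x -> (a <= n.+2)%N -> x ^+ a <= B.
  move=> wx an; have x0 := window_gt0 wx; have /andP[_ x2] := wx.
  apply: (@le_trans _ _ (expR (T / N) ^+ a)).
    by rewrite lerXn2r ?nnegrE ?expR_ge0 ?(ltW x0).
  rewrite -expRM_natl ler_expR mulrC mulrAC ler_pdivrMr//.
  rewrite [2 * T]mulrC -mulrA ler_wpM2l// -natrM ler_nat.
  by apply: leq_trans an _; lia.
move=> wt an; rewrite up// andbT.
have := up _ (window_inv wt) an; rewrite exprVn.
have t0 : 0 < t ^+ a by rewrite exprn_gt0// window_gt0.
by move=> h; rewrite -[leRHS]invrK lef_pV2// posrE ?invr_gt0// expR_gt0.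
Qed.

Lemma window_dist t : window t -> `|t - 1| <= T / N * B.
Proof.
move=> wt; have t0 := window_gt0 wt; have /andP[t1 t2] := wt.
have B1 : 1 <= B by rewrite -expR0 ler_expR mulr_ge0.
have TN : 0 <= T / N by rewrite divr_ge0// ltW.
have h2 : expR (T / N) <= B.
  have := @window_pow (expR (T / N)) 1%N; rewrite expr1 => h.
  by have /andP[] := h (window_exp ltac:(by rewrite ger0_norm)) isT.
move: t1 t2 TN h2; set x := T / N => t1 t2 x0 h2.
have e1 := expR_ge1Dx (- x); have e2 := expR_gt0 x.
have b1 : x <= x * B by exact: ler_peMr.
have b2 := ler_wpM2l x0 h2.
have b3 : expR x - 1 <= x * expR x.
  by have := ler_wpM2l (ltW e2) e1; rewrite expRN mulfV ?gt_eqF//; lra.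
by rewrite ler_norml; apply/andP; split; lra.
Qed.

(** The drift rate is of order [i * |t - 1|] and acts for a time [|t - 1|], which is of order
    [1 / N]; the total [i / N^2] is of order at most [1 / i]. *)
Lemma window_quantile_bound t i : window t -> (i <= n)%N ->
  B ^+ 2 / i.+1%:R + 2 * (i.+1%:R * B ^+ 2 * `|t - 1| * `|t - 1|) <=
  (B ^+ 2 + 2 * T ^+ 2 * B ^+ 4) / i.+1%:R.
Proof.
move=> wt i_n; have i0 : 0 < i.+1%:R :> R by [].
rewrite (mulrDl (B ^+ 2) (2 * T ^+ 2 * B ^+ 4)) lerD2l.
have h : `|t - 1| * `|t - 1| <= (T / N * B) * (T / N * B).
  by apply: ler_pM => //; exact: window_dist.
apply: (@le_trans _ _ (2 * (i.+1%:R * B ^+ 2 * ((T / N * B) * (T / N * B))))).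
  by rewrite ler_pM2l// -mulrA ler_wpM2l// mulr_ge0// ?exprn_ge0// expR_ge0.
rewrite ler_pdivlMr//.
rewrite (_ : _ * i.+1%:R = 2 * T ^+ 2 * B ^+ 4 * (i.+1%:R / N) ^+ 2); last first.
  by field; rewrite nat1r gt_eqF.
rewrite ler_piMr ?mulr_ge0 ?exprn_ge0 ?expR_ge0//.
rewrite exprn_ile1// ?divr_ge0// ?(ltW N0)//.
by rewrite ler_pdivrMr// mul1r ler_nat.
Qed.

End window.

Lemma left_inv_le (n : nat) (s : 'S_n) (k : 'I_n) : (left_inv s k <= k)%N.
Proof.
rewrite /left_inv -sum1_card big_mkcond /=.
apply: (@leq_trans (\sum_(j < n) (j < k))%N).
  by apply: leq_sum => j _; rewrite inE; case: ltnP => //=; case: ifP.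
suff -> N : (\sum_(j < N) (j < k))%N = minn N k by exact: geq_minr.
elim: N => [|N IH]; first by rewrite big_ord0 min0n.
by rewrite big_ord_recr /= IH; case: ltnP; lia.
Qed.

Section mallows.
Variables (R : realType) (n : nat) (T : R) (d : measure_display) (W : measurableType d).
Variables (P : probability W R) (sigma : R -> W -> 'S_n.+1).
Hypothesis T0 : 0 <= T.
Hypothesis hs : birth_mallows_process P sigma.
Local Notation pr := (prob P).
Local Notation B := (expR (2 * T)).
Local Notation H := (history sigma [set t | 0 <= t]).

Lemma mallows_measurable t : 0 <= t -> forall s, measurable (sigma t @^-1` [set s]).
Proof.
move=> t0 s; have [l [bl _ ls]] := hs.
rewrite (_ : _ @^-1` _ = \bigcap_(k in [set: 'I_n.+1]) [set w | (l k t w : nat) = left_inv s k]).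
  apply: fin_bigcap_measurable => // k _.
  exact: (measurable_finite_preimage (fun j => birth_measurable (bl k) j t0) [set v | (v : nat) = left_inv s k]).
apply/seteqP; split => w /=; first by move=> <- k _; rewrite /= ls.
by move=> h; apply: left_inv_inj => k; rewrite ls// h.
Qed.

Lemma history_pair t u (Q : 'S_n.+1 -> 'S_n.+1 -> Prop) : 0 <= t -> 0 <= u ->
  H [set w | Q (sigma t w) (sigma u w)].
Proof.
move=> t0 u0; pose G := [set A : set W | exists t y, 0 <= t /\ A = sigma t @^-1` [set y]].
suff : @measurable _ (g_sigma_algebraType G) [set w | Q (sigma t w) (sigma u w)] by [].
rewrite (_ : [set w | _] = \bigcup_(y in [set y : 'S_n.+1 * 'S_n.+1 | Q y.1 y.2])
    (sigma t @^-1` [set y.1] `&` sigma u @^-1` [set y.2])).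
  apply: fin_bigcup_measurable => [|y _]; first exact: (@finite_finset ('S_n.+1 * 'S_n.+1)%type).
  apply: measurableI.
    by apply: sub_sigma_algebra; exists t, y.1.
  by apply: sub_sigma_algebra; exists u, y.2.
apply/seteqP; split => w /=; first by exists (sigma t w, sigma u w).
by case=> -[y z] /= Qyz [-> ->].
Qed.

Lemma mallows_history_measurable A : H A -> measurable A.
Proof.
apply: smallest_sub; first exact: sigma_algebra_measurable.
by move=> _ [t [y [t0 ->]]]; exact: mallows_measurable.
Qed.

Lemma mallows_quantile t (i : 'I_n.+1) eta : window n T t -> 0 < eta ->
  pr [set w | eta <= `|tgeom_cdf i.+1 t (left_inv (sigma t w) i).+1 -
                       tgeom_cdf i.+1 1 (left_inv (sigma 1 w) i).+1|] <=
  (B ^+ 2 + 2 * T ^+ 2 * B ^+ 4) / i.+1%:R / eta ^+ 2.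
Proof.
move=> wt eta0; have [l [bl _ ls]] := hs.
have t0 := ltW (window_gt0 wt).
have [K GK PK] := birth_joint_law (bl i).
(* The variance bound runs forward in time, so [(s, u)] is [(1, t)] or [(t, 1)] according to the
   side of 1 on which [t] lies. *)
have main s u : 0 <= s -> s <= u -> window n T s -> window n T u -> u - s = `|t - 1| ->
    (forall x, s <= x <= u -> `|x - 1| <= `|t - 1|) ->
    pr [set w | eta <= `|tgeom_cdf i.+1 u (l i u w).+1 - tgeom_cdf i.+1 s (l i s w).+1|] <=
  (B ^+ 2 + 2 * T ^+ 2 * B ^+ 4) / i.+1%:R / eta ^+ 2.
  move=> s0 su ws wu us xs; have u0 : 0 <= u by exact: le_trans su.
  pose h w := (l i s w, l i u w).
  have hE jk : h @^-1` [set jk] = l i s @^-1` [set jk.1] `&` l i u @^-1` [set jk.2].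
    by rewrite /h; case: jk => j k; apply/seteqP; split => w /= [-> ->].
  have mh jk : measurable (h @^-1` [set jk]).
    by rewrite hE; apply: measurableI; exact: (birth_measurable (bl i)).
  apply: (@pr_finite_chebyshev _ _ _ P _ h mh (fun jk => tgeom_cdf i.+1 u jk.2.+1 - tgeom_cdf i.+1 s jk.1.+1)) => //.
  have il : (i <= n)%N by rewrite -ltnS.
  apply: le_trans (window_quantile_bound T0 wt il).
  rewrite -{2}us; apply: le_trans (birth_quantile_var GK s0 su (expR_gt0 _) _ xs); last first.
    move=> x a xsu ai; apply: (@window_pow _ _ T) => //.
      exact: window_between ws wu xsu.
    by apply: leq_trans ai _; rewrite ltnS ltnW.
  rewrite (pair_bigA _ (fun (j k : 'I_i.+1) => tgeom i.+1 s j * K s u j k *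
     (tgeom_cdf i.+1 u k.+1 - tgeom_cdf i.+1 s j.+1) ^+ 2)) /=.
  by rewrite le_eqVlt; apply/orP; left; apply/eqP/eq_bigr => jk _; rewrite hE PK.
have [t1|t1] := leP 1 t.
  have := main 1 t ler01 t1 (window1 n T0) wt.
  have tn : `|t - 1| = t - 1 by rewrite ger0_norm// subr_ge0.
  rewrite tn => /(_ erefl); set A := [set w | _]; set A' := [set w | _].
  have -> : A = A'.
    by apply/seteqP; split => w; rewrite /A /A' /= !ls.
  by apply => x /andP[x1 xt]; rewrite ger0_norm; lra.
have := main t 1 t0 (ltW t1) wt (window1 n T0).
have tn : `|t - 1| = 1 - t by rewrite ltr0_norm ?opprB// subr_lt0.
rewrite tn => /(_ erefl); set A := [set w | _]; set A' := [set w | _].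
have -> : A = A'.
  by apply/seteqP; split => w; rewrite /A /A' /= !ls// distrC.
by apply => x /andP[x1 xt]; rewrite ler0_norm; lra.
Qed.

Section joint_law.
Variables (l : forall i : 'I_n.+1, R -> W -> 'I_i.+1) (tau : 'I_n.+1 -> R).
Hypothesis tau0 : forall k, 0 <= tau k.
Hypothesis bl : forall i, birth_process P (l i) (birth_rate i.+1).
Hypothesis il : independent_family P (fun i => history (l i) [set t | 0 <= t]).

(** Each coordinate is read at its own time [tau k]; widening to a common type makes the table a
    finite function with product law. *)
Definition inversion_table (w : W) : {ffun 'I_n.+1 -> 'I_n.+1} :=
  [ffun k => widen_ord (ltn_ord k) (l k (tau k) w)].

Definition inversion_weight (k v : 'I_n.+1) : R :=
  if (v <= k)%N then tgeom k.+1 (tau k) v else 0.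

Let tableE x : inversion_table @^-1` [set x] =
  \bigcap_k [set w | (l k (tau k) w : nat) = x k].
Proof.
apply/seteqP; split => w /= => [<- k _|h]; first by rewrite /= ffunE.
by apply/ffunP => k; apply: val_inj; rewrite ffunE /= h.
Qed.

Let coordE k (v : 'I_n.+1) : [set w | (l k (tau k) w : nat) = v] =
  if (v <= k)%N then l k (tau k) @^-1` [set inord v] else set0.
Proof.
case: ifP => [vk|/negbT vk]; apply/seteqP; split => w //= h.
- by apply: val_inj; rewrite /= inordK.
- by rewrite h inordK.
- by move: vk; rewrite -h -ltnS ltn_ord.
Qed.

Lemma inversion_table_law x :
  measurable (inversion_table @^-1` [set x]) /\
  pr (inversion_table @^-1` [set x]) = \prod_k inversion_weight k (x k).
Proof.
have mA k (v : 'I_n.+1) : measurable [set w | (l k (tau k) w : nat) = v].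
  by rewrite coordE; case: ifP => // _; exact: (birth_measurable (bl k)).
rewrite tableE; split; first exact: fin_bigcap_measurable.
apply: EFin_inj; rewrite -prE; last exact: fin_bigcap_measurable.
rewrite il => [|k].
  rewrite -prodEFin; apply: eq_bigr => k _; rewrite prE//; congr EFin.
  rewrite coordE /inversion_weight; case: ifP => vk; last by rewrite /prob measure0.
  by rewrite (birth_pr (bl k))// inordK.
rewrite coordE; case: ifP => _; last exact: sigma_algebra0.
by apply: sub_sigma_algebra; exists (tau k), (inord (x k)); split; first exact: tau0.
Qed.

Lemma inversion_weight_ge0 k v : 0 <= inversion_weight k v.
Proof. by rewrite /inversion_weight; case: ifP => // _; exact: tgeom_ge0. Qed.

Lemma inversion_weight_sum k : \sum_v inversion_weight k v = 1.
Proof.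
rewrite -(tgeom_cdf1 k (tau0 k)) -sum_tgeom.
rewrite (big_ord_widen _ (fun j => tgeom k.+1 (tau k) j) (ltn_ord k)) [RHS]big_mkcond.
by apply: eq_bigr => v _; rewrite /inversion_weight ltnS.
Qed.

End joint_law.

(** Two permutations, because the chain increases with the starting value [l_i] and decreases with
    the later left inversions: a bound over a time interval takes these from opposite end points. *)
Definition mallows_chain (s s' : 'S_n.+1) (i : 'I_n.+1) : nat :=
  rank_chain (fun k => left_inv s (inord k)) (left_inv s' i) i (n - i).

(** The martingale starts from [l_i] and accepts any law of it on [{0, ..., i}]. Since positions are
    independent, [l_i] may be read at [t'] and the other coordinates at [t]. *)
Lemma mallows_rank t t' (i : 'I_n.+1) eta : window n T t -> window n T t' -> 0 < eta ->
  pr [set w | eta <= `|rank_ratio t n (mallows_chain (sigma t w) (sigma t' w) i) -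
                       rank_ratio t i (left_inv (sigma t' w) i)|] <=
  B ^+ 4 / i.+1%:R / eta ^+ 2.
Proof.
move=> wt wt' eta0; have [l [bl il ls]] := hs.
have t0 := ltW (window_gt0 wt); have t0' := ltW (window_gt0 wt').
pose tau (k : 'I_n.+1) := if k == i then t' else t.
have tau0 k : 0 <= tau k by rewrite /tau; case: eqP.
have mh x := (inversion_table_law tau0 bl il x).1.
pose phi (x : {ffun 'I_n.+1 -> 'I_n.+1}) :=
  rank_ratio t (i + (n - i)) (ffun_chain i (n - i) x) - rank_ratio t i (x i).
have in_ : (i <= n)%N by rewrite -ltnS.
rewrite (_ : [set w | _] = [set w | eta <= `|phi (inversion_table l tau w)|]); last first.
  have tabE w k : inversion_table l tau w k = left_inv (sigma (tau k) w) k :> nat.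
    by rewrite ffunE /= ls.
  have E w : phi (inversion_table l tau w) = rank_ratio t n (mallows_chain (sigma t w) (sigma t' w) i) -
                       rank_ratio t i (left_inv (sigma t' w) i).
    have taui : tau i = t' by rewrite /tau eqxx.
    rewrite /phi /ffun_chain /mallows_chain subnKC// tabE taui; congr (rank_ratio _ _ _ - _).
    apply: eq_rank_chain => k /andP[ik kn]; rewrite subnKC// in kn.
    rewrite tabE /tau ifN//; apply: contraTneq ik => <-; rewrite inordK ?ltnn//.
  by apply/seteqP; split => w /=; rewrite E.
apply: (@pr_finite_chebyshev _ _ _ P _ (inversion_table l tau) mh phi) => //.
have B1 : 1 <= B by rewrite -expR0 ler_expR mulr_ge0.
have -> : \sum_x pr (inversion_table l tau @^-1` [set x]) * phi x ^+ 2 =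
    \sum_(x : {ffun 'I_n.+1 -> 'I_n.+1}) (\prod_k inversion_weight tau k (x k)) * phi x ^+ 2.
  by apply: eq_bigr => x _; rewrite (inversion_table_law tau0 bl il x).2.
have := @rank_martingale_var R n i t B (inversion_weight tau) (window_gt0 wt) B1
  (fun a => window_pow T0 (window_inv wt)) (inversion_weight_ge0 tau0) (inversion_weight_sum tau0).
move=> /(_ _ _ (n - i)%N) h.
apply: (le_trans (h _ _ _)).
- by move=> v iv; rewrite /inversion_weight leqNgt iv.
- move=> k v ik; rewrite /inversion_weight; have -> // : tau k = t.
  by rewrite /tau ifN//; apply: contraTneq ik => ->; rewrite ltnn.
- by rewrite subnKC.
rewrite ler_wpM2l ?exprn_ge0 ?expR_ge0//.
apply: (@le_trans _ _ i.+2%:R^-1); first by rewrite gerBl invr_ge0.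
by rewrite lef_pV2 ?posrE// ler_nat.
Qed.

(** At [t = 1] every left inversion is uniform, so all permutations have the same probability [c].
    Composing with a transposition of values shows that all [j] are equally likely, without
    evaluating [c]. *)
Lemma mallows_uniform (i j : 'I_n.+1) : pr [set w | sigma 1 w i = j] = n.+1%:R^-1.
Proof.
have [l [bl il ls]] := hs; pose tau (_ : 'I_n.+1) : R := 1.
have tau0 k : 0 <= tau k by exact: ler01.
pose c : R := \prod_(k < n.+1) k.+1%:R^-1.
have m1 := mallows_measurable ler01.
have law s : pr (sigma 1 @^-1` [set s]) = c.
  pose x : {ffun 'I_n.+1 -> 'I_n.+1} := [ffun k => inord (left_inv s k)].
  have xE k : x k = left_inv s k :> nat.
    by rewrite ffunE inordK// (leq_ltn_trans (left_inv_le s k)).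
  rewrite (_ : _ @^-1` _ = inversion_table l tau @^-1` [set x]); last first.
    apply/seteqP; split => w /= [h].
      by apply/ffunP => k; apply: val_inj; rewrite /= xE ffunE /= -h ls ?ler01.
    by apply: left_inv_inj => k; rewrite -xE -h ffunE /= ls ?ler01.
  rewrite (inversion_table_law tau0 bl il x).2; apply: eq_bigr => k _.
  rewrite /inversion_weight xE left_inv_le /tgeom expr1n qnat1 div1r//.
have prj j' : pr [set w | sigma 1 w i = j'] = \sum_(s : 'S_n.+1 | s i == j') c.
  rewrite (_ : [set w | _] = sigma 1 @^-1` [set s | s i == j']); last first.
    by apply/seteqP; split => w /= /eqP.
  by rewrite (pr_finite P m1); apply: eq_bigr => s _; exact: law.
have same j' : pr [set w | sigma 1 w i = j'] = pr [set w | sigma 1 w i = j].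
  rewrite !prj (reindex_inj (mulIg (tperm j j'))) /=; apply: eq_bigl => s.
  by rewrite permM -[X in _ == X](tpermL j j') (inj_eq perm_inj).
have tot : \sum_j' pr [set w | sigma 1 w i = j'] = 1.
  apply: (@sum_pr_finite _ _ _ P _ (fun w => sigma 1 w i)).
  by move=> j'; exact: (measurable_finite_preimage m1 [set s | s i = j']).
have N0 : n.+1%:R != 0 :> R by rewrite pnatr_eq0.
apply: (mulIf N0); rewrite mulVf// -[RHS]tot (eq_bigr _ (fun j' _ => same j')).
by rewrite sumr_const card_ord mulr_natr.
Qed.

End mallows.

(** * The limit paths *)

Section expR_bounds.
Variable R : realType.
Implicit Types u v c : R.

Lemma expR_sub_ge u v : v <= u -> expR v * (u - v) <= expR u - expR v.
Proof.
move=> vu; have := expR_ge1Dx (u - v); rewrite expRB => h.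
have e := expR_gt0 v; have := ler_wpM2l (ltW e) h.
by rewrite mulrCA mulfV ?gt_eqF//; lra.
Qed.

Lemma expR_sub_le u v : v <= u -> expR u - expR v <= expR u * (u - v).
Proof.
move=> vu; have := expR_ge1Dx (v - u); rewrite expRB => h.
have e := expR_gt0 u; have := ler_wpM2l (ltW e) h.
by rewrite mulrCA mulfV ?gt_eqF//; lra.
Qed.

Lemma expR_dist_ge u v c : - c <= u -> - c <= v ->
  `|u - v| <= expR c * `|expR u - expR v|.
Proof.
wlog vu : u v / v <= u.
  move=> H; have [/H//|/ltW/H h c1 c2] := leP v u.
  by rewrite distrC [`|expR u - _|]distrC; exact: h.
move=> cu cv; have h := expR_sub_ge vu.
have e1 : 1 <= expR c * expR v by rewrite -expRD -expR0 ler_expR; lra.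
rewrite !ger0_norm ?subr_ge0 ?ler_expR//.
apply: (@le_trans _ _ (expR c * (expR v * (u - v)))).
  by rewrite mulrA ler_peMl// subr_ge0.
by rewrite ler_wpM2l// expR_ge0.
Qed.

Lemma expR_dist_le u v c : u <= c -> v <= c ->
  `|expR u - expR v| <= expR c * `|u - v|.
Proof.
wlog vu : u v / v <= u.
  move=> H; have [/H//|/ltW/H h c1 c2] := leP v u.
  by rewrite distrC [`|u - _|]distrC; exact: h.
move=> uc vc; have h := expR_sub_le vu.
rewrite !ger0_norm ?subr_ge0 ?ler_expR//; apply: (le_trans h).
by rewrite ler_wpM2r ?subr_ge0// ler_expR.
Qed.

End expR_bounds.

Section hyperbolic.
Variable R : realType.
Implicit Types (E b K : R).

(** Fractional linear in [b], with fixed points 0 and 1, and the identity for [E = 1]. *)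
Definition moebius E b : R := E * b / (1 - b + b * E).

Lemma moebius_den E b K : 1 <= K -> K^-1 <= E -> 0 <= b <= 1 -> K^-1 <= 1 - b + b * E.
Proof.
move=> K1 KE /andP[b0 b1]; have K0 : 0 < K by exact: lt_le_trans K1.
have k1 : K^-1 <= 1 by rewrite invf_le1.
have h1 : b * K^-1 <= b * E by rewrite ler_wpM2l.
have h2 : (1 - b) * K^-1 <= (1 - b) * 1 by rewrite ler_wpM2l// subr_ge0.
lra.
Qed.

(** Change [E] first, then [b]: each difference is explicit, over a product of two denominators that
    are at least [K^-1]. *)
Lemma moebius_dist E E' b b' K : 1 <= K -> K^-1 <= E <= K -> K^-1 <= E' <= K ->
  0 <= b <= 1 -> 0 <= b' <= 1 ->
  `|moebius E b - moebius E' b'| <= K ^+ 2 * `|E - E'| + K ^+ 3 * `|b - b'|.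
Proof.
move=> K1 /andP[E1 E2] /andP[E1' E2'] b01 b01'.
have K0 : 0 < K by exact: lt_le_trans K1.
have inv_le D D' : K^-1 <= D -> K^-1 <= D' -> (D * D')^-1 <= K ^+ 2.
  have k0 : 0 < K^-1 by rewrite invr_gt0.
  move=> h h'; rewrite -[leRHS]invrK lef_pV2 ?posrE ?invr_gt0 ?exprn_gt0//.
    by rewrite -exprVn expr2 ler_pM// ltW.
  by rewrite mulr_gt0//; [exact: lt_le_trans h | exact: lt_le_trans h'].
have D1 := moebius_den K1 E1 b01; have D2 := moebius_den K1 E1' b01.
have D3 := moebius_den K1 E1' b01'.
have k0 : 0 < K^-1 by rewrite invr_gt0.
have P1 := lt_le_trans k0 D1; have P2 := lt_le_trans k0 D2; have P3 := lt_le_trans k0 D3.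
have eq1 : moebius E b - moebius E' b =
    (b * (1 - b)) * ((1 - b + b * E) * (1 - b + b * E'))^-1 * (E - E').
  by rewrite /moebius; field; rewrite !gt_eqF.
have eq2 : moebius E' b - moebius E' b' =
    E' * ((1 - b + b * E') * (1 - b' + b' * E'))^-1 * (b - b').
  by rewrite /moebius; field; rewrite !gt_eqF.
have /andP[b0 b1] := b01.
apply: (le_trans (ler_distD (moebius E' b) _ _)); apply: lerD.
  rewrite eq1 normrM ler_wpM2r// ger0_norm; last first.
    by rewrite mulr_ge0 ?invr_ge0 ?mulr_ge0 ?subr_ge0// ltW.
  rewrite -[leRHS]mul1r ler_pM// ?inv_le// ?invr_ge0 ?mulr_ge0 ?subr_ge0 ?(ltW P1) ?(ltW P2)//.
  by rewrite -[leRHS]mul1r ler_pM ?subr_ge0//; lra.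
rewrite eq2 normrM ler_wpM2r// ger0_norm; last first.
  by rewrite mulr_ge0 ?invr_ge0 ?mulr_ge0// ltW// (lt_le_trans k0).
by rewrite exprS ler_pM// ?inv_le// ?invr_ge0 ?mulr_ge0// ltW// (lt_le_trans k0).
Qed.

End hyperbolic.

Section zpath_bounds.
Variables (R : realType) (T : R).
Hypothesis T0 : 0 <= T.
Local Notation K := (expR T).

(** This is the limit of the exact relation [q^(m+1) - 1 = ratio * (q^(n+2) - 1)], the ratio being
    replaced by its Moebius value; solving it for the exponent on the left gives [zpath]. *)
Lemma zpath_expE (x a s : R) : 0 <= a <= 1 -> s != 0 ->
  expR (- (s * (1 - zpath x a s))) - 1 =
  moebius (expR (s * x)) (1 - a) * (expR (- s) - 1).
Proof.
move=> a01 s0; rewrite /zpath (negbTE s0).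
have N0 := zpath_den_gt0 x s (expR_gt0 s) a01.
have D0 := zpath_den_gt0 x s ltr01 a01; rewrite mulr1 in D0.
rewrite mulrBr mulrA mulfV// mul1r mulr1 opprB expRD lnK ?posrE ?divr_gt0//.
rewrite /moebius [s * x]mulrC expRN; move: N0 D0.
move: (expR (x * s)) (expR s) (expR_gt0 s) => E F F0 N0 D0.
have -> : 1 - (1 - a) + (1 - a) * E = E * (1 - a) + a by ring.
by field; rewrite !gt_eqF.
Qed.

Let expRT s : `|s| <= T -> K^-1 <= expR s <= K.
Proof. by rewrite ler_norml => /andP[h1 h2]; rewrite -expRN !ler_expR h1 h2. Qed.

Let K1 : 1 <= K. Proof. by rewrite -expR0 ler_expR. Qed.

(** Near [s = 0] both sides of the equation for [zpath] vanish to first order, so the error is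
    measured relative to [|s|] and survives the division by [s]. The exponents are at least
    [- 2 * T], whence the factor [K ^+ 2]. *)
Lemma zpath_near (x a s y h delta : R) : 0 <= a <= 1 -> `|s| <= T -> 0 <= y <= 2 ->
  (s = 0 -> `|y - (1 - a)| <= h + delta) ->
  (s != 0 -> `|expR (- (s * y)) - 1 - moebius (expR (s * x)) (1 - a) * (expR (- s) - 1)| <=
     `|s| * (h + delta)) ->
  `|y - (1 - zpath x a s)| <= K ^+ 2 * (h + delta).
Proof.
move=> a01 sT /andP[y0 y2] H0 H1; have [s0|s0] := eqVneq s 0.
  rewrite /zpath s0 eqxx; have := H0 s0 => h1; apply: (le_trans h1).
  rewrite ler_peMl ?exprn_ege1//; exact: le_trans h1.
have /andP[z0 z1] := zpath_range x s a01; set z := zpath x a s in z0 z1 *.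
have sp : 0 < `|s| by rewrite normr_gt0.
rewrite -(ler_pM2l sp).
have b1 : - (2 * T) <= - (s * y).
  have : `|s * y| <= T * 2 by rewrite normrM [`|y|]ger0_norm// ler_pM.
  by move=> /(le_trans (ler_norm _)); lra.
have b2 : - (2 * T) <= - (s * (1 - z)).
  have : `|s * (1 - z)| <= T * 2 by rewrite normrM [`|1 - z|]ger0_norm ?ler_pM//; lra.
  by move=> /(le_trans (ler_norm _)); lra.
have -> : `|s| * `|y - (1 - z)| = `|- (s * y) - - (s * (1 - z))|.
  by rewrite -normrM distrC; congr `|_|; ring.
apply: (le_trans (expR_dist_ge b1 b2)).
have -> : expR (2 * T) = K ^+ 2 by rewrite expRM_natl.
rewrite mulrCA ler_wpM2l ?exprn_ge0 ?expR_ge0//; apply: le_trans (H1 s0).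
rewrite le_eqVlt; apply/orP; left; apply/eqP; congr `|_|.
by have := zpath_expE x a01 s0; rewrite -/z; lra.
Qed.

(** [1 - zpath x a s] nearly solves the equation for [(x', a')], so [zpath_near] applies. Of the
    power 6, the Moebius map takes 3, the bound [|expR (- s) - 1| <= K * |s|] takes 1 and
    [zpath_near] takes 2. *)
Lemma zpath_lipschitz (x x' a a' s : R) : 0 <= x <= 1 -> 0 <= x' <= 1 ->
  0 <= a <= 1 -> 0 <= a' <= 1 -> `|s| <= T ->
  `|zpath x a s - zpath x' a' s| <= K ^+ 6 * (T * `|x - x'| + `|a - a'|).
Proof.
move=> x01 x01' a01 a01' sT.
have sx (y : R) : 0 <= y <= 1 -> `|s * y| <= T.
  by move=> /andP[y0 y1]; rewrite normrM [`|y|]ger0_norm// -[T]mulr1 ler_pM.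
have E1 := expRT (sx _ x01); have E2 := expRT (sx _ x01').
have dE : `|expR (s * x) - expR (s * x')| <= K * (T * `|x - x'|).
  apply: le_trans (@expR_dist_le _ _ _ T _ _) _.
  - by have := sx _ x01; rewrite ler_norml => /andP[].
  - by have := sx _ x01'; rewrite ler_norml => /andP[].
  - by rewrite ler_wpM2l ?expR_ge0// -mulrBr normrM ler_wpM2r.
have c01 (c : R) : 0 <= c <= 1 -> 0 <= 1 - c <= 1 by move=> /andP[? ?]; apply/andP; split; lra.
have hM := moebius_dist K1 E1 E2 (c01 _ a01) (c01 _ a01').
have da : `|1 - a - (1 - a')| = `|a - a'| by rewrite distrC; congr `|_|; ring.
have m3 : `|moebius (expR (s * x)) (1 - a) - moebius (expR (s * x')) (1 - a')| <=
    K ^+ 3 * (T * `|x - x'| + `|a - a'|).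
  apply: (le_trans hM); rewrite da mulrDr lerD2r [K ^+ 3]exprSr -mulrA ler_wpM2l// exprn_ge0// expR_ge0.
set D := T * `|x - x'| + `|a - a'| in m3 *.
have D0 : 0 <= D by rewrite addr_ge0// mulr_ge0.
have /andP[z0 z1] := zpath_range x s a01.
have := @zpath_near x' a' s (1 - zpath x a s) (K ^+ 4 * D) 0 a01' sT.
rewrite addr0 (_ : K ^+ 2 * (K ^+ 4 * D) = K ^+ 6 * D); last by ring.
rewrite (_ : `|1 - zpath x a s - (1 - zpath x' a' s)| = `|zpath x a s - zpath x' a' s|); last first.
  by rewrite distrC; congr `|_|; ring.
apply.
- by apply/andP; split; lra.
- move=> s0; rewrite /zpath s0 eqxx da.
  apply: (@le_trans _ _ D); first by rewrite lerDr mulr_ge0.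
  by rewrite ler_peMl// exprn_ege1.
- move=> s0; have -> := zpath_expE x a01 s0; rewrite -mulrBl normrM mulrC.
  have e1 : `|expR (- s) - 1| <= K * `|s|.
    rewrite -expR0; apply: le_trans (@expR_dist_le _ _ _ T _ T0) _.
      by move: sT; rewrite ler_norml => /andP[]; lra.
    by rewrite subr0 normrN.
  apply: le_trans (ler_pM _ _ e1 m3) _ => //.
  by rewrite le_eqVlt; apply/orP; left; apply/eqP; ring.
Qed.

End zpath_bounds.

Section qnat_ratio.
Variable R : realType.

Lemma qnat_ratio_bounds (t : R) (a b : nat) : 0 <= t -> (a <= b)%N ->
  0 <= qnat t a / qnat t b <= 1.
Proof.
move=> t0 ab; rewrite mulr_ge0 ?invr_ge0 ?qnat_ge0//=.
exact: (tgeom_cdf_le1 (m := b)).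
Qed.

Lemma qnat_ratio_lip (n : nat) (t t' eta : R) (a b : nat) : 0 < t -> 0 < t' ->
  0 <= eta <= 1 -> t' <= t * expR (eta / n.+1%:R) -> t <= t' * expR (eta / n.+1%:R) ->
  (a <= b)%N -> (b <= n.+2)%N ->
  `|qnat t' a / qnat t' b - qnat t a / qnat t b| <= 2 * expR 2 * eta.
Proof.
move=> t0 t0' /andP[e0 e1] h1 h2 ab bn.
have up x y c : 0 < x -> 0 < y -> y <= x * expR (eta / n.+1%:R) -> (c <= n.+2)%N ->
    qnat y c <= expR eta * qnat x c.
  move=> x0 y0 yx cn; rewrite /qnat mulr_sumr; apply: ler_sum => j _.
  apply: (@le_trans _ _ ((x * expR (eta / n.+1%:R)) ^+ j)).
    by rewrite lerXn2r ?nnegrE ?mulr_ge0 ?expR_ge0// ltW.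
  rewrite exprMn mulrC ler_wpM2r ?exprn_ge0 ?(ltW x0)// -expRM_natl ler_expR.
  rewrite mulrA ler_pdivrMr// mulrC ler_wpM2l// ler_nat -ltnS.
  exact: leq_trans (ltn_ord j) cn.
have [->|b0] := posnP b.
  by rewrite !qnat0 !invr0 !mulr0 subrr normr0 mulr_ge0// mulr_ge0// expR_ge0.
have q0 x : 0 < x -> 0 < qnat x b by move=> x0; rewrite -(prednK b0) qnat_gt0// ltW.
have main x y : 0 < x -> 0 < y -> y <= x * expR (eta / n.+1%:R) ->
    x <= y * expR (eta / n.+1%:R) ->
    qnat y a / qnat y b - qnat x a / qnat x b <= 2 * expR 2 * eta.
  move=> x0 y0 yx xy.
  have /andP[r0 r1] := qnat_ratio_bounds (ltW x0) ab.
  have : qnat y a / qnat y b <= expR (2 * eta) * (qnat x a / qnat x b).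
    rewrite ler_pdivrMr ?q0//; apply: (le_trans (up x y a x0 y0 yx (leq_trans ab bn))).
    have := up y x b y0 x0 xy bn => h.
    have -> : expR (2 * eta) = expR eta * expR eta by rewrite -expRD; congr expR; ring.
    rewrite -!mulrA ler_wpM2l ?expR_ge0//.
    have -> : expR eta * (qnat x a * ((qnat x b)^-1 * qnat y b)) =
      qnat x a / qnat x b * (expR eta * qnat y b) by ring.
    apply: (@le_trans _ _ (qnat x a / qnat x b * qnat x b)).
      by rewrite divfK// gt_eqF ?q0.
    by rewrite ler_wpM2l.
  have := @expR_sub_le R (2 * eta) 0 ltac:(by rewrite mulr_ge0).
  rewrite expR0 subr0 => h.
  have h' : expR (2 * eta) * (2 * eta) <= expR 2 * (2 * eta).
    by rewrite ler_wpM2r ?mulr_ge0// ler_expR; lra.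
  have h3 : (expR (2 * eta) - 1) * (qnat x a / qnat x b) <= expR (2 * eta) - 1.
    rewrite ler_piMr// subr_ge0 -[leLHS]expR0 ler_expR; lra.
  move: h3; rewrite mulrBl mul1r; move: (_ * (qnat x a / _)) => Z; lra.
rewrite ler_norml; apply/andP; split; last exact: main.
rewrite lerNl opprB; exact: main.
Qed.

End qnat_ratio.

(** * From ratios of q-integers to the limit path *)

Section chain_near_zpath.
Variables (R : realType) (T : R).
Hypothesis T0 : 0 <= T.
Local Notation K := (expR T).
Local Notation B := (expR (2 * T)).

(** [4 * expR 2] moves the two rank ratios in time, [1] is the martingale deviation, [B ^+ 2]
    replaces [[i + 2]] by [[i + 1]], and the last term is the Moebius map at an argument that is off
    by [(2 * expR 2 + 4) * eta]. *)
Definition chain_const1 : R :=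
  4 * expR 2 + 1 + B ^+ 2 + K ^+ 3 * (2 * expR 2 + 4).
Definition chain_const : R := K ^+ 2 * (K * chain_const1 + B).

Variables (n i : nat).
Local Notation N := (n.+1%:R : R).
Local Notation time s := (expR (s / N)).

Let time_ratio s s' eta : `|s - s'| <= eta -> time s' <= time s * expR (eta / N).
Proof.
rewrite ler_distl => /andP[h1 h2]; rewrite -expRD ler_expR -mulrDl ler_pM2r ?invr_gt0 ?ltr0n//; lra.
Qed.

(* The identity behind the limit: the ratio at parameter [t^-1] is the Moebius
   image of the ratio at parameter [t]. *)
Lemma rank_ratio_moebius (t : R) l : 0 < t -> (l <= i)%N ->
  qnat t^-1 l.+1 / qnat t^-1 i.+1 = moebius (t ^+ i.+1) (tgeom_cdf i.+1 t l.+1).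
Proof.
move=> t0 li; rewrite !qnat_inv// /= /moebius /tgeom_cdf.
have El := qnatE t l.+1; have Ei := qnatE t i.+1.
have Q0 : qnat t i.+1 != 0 by rewrite gt_eqF ?qnat_gt0 ?ltW.
have -> : 1 - qnat t l.+1 / qnat t i.+1 + qnat t l.+1 / qnat t i.+1 * t ^+ i.+1 = t ^+ l.+1.
  apply: (mulfI Q0); rewrite -[t ^+ l.+1](subrK 1) -El -[t ^+ i.+1](subrK 1) -Ei.
  by field.
have tn0 : t != 0 by rewrite gt_eqF.
rewrite !exprVn !exprS; field.
by rewrite Q0 tn0 !expf_neq0.
Qed.

(** In the application [sa] and [sb] are the ends of a grid cell around [s], since the sandwich
    reads the later positions at one end and [l_i] at the other. Both ratios are moved to time [s]
    before they are compared. *)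
Lemma chain_near_zpath (s sa sb eta : R) (M l l1 m1 : nat) :
  `|s| <= T -> `|sa| <= T -> `|sb| <= T -> `|s - sa| <= eta -> `|s - sb| <= eta ->
  0 < eta <= 1 -> i.+1%:R^-1 <= eta ->
  (i <= n)%N -> (l <= i)%N -> (l1 <= i)%N -> (m1 <= n)%N -> (M <= n)%N ->
  `|rank_ratio (time sa) n M - rank_ratio (time sa) i l| <= eta ->
  `|tgeom_cdf i.+1 (time sb) l.+1 - tgeom_cdf i.+1 1 l1.+1| <= eta ->
  `|rank_ratio 1 n m1 - rank_ratio 1 i l1| <= eta ->
  `|M.+1%:R / N - (1 - zpath (i.+1%:R / N) (1 - m1%:R / N) s)| <= chain_const * eta.
Proof.
move=> sT saT sbT ssa ssb /andP[eta0 eta1] ieta i_n li l1i m1n Mn h1 h2 h3.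
have N0 : 0 < N by rewrite ltr0n.
have I0 : 0 < i.+1%:R :> R by rewrite ltr0n.
have Neta : N^-1 <= eta by apply: le_trans ieta; rewrite lef_pV2 ?posrE// ler_nat.
have K1 : 1 <= K by rewrite -expR0 ler_expR.
have B1 : 1 <= B by rewrite -expR0 ler_expR mulr_ge0.
have K0 : 0 < K by exact: expR_gt0.
have B0 : 0 < B by exact: expR_gt0.
set t := time s; have t0 : 0 < t by exact: expR_gt0.
have wt : window n T t by exact: window_exp.
set x := i.+1%:R / N; set b := m1%:R / N.
have x0 : 0 <= x by rewrite divr_ge0// ltW.
have x1 : x <= 1 by rewrite ler_pdivrMr// mul1r ler_nat.
have b01 : 0 <= b <= 1.
  by rewrite divr_ge0 ?(ltW N0)//= ler_pdivrMr// mul1r ler_nat ltnW.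
have eta01 : 0 <= eta <= 1 by rewrite (ltW eta0).
pose kappa : R := 2 * expR 2 * eta.
have lip u u' a c : `|u - u'| <= eta -> (a <= c)%N -> (c <= n.+2)%N ->
    `|qnat (time u') a / qnat (time u') c - qnat (time u) a / qnat (time u) c| <= kappa.
  move=> uu ac cn; apply: (qnat_ratio_lip (expR_gt0 _) (expR_gt0 _) eta01 _ _ ac cn).
    exact: time_ratio.
  by apply: time_ratio; rewrite distrC.
have dF : `|tgeom_cdf i.+1 (time sb) l.+1 - tgeom_cdf i.+1 t l.+1| <= kappa.
  have := @lip s sb l.+1 i.+1 ssb li; apply; by rewrite ltnS (leq_trans i_n).
have dR k m : (m <= k)%N -> (k <= n)%N ->
    `|rank_ratio (time sa) k m - rank_ratio t k m| <= kappa.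
  have iN u : (time u)^-1 = time (- u) by rewrite -expRN mulNr.
  move=> mk kn; rewrite /rank_ratio /t !iN.
  have dN : `|- s - - sa| <= eta by rewrite -opprD normrN.
  have := @lip (- s) (- sa) m.+1 k.+2 dN; apply; by rewrite !ltnS // ltnW.
have ratio1 k m : rank_ratio 1 k m = m.+1%:R / k.+2%:R :> R.
  by rewrite /rank_ratio invr1 !qnat1.
have d1 : `|tgeom_cdf i.+1 1 l1.+1 - rank_ratio 1 i l1| <= eta.
  rewrite ratio1 /tgeom_cdf !qnat1; apply: le_trans ieta.
  have -> : l1.+1%:R / i.+1%:R - l1.+1%:R / i.+2%:R = l1.+1%:R / i.+2%:R / i.+1%:R :> R.
    rewrite -[i.+2%:R](natr1 i.+1); move: (i.+1%:R : R) I0 => z z0; field.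
    by rewrite !gt_eqF// addr_gt0.
  rewrite ger0_norm ?divr_ge0// ler_piMl ?invr_ge0//.
  by rewrite ler_pdivrMr// mul1r ler_nat; exact: leqW.
have d2 : `|rank_ratio 1 n m1 - b| <= eta.
  rewrite ratio1 /b; apply: le_trans Neta.
  have -> : m1.+1%:R / n.+2%:R - m1%:R / N = (N - m1%:R) / n.+2%:R / N.
    rewrite -[n.+2%:R](natr1 n.+1) -(natr1 m1); move: N N0 => z z0; field.
    by rewrite !gt_eqF// addr_gt0.
  have m1N : m1%:R <= N by rewrite ler_nat ltnW.
  rewrite ger0_norm ?divr_ge0 ?subr_ge0// ler_piMl ?invr_ge0//.
  rewrite ler_pdivrMr// mul1r -[n.+2%:R](natr1 n.+1); have : 0 <= m1%:R :> R by [].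
  lra.
set F := tgeom_cdf i.+1 t l.+1 in dF.
(* The 4 counts [h2], [h3] and the index shifts [d1], [d2]; the rest is [kappa], the move in
   time. *)
have dFb : `|F - b| <= (2 * expR 2 + 4) * eta.
  have : (2 * expR 2 + 4) * eta = kappa + 4 * eta by rewrite /kappa; ring.
  rewrite ler_norml in dF *; rewrite !ler_norml in h2 h3 d1 d2 *.
  move: dF h2 h3 d1 d2 => /andP[? ?] /andP[? ?] /andP[? ?] /andP[? ?] /andP[? ?].
  by move=> ->; apply/andP; split; lra.
pose E := t ^+ i.+1.
have EE : E = expR (s * x).
  by rewrite /E /t -expRM_natl /x; congr expR; ring.
have EK : K^-1 <= E <= K.
  have : `|s * x| <= T by rewrite normrM (ger0_norm x0) -[T]mulr1 ler_pM.
  by rewrite EE ler_norml -expRN !ler_expR.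
have F01 : 0 <= F <= 1 by exact: (qnat_ratio_bounds (ltW t0)).
have dM := moebius_dist K1 EK EK F01 b01.
rewrite subrr normr0 mulr0 add0r -rank_ratio_moebius// in dM.
have q0 : 0 < t^-1 by rewrite invr_gt0.
have dH : `|rank_ratio t i l - qnat t^-1 l.+1 / qnat t^-1 i.+1| <= B ^+ 2 * eta.
  have Q1 : 0 < qnat t^-1 i.+1 by rewrite qnat_gt0// ltW.
  have Q2 : 0 < qnat t^-1 i.+2 by rewrite qnat_gt0// ltW.
  have -> : rank_ratio t i l - qnat t^-1 l.+1 / qnat t^-1 i.+1 =
      - (qnat t^-1 l.+1 / qnat t^-1 i.+1 * tgeom i.+2 t^-1 i.+1).
    rewrite /rank_ratio /tgeom; have P : qnat t^-1 i.+2 = qnat t^-1 i.+1 + t^-1 ^+ i.+1 by rewrite qnatS.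
    by move: P Q1 Q2 => -> Q1 Q2; field; rewrite !gt_eqF.
  have g0 := tgeom_ge0 i.+2 i.+1 (ltW q0).
  have /andP[r0 r1] := @qnat_ratio_bounds R t^-1 l.+1 i.+1 (ltW q0) li.
  rewrite normrN (ger0_norm (mulr_ge0 r0 g0)).
  apply: (@le_trans _ _ (tgeom i.+2 t^-1 i.+1)); first by rewrite ler_piMl.
  apply: (le_trans (tgeom_le (B := B) B0 _ _)) => //.
    move=> a ai; apply: (@window_pow _ n T T0 _ _ (window_inv wt)).
    by rewrite (leq_trans ai)// !ltnS.
  rewrite ler_wpM2l ?exprn_ge0 ?(ltW B0)//; apply: le_trans ieta.
  by rewrite lef_pV2 ?posrE// ler_nat.
set rho := rank_ratio t n M.
have drho : `|rho - moebius E b| <= chain_const1 * eta.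
  have e1 := dR n M Mn (leqnn _); have e2 := dR i l li i_n; rewrite -/rho in e1.
  have e3 : K ^+ 3 * `|F - b| <= K ^+ 3 * ((2 * expR 2 + 4) * eta).
    by rewrite ler_wpM2l// exprn_ge0// ltW.
  have -> : chain_const1 * eta = kappa + kappa + eta + B ^+ 2 * eta + K ^+ 3 * ((2 * expR 2 + 4) * eta).
    by rewrite /chain_const1 /kappa; ring.
  move: e1 e2 h1 dH (le_trans dM e3); rewrite !ler_norml.
  move=> /andP[? ?] /andP[? ?] /andP[? ?] /andP[? ?] /andP[? ?].
  by apply/andP; split; lra.
have c1 : 0 <= chain_const1 * eta by exact: le_trans drho.
have rho01 : 0 <= rho <= 1.
  by apply: (qnat_ratio_bounds (ltW q0)); exact: leqW.
have a01 : 0 <= 1 - b <= 1 by case/andP: b01 => ? ?; rewrite subr_ge0 gerBl; apply/andP.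
have bE : 1 - (1 - b) = b by ring.
have -> : chain_const * eta = K ^+ 2 * (K * (chain_const1 * eta) + B * eta).
  by rewrite /chain_const; ring.
have y01 : 0 <= M.+1%:R / N <= 1.
  by rewrite divr_ge0 ?(ltW N0)//= ler_pdivrMr// mul1r ler_nat.
apply: zpath_near => //.
- by case/andP: y01 => y0 y1; rewrite y0 /= (le_trans y1)// ler1n.
- move=> s0; rewrite bE.
  have t1 : t = 1 by rewrite /t s0 mul0r expR0.
  have mb : moebius E b = b by rewrite /moebius /E t1 expr1n mul1r mulr1 subrK divr1.
  have dy : `|M.+1%:R / N - rho| <= eta.
    rewrite /rho t1 ratio1; apply: le_trans Neta.
    have -> : M.+1%:R / N - M.+1%:R / n.+2%:R = M.+1%:R / n.+2%:R / N.
      rewrite -[n.+2%:R](natr1 n.+1); move: N N0 => z z0; field.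
      by rewrite !gt_eqF// addr_gt0.
    rewrite ger0_norm ?divr_ge0// ler_piMl ?invr_ge0//.
    by rewrite ler_pdivrMr// mul1r ler_nat; exact: leqW.
  rewrite mb in drho; apply: (le_trans (ler_distD rho _ _)); rewrite addrC; apply: lerD.
    by apply: (le_trans drho); rewrite ler_peMl.
  by apply: (le_trans dy); rewrite ler_peMl// ltW.
move=> s0; rewrite bE -EE.
(* An exact relation between q-integers, free of any division by [s]; replacing [t^-1 ^+ n.+2] by
   [expR (- s)] costs one factor [expR (- (s / N))]. *)
have e1 : expR (- (s * (M.+1%:R / N))) - 1 = rho * (t^-1 ^+ n.+2 - 1).
  have -> : expR (- (s * (M.+1%:R / N))) = t^-1 ^+ M.+1.
    by rewrite /t -expRN -expRM_natl; congr expR; ring.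
  rewrite -!qnatE /rho /rank_ratio mulrA divfK// gt_eqF// qnat_gt0// ltW//.
rewrite e1.
have e2 : `|t^-1 ^+ n.+2 - expR (- s)| <= `|s| * (B * eta).
  have qE : t^-1 ^+ n.+2 = expR (- s - s / N).
    rewrite /t -expRN -expRM_natl; congr expR; rewrite -(natr1 n.+1); move: N N0 => z z0.
    by field; rewrite gt_eqF.
  have sN : `|s / N| <= T.
    rewrite normrM [`|N^-1|]ger0_norm ?invr_ge0 ?(ltW N0)// ler_pdivrMr//.
    by apply: (le_trans sT); rewrite ler_peMr// ler1n.
  have b1 : - s <= T by apply: le_trans (ler_norm _) _; rewrite normrN.
  have b2 : - (s / N) <= T by apply: le_trans (ler_norm _) _; rewrite normrN.
  have TE : T + T = 2 * T by rewrite mulr_natl mulr2n.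
  have b3 : - s <= 2 * T by rewrite -TE (le_trans b1)// lerDl.
  have b4 : - s - s / N <= 2 * T by rewrite -TE lerD.
  rewrite qE; apply: (le_trans (expR_dist_le b4 b3)).
  have -> : - s - s / N - - s = - (s / N) by rewrite opprK addrAC addNr add0r.
  rewrite normrN normrM [`|N^-1|]ger0_norm ?invr_ge0 ?(ltW N0)// mulrCA.
  by rewrite ler_wpM2l// ler_wpM2l// ltW.
have e3 : `|expR (- s) - 1| <= `|s| * K.
  rewrite -expR0 mulrC; apply: le_trans (@expR_dist_le _ _ _ T _ T0) _.
    by apply: le_trans (ler_norm _) _; rewrite normrN.
  by rewrite subr0 normrN.
have -> : rho * (t^-1 ^+ n.+2 - 1) - moebius E b * (expR (- s) - 1) =
   (rho - moebius E b) * (expR (- s) - 1) + rho * (t^-1 ^+ n.+2 - expR (- s)) by ring.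
apply: (le_trans (ler_normD _ _)); rewrite [X in _ <= X]mulrDr; apply: lerD.
  have -> : `|s| * (K * (chain_const1 * eta)) = chain_const1 * eta * (`|s| * K) by ring.
  by rewrite normrM; exact: ler_pM.
case/andP: rho01 => r0 r1; rewrite normrM (ger0_norm r0).
by apply: le_trans e2; rewrite ler_piMl.
Qed.

End chain_near_zpath.

(** * Discretization in the Skorokhod space *)

(** A contraction cannot undo the increase of the identity; surjectivity is the intermediate value
    theorem. *)
Lemma lipschitz_time_change (R : realType) (a b kappa : R) (g : R -> R) : a <= b ->
  0 <= kappa -> kappa < 1 -> (forall x y, `|g x - g y| <= kappa * `|x - y|) ->
  g a = 0 -> g b = 0 -> time_change a b (fun t => t + g t).
Proof.
move=> ab k0 k1 gl ga gb.
have mono x y : x < y -> x + g x < y + g y.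
  move=> xy; have := gl y x; rewrite (gtr0_norm (_ : 0 < y - x)) ?subr_gt0//.
  move=> /(le_trans (ler_norm _)) h1.
  have := gl y x; rewrite (gtr0_norm (_ : 0 < y - x)) ?subr_gt0// distrC.
  move=> /(le_trans (ler_norm _)) h2.
  have : 0 < (1 - kappa) * (y - x) by rewrite mulr_gt0// subr_gt0.
  rewrite mulrBl mul1r; lra.
have mono_le x y : x <= y -> x + g x <= y + g y.
  by rewrite le_eqVlt => /predU1P[->//|/mono/ltW].
split; last by move=> x y _ _; exact: mono.
split.
- move=> t /=; rewrite !in_itv/= => /andP[at_ tb].
  by have := mono_le _ _ at_; have := mono_le _ _ tb; rewrite ga gb !addr0 => -> ->.
- move=> x y _ _ xy; have [h|h|//] := ltgtP x y.
  + by have := mono _ _ h; rewrite xy ltxx.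
  + by have := mono _ _ h; rewrite xy ltxx.
- move=> v /=; rewrite in_itv/= => /andP[av vb].
  have cont : continuous (fun t => t + g t).
    move=> x; apply/cvgrPdist_lt => e e0; near=> y.
    have h : `|x - y| < e / 2 by near: y; apply: cvgr_dist_lt => //; rewrite divr_gt0.
    have -> : x + g x - (y + g y) = (x - y) + (g x - g y) by ring.
    apply: (le_lt_trans (ler_normD _ _)).
    have := gl x y; have : kappa * `|x - y| <= `|x - y| by rewrite ler_piMl// ltW.
    lra.
  have [|c cab <-] := @IVT R (fun t => t + g t) a b v ab (continuous_subspaceT cont).
    by rewrite ga gb !addr0 (min_idPl ab) (max_idPr ab) av vb.
  by exists c.
Unshelve. all: by end_near. Qed.

(** By compactness it is enough to look near one [x], with breakpoints [x - d / 2], [x],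
    [x + d / 2]. A point separated by none of them from a point within [d / 2] of [x] is itself
    within [d] of [x] and on the same side, where a one-sided limit controls [f]. *)
Lemma cadlag_breakpoints (R : realType) (a b : R) (f : R -> R) (e : R) :
  cadlag_on `[a, b] f -> 0 < e -> exists s : seq R,
    forall t u, t \in `[a, b] -> u \in `[a, b] ->
      (forall p, p \in s -> (p <= t) = (p <= u)) -> `|f t - f u| < e.
Proof.
move=> fc e0.
(* Finite lists of breakpoints directed by inclusion, as the filter in the covering form of
   compactness. *)
pose F : set_system (seq R) := [set A | exists s0 : seq R, forall s : seq R, {subset s0 <= s} -> A s].
have FF : Filter F.
  split; first by exists [::].
    move=> A B [s1 h1] [s2 h2]; exists (s1 ++ s2) => s ss; split.
      by apply: h1 => x xs; apply: ss; rewrite mem_cat xs.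
    by apply: h2 => x xs; apply: ss; rewrite mem_cat xs orbT.
  by move=> A B AB [s1 h1]; exists s1 => s /h1/AB.
have := (compact_near_coveringP `[a, b]%classic).1 (@segment_compact R a b).
move=> /(_ (seq R) F (fun s t => t \in `[a, b] -> forall u, u \in `[a, b] ->
  (forall p, p \in s -> (p <= t) = (p <= u)) -> `|f t - f u| < e) FF).
move=> H; have [|s0 /(_ s0 (fun x => id)) hs0] := H; last first.
  by exists s0 => t u tab uab; apply: (hs0 t).
move=> x xab; have [fr [l fl]] := fc x xab.
have e2 : 0 < e / 2 by rewrite divr_gt0.
move/cvgrPdist_lt/(_ _ e2)/nbhs_ballP : fr => [d1 /= d10 h1].
move/cvgrPdist_lt/(_ _ e2)/nbhs_ballP : fl => [d2 /= d20 h2].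
pose d := Num.min d1 d2.
have d0 : 0 < d by rewrite lt_min d10.
have right y : y \in `[a, b] -> x <= y -> y < x + d -> `|f x - f y| < e / 2.
  move=> yab; rewrite le_eqVlt => /predU1P[<-|xy] yd; first by rewrite subrr normr0.
  apply: h1 => //; rewrite /ball/= ltr_distlC; apply/andP; split; first lra.
  by apply: (lt_le_trans yd); rewrite lerD2l ge_min lexx.
have left y : y \in `[a, b] -> y < x -> x - d < y -> `|l - f y| < e / 2.
  move=> yab yx yd; apply: h2 => //; rewrite /ball/= ltr_distlC; apply/andP; split; last lra.
  by apply: le_lt_trans yd; rewrite lerD2l lerN2 ge_min lexx orbT.
have d2' : 0 < d / 2 by rewrite divr_gt0.
exists ([set y | `|x - y| < d / 2], [set s : seq R | {subset [:: x; x - d / 2; x + d / 2] <= s}]).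
  split; last by exists [:: x; x - d / 2; x + d / 2].
  by apply/nbhs_ballP; exists (d / 2).
move=> [y s] /= [xy ss] yab u uab sep.
have := sep x (ss _ _); rewrite inE eqxx => /(_ isT) sx.
have := sep (x - d / 2) (ss _ _); rewrite !inE eqxx orbT => /(_ isT) sl.
have := sep (x + d / 2) (ss _ _); rewrite !inE eqxx !orbT => /(_ isT) sr.
move: xy; rewrite ltr_distlC => /andP[y1 y2].
have u1 : x - d / 2 <= u by rewrite -sl ltW.
have u2 : u < x + d / 2 by rewrite ltNge -sr -ltNge.
have [xy|yx] := leP x y.
  have xu : x <= u by rewrite -sx.
  have h3 := right y yab xy ltac:(lra); have h4 := right u uab xu ltac:(lra).
  rewrite distrC in h3.
  apply: (le_lt_trans (ler_distD (f x) _ _)); lra.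
have ux : u < x by rewrite ltNge -sx -ltNge.
have h3 := left y yab yx ltac:(lra); have h4 := left u uab ux ltac:(lra).
rewrite distrC in h3.
apply: (le_lt_trans (ler_distD l _ _)); lra.
Qed.

(** * Grids and step approximations in the J1 topology *)

Section grid.
Variables (R : realType) (a b : R) (k : nat).
Hypothesis ab : a < b.

Definition mesh : R := (b - a) / k.+1%:R.
Definition grid_index (t : R) : nat := Num.truncn ((t - a) / mesh).
Definition grid_point (j : nat) : R := a + j%:R * mesh.
Definition grid_ceil (t : R) : R := grid_point `|Num.ceil ((t - a) / mesh)|%N.

Lemma mesh_gt0 : 0 < mesh.
Proof. by rewrite divr_gt0// subr_gt0. Qed.

Let U0 t : a <= t -> 0 <= (t - a) / mesh.
Proof. by move=> at_; rewrite divr_ge0 ?subr_ge0// ltW// mesh_gt0. Qed.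

Let UE t j : (j%:R <= (t - a) / mesh) = (grid_point j <= t).
Proof. by rewrite ler_pdivlMr ?mesh_gt0// lerBrDl. Qed.

Let UE' t j : ((t - a) / mesh <= j%:R) = (t <= grid_point j).
Proof. by rewrite ler_pdivrMr ?mesh_gt0// lerBlDl. Qed.

Lemma grid_index_le t : t <= b -> (grid_index t <= k.+1)%N.
Proof.
move=> tb; have [at_|ta] := leP a t.
  rewrite -(ler_nat R) (le_trans (_ : _ <= (t - a) / mesh))//.
    by have /andP[] := truncn_itv (U0 at_).
  rewrite ler_pdivrMr ?mesh_gt0// /mesh mulrC divfK ?pnatr_eq0//; lra.
rewrite /grid_index (truncn0Pn _ _)//.
rewrite -ltNge; apply: (@lt_le_trans _ _ 0) => //.
by rewrite pmulr_llt0 ?subr_lt0// invr_gt0 mesh_gt0.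
Qed.

Lemma grid_point_le t : a <= t -> grid_point (grid_index t) <= t.
Proof. by move=> at_; rewrite -UE; have /andP[] := truncn_itv (U0 at_). Qed.

Lemma grid_point_itv t : t \in `[a, b] -> grid_point (grid_index t) \in `[a, b].
Proof.
rewrite !in_itv/= => /andP[at_ tb]; rewrite (le_trans (grid_point_le at_) tb) andbT.
by rewrite lerDl mulr_ge0// ltW// mesh_gt0.
Qed.

Lemma grid_ceilE t : a <= t ->
  (`|Num.ceil ((t - a) / mesh)|%N%:R : R) = (Num.ceil ((t - a) / mesh))%:~R.
Proof.
move=> at_; have : 0 <= Num.ceil ((t - a) / mesh).
  by rewrite ceil_ge0 (lt_le_trans _ (U0 at_))// ltrN10.
by case: Num.ceil.
Qed.

(* Rounding up and rounding down to the grid are adjoint. *)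
Lemma grid_ceil_adj t u : a <= t -> a <= u ->
  (grid_ceil t <= u) = (t <= grid_point (grid_index u)).
Proof.
move=> at_ au; rewrite -UE -UE' /grid_index -truncn_ge_nat ?U0//.
by rewrite -(ler_nat R) grid_ceilE// -[X in _ <= X]/(((Num.truncn ((u - a) / mesh)) : int)%:~R) ler_int ceil_le_int.
Qed.

Lemma grid_ceil_dist t : a <= t -> `|grid_ceil t - t| <= mesh.
Proof.
move=> at_; have /andP[c1 c2] := ceil_itv ((t - a) / mesh).
have m0 := mesh_gt0.
have h1 : (t - a) <= (Num.ceil ((t - a) / mesh))%:~R * mesh by rewrite -ler_pdivrMr.
have h2 : (Num.ceil ((t - a) / mesh))%:~R * mesh < t - a + mesh.
  by move: c1; rewrite intrB mulr1z ltr_pdivlMr// mulrBl mul1r; lra.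
rewrite /grid_ceil /grid_point grid_ceilE// ger0_norm; lra.
Qed.

Lemma grid_ceil_a : grid_ceil a = a.
Proof. by rewrite /grid_ceil subrr mul0r ceil0 /grid_point mul0r addr0. Qed.

Lemma grid_ceil_b : grid_ceil b = b.
Proof.
rewrite /grid_ceil /grid_point grid_ceilE ?ltW//.
have -> : (b - a) / mesh = k.+1%:R by rewrite /mesh invf_div mulrC divfK// subr_eq0 gt_eqF.
rewrite -[k.+1%:R]/((k.+1 : int)%:~R) intrKceil /mesh mulrC divfK ?pnatr_eq0//.
by rewrite addrC subrK.
Qed.

Lemma step_cadlag (v : nat -> R) D : cadlag_on D (fun t => v (grid_index t)).
Proof.
move=> t _; have m0 := mesh_gt0.
have near_cst (F : set_system R) (FF : Filter F) (g : R -> nat) c :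
    (\forall x \near F, g x = c) -> v (g x) @[x --> within D F] --> v c.
  move=> h; have C : cst (v c) x @[x --> within D F] --> v c by exact: cvg_cst.
  apply: cvg_trans C; apply: near_eq_cvg.
  by apply: (@filterS _ F FF) h => x gx _; rewrite /= gx.
have idx (z : int) (x : R) : z%:~R <= (x - a) / mesh < (z + 1)%:~R ->
    grid_index x = if z is Posz n then n else 0%N.
  by move=> h; rewrite /grid_index truncEfloor (floor_def h).
have UEr (x z : R) : ((x - a) / mesh < z) = (x < a + z * mesh).
  by rewrite ltr_pdivrMr// ltrBlDl.
have UEl (x z : R) : (z < (x - a) / mesh) = (a + z * mesh < x).
  by rewrite ltr_pdivlMr// ltrBrDl.
split; last eexists.
  apply: near_cst; have /andP[z1 z2] := floor_itv ((t - a) / mesh).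
  set z := Num.floor _ in z1 z2.
  rewrite (idx z t); last by rewrite z1 z2.
  rewrite UEr in z2; near=> x; apply: idx; apply/andP; split.
    apply: (le_trans z1); rewrite ler_pM2r ?invr_gt0// lerD2r ltW//.
  by rewrite UEr; near: x; exact: nbhs_right_lt.
(* To the left of [t] the index is the ceiling minus one; negative values are truncated to 0. *)
apply: near_cst; have /andP[z1 z2] := ceil_itv ((t - a) / mesh).
set z := Num.ceil _ in z1 z2.
rewrite UEl in z1; near=> x; apply: (idx (z - 1)); apply/andP; split.
  by rewrite ltW// UEl; near: x; exact: nbhs_left_gt.
rewrite subrK; apply: lt_le_trans z2; rewrite ltr_pM2r ?invr_gt0// ltrD2r.
by near: x; exact: nbhs_left_lt.
Unshelve. all: by end_near. Qed.

(** The time change moves each breakpoint [p] to [grid_ceil p]. By adjunction, [t] and the grid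
    point below its image then lie on the same side of every breakpoint, so [f] is close at the two.
    Counting [a] and [b] as breakpoints keeps the end points fixed. *)
Lemma step_J1_ball (f y : skorokhod a b) (s : seq R) (e : R) :
  0 < e -> mesh * (size s).+2%:R < e ->
  (forall t u, t \in `[a, b] -> u \in `[a, b] ->
      (forall p, p \in s -> (p <= t) = (p <= u)) -> `|f t - f u| < e) ->
  (forall t, t \in `[a, b] -> y t = f (grid_point (grid_index t))) ->
  forall delta : R, 0 < delta ->
  (forall p q, p \in a :: b :: s -> q \in a :: b :: s -> p != q -> delta <= `|p - q|) ->
  mesh * (size s).+2%:R < delta -> J1_ball f e y.
Proof.
move=> e0 me fs yf delta delta0 sep small.
have m0 := mesh_gt0.
pose r := undup [seq p <- a :: b :: s | p \in `[a, b]].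
have rP p : p \in r = (p \in a :: b :: s) && (p \in `[a, b]).
  by rewrite mem_undup mem_filter andbC.
(* Tents of half-width [delta]: at a breakpoint only its own tent is nonzero. Elsewhere the supports
   may overlap, which costs the factor [(size s).+2]. *)
pose bump (u : R) := Num.max 0 (1 - `|u| / delta).
pose g t := \sum_(p <- r) (grid_ceil p - p) * bump (t - p).
have bump0 u : delta <= `|u| -> bump u = 0.
  by move=> du; apply/max_idPl; rewrite subr_le0 ler_pdivlMr// mul1r.
have bump1 : bump 0 = 1.
  by rewrite /bump normr0 mul0r subr0; apply/max_idPr.
have bump_lip u v : `|bump u - bump v| <= `|u - v| / delta.
  rewrite /bump; apply: (@le_trans _ _ `|(1 - `|u| / delta) - (1 - `|v| / delta)|).
    by rewrite /Num.max; do 2 case: ltP => ?; rewrite ?subrr ?normr0//;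
      rewrite ler_norml; have := ler_norm ((1 - `|u| / delta) - (1 - `|v| / delta));
      have := ler_norm (- ((1 - `|u| / delta) - (1 - `|v| / delta))); rewrite normrN => ? ?;
      apply/andP; split; lra.
  have -> : (1 - `|u| / delta) - (1 - `|v| / delta) = (`|v| - `|u|) / delta by ring.
  rewrite normrM [`|delta^-1|]ger0_norm ?invr_ge0 ?(ltW delta0)// ler_wpM2r ?invr_ge0 ?(ltW delta0)//.
  by rewrite distrC ler_dist_dist.
have gr p : p \in r -> g p = grid_ceil p - p.
  move=> pr; rewrite /g (bigD1_seq p)//= ?undup_uniq// subrr bump1 mulr1 big_seq_cond big1 ?addr0//.
  move=> q /andP[qr qp]; rewrite bump0 ?mulr0//; apply: sep; last by rewrite eq_sym.
    by move: pr; rewrite rP => /andP[].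
  by move: qr; rewrite rP => /andP[].
have sr : (size r <= (size s).+2)%N.
  by rewrite (leq_trans (size_undup _))// size_filter (leq_trans (count_size _ _)).
pose kappa := mesh * (size s).+2%:R / delta.
have glip x z : `|g x - g z| <= kappa * `|x - z|.
  rewrite /g -sumrB; apply: (le_trans (ler_norm_sum _ _ _)).
  apply: (@le_trans _ _ (\sum_(p <- r) mesh * (`|x - z| / delta))).
    rewrite !big_seq; apply: ler_sum => p; rewrite rP => /andP[_].
    rewrite in_itv/= => /andP[ap _].
    rewrite -mulrBr normrM ler_pM ?grid_ceil_dist//.
    apply: (le_trans (bump_lip _ _)); rewrite opprB addrA subrK//.
  rewrite big_const_seq count_predT iter_addr_0 -mulr_natr /kappa.
  have -> : mesh * (`|x - z| / delta) * (size r)%:R = (mesh / delta * `|x - z|) * (size r)%:R by ring.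
  have -> : mesh * (size s).+2%:R / delta * `|x - z| = (mesh / delta * `|x - z|) * (size s).+2%:R by ring.
  by rewrite ler_wpM2l ?ler_nat// mulr_ge0// divr_ge0 ?ltW.
have ar : a \in r by rewrite rP inE eqxx in_itv/= lexx ltW.
have br : b \in r by rewrite rP 2!inE eqxx orbT/= in_itv/= lexx (ltW ab).
have tc : time_change a b (fun t => t + g t).
  apply: (lipschitz_time_change (kappa := kappa)) => //.
  - exact: ltW.
  - by apply: divr_ge0; [apply: mulr_ge0 => //; exact: ltW | exact: ltW].
  - by rewrite /kappa ltr_pdivrMr// mul1r.
  - by rewrite gr// grid_ceil_a subrr.
  - by rewrite gr// grid_ceil_b subrr.
have [[tf _ _] tm] := tc.
exists (fun t => t + g t); split => // t tab.
have bump01 u : `|bump u| <= 1.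
  rewrite ger0_norm; last by rewrite le_max lexx.
  by rewrite ge_max ler01/= gerBl divr_ge0// ltW.
have gm u : `|g u| < e.
  apply: le_lt_trans me; apply: (le_trans (ler_norm_sum _ _ _)).
  apply: (@le_trans _ _ (\sum_(p <- r) mesh)); last first.
    rewrite big_const_seq count_predT iter_addr_0 -[mesh *+ _]mulr_natr.
    by rewrite ler_wpM2l ?(ltW m0)// ler_nat.
  rewrite !big_seq; apply: ler_sum => p; rewrite rP => /andP[_].
  rewrite in_itv/= => /andP[ap _].
  by rewrite normrM -[leRHS]mulr1 ler_pM// grid_ceil_dist.
rewrite [t + g t - t]addrC addKr gm; split => //.
have lab : t + g t \in `[a, b] by exact: tf.
rewrite yf//; apply: fs => //; first exact: grid_point_itv.
move: (tab) (lab); rewrite !in_itv/= => /andP[at_ tb] /andP[al lb].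
move=> p ps.
have [pa|ap] := ltP p a.
  have /andP[h _] : a <= grid_point (grid_index (t + g t)) <= b.
    by have := grid_point_itv lab; rewrite in_itv.
  by rewrite (le_trans (ltW pa) at_) (le_trans (ltW pa) h).
have [bp|pb] := ltP b p.
  have /andP[_ h] : a <= grid_point (grid_index (t + g t)) <= b.
    by have := grid_point_itv lab; rewrite in_itv.
  by rewrite !leNgt (le_lt_trans tb bp) (le_lt_trans h bp).
have pab : p \in `[a, b] by rewrite in_itv/= ap.
have pr : p \in r by rewrite rP !inE ps !orbT.
rewrite -grid_ceil_adj//.
have pE : p + g p = grid_ceil p by rewrite gr// addrC subrK.
rewrite -pE; apply/idP/idP.
  by rewrite le_eqVlt => /predU1P[->//|pt]; apply/ltW/tm.
by apply: contraTT; rewrite -!ltNge => tp; exact: tm.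
Qed.

End grid.

Lemma finite_separation (R : realType) (s : seq R) : exists2 delta : R, 0 < delta &
  forall p q, p \in s -> q \in s -> p != q -> delta <= `|p - q|.
Proof.
have one (p : R) (r : seq R) : exists2 delta : R, 0 < delta &
    forall q, q \in r -> p != q -> delta <= `|p - q|.
  elim: r => [|q r [d d0 IH]]; first by exists 1.
  have [<-|pq] := eqVneq p q.
    by exists d => // q'; rewrite inE => /predU1P[->|/IH//]; rewrite eqxx.
  exists (Num.min d `|p - q|); first by rewrite lt_min d0 normr_gt0 subr_eq0.
  move=> q'; rewrite inE => /predU1P[-> _|q'r /IH h]; first by rewrite ge_min lexx orbT.
  by rewrite ge_min h.
suff : forall r : seq R, exists2 delta : R, 0 < delta &
  forall p q, p \in r -> q \in s -> p != q -> delta <= `|p - q| by apply.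
elim=> [|p r [d d0 IH]]; first by exists 1.
have [d' d'0 h] := one p s; exists (Num.min d d'); first by rewrite lt_min d0.
move=> p' q; rewrite inE => /predU1P[->|pr] qs pq; rewrite ge_min.
  by rewrite (h q qs pq) orbT.
by rewrite IH.
Qed.

Lemma step_J1_cvg (R : realType) (a b : R) (f : skorokhod a b) (e : R) :
  a < b -> 0 < e -> exists k0, forall k, (k0 <= k)%N -> forall y : skorokhod a b,
    (forall t, t \in `[a, b] -> y t = f (grid_point a b k (grid_index a b k t))) ->
    J1_ball f e y.
Proof.
move=> ab e0; have [s fs] := cadlag_breakpoints (sk_cadlag f) e0.
have [delta delta0 sep] := finite_separation (a :: b :: s).
pose c := (b - a) * (size s).+2%:R / Num.min e delta.
have m0 : 0 < Num.min e delta by rewrite lt_min e0.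
exists (Num.truncn c) => k kk y yf.
have ck : c < k.+1%:R by apply: (lt_le_trans (truncnS_gt c)); rewrite ler_nat ltnS.
have small : mesh a b k * (size s).+2%:R < Num.min e delta.
  by rewrite /mesh mulrAC ltr_pdivrMr// [ltRHS]mulrC -ltr_pdivrMr.
apply: (step_J1_ball ab (s := s) e0 _ fs yf delta0 sep).
  by apply: lt_le_trans small _; rewrite ge_min lexx.
by apply: lt_le_trans small _; rewrite ge_min lexx orbT.
Qed.

(** A limit lies in the open set [U] iff for some [m] the approximants eventually lie in [V m]. The
    approximants will be finite-valued, which is why preimages of arbitrary sets are assumed
    measurable. *)
Lemma pointwise_limit_borel_measurable (R : realType) (S : pseudoMetricType R)
    (d : measure_display) (W : measurableType d) (Y : W -> S) (Yk : nat -> W -> S) :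
  (forall k B, measurable (Yk k @^-1` B)) ->
  (forall w e, 0 < e -> exists k0, forall k, (k0 <= k)%N -> ball (Y w) e (Yk k w)) ->
  borel_measurable Y.
Proof.
move=> mY cY.
suff : <<s [set U : set S | open U] >> `<=` [set B | measurable (Y @^-1` B)] by [].
apply: smallest_sub; first split.
- by rewrite /= preimage_set0; exact: measurable0.
- by move=> A mA; rewrite /= setTD preimage_setC; exact: measurableC.
- by move=> A mA; rewrite /= preimage_bigcup; exact: bigcupT_measurable.
move=> U /= oU.
pose V m := [set x : S | ball x m.+1%:R^-1 `<=` U].
have -> : Y @^-1` U = \bigcup_m \bigcup_k0 \bigcap_k (Yk (k0 + k)%N @^-1` V m).
  apply/seteqP; split => [w /= UYw|w [m _ [k0 _ h]]].
    have /nbhs_ballP[e /= e0 eU] : nbhs (Y w) U by rewrite nbhsE; exists U.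
    pose m := Num.truncn (2 / e); exists m => //.
    have me : m.+1%:R^-1 < e / 2.
      by rewrite -[ltRHS]invf_div ltf_pV2 ?posrE ?divr_gt0// truncnS_gt.
    have [k0 hk] := cY w m.+1%:R^-1 ltac:(by []).
    exists k0 => // k _ z /= Vz; apply: eU.
    have := ball_triangle (hk _ (leq_addr k k0)) Vz; apply: le_ball.
    by rewrite [leRHS]splitr lerD// ltW.
  have [k1 hk] := cY w m.+1%:R^-1 ltac:(by []).
  have /= := h k1 Logic.I; apply; apply: ball_sym; apply: hk; exact: leq_addl.
apply: bigcupT_measurable => m; apply: bigcupT_measurable => k0.
by apply: bigcapT_measurable => k; exact: mY.
Qed.

Section particle.
Variables (R : realType) (n : nat) (d : measure_display) (W : measurableType d).
Variables (P : probability W R) (sigma : R -> W -> 'S_n.+1) (I : W -> 'I_n.+1).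
Hypothesis hs : birth_mallows_process P sigma.
Hypothesis mI : forall i, measurable (I @^-1` [set i]).

Lemma particle_path_measurable (T : R) : 0 < T ->
  borel_measurable (particle_path hs T I).
Proof.
move=> T0; have ab : - T < T by lra.
(* The step path depends on finite data: the index and the permutations at the [k.+2] grid points
   [0, ..., k.+1]. *)
pose v k (x : 'I_n.+1 * {ffun 'I_k.+2 -> 'S_n.+1}) (j : nat) : R :=
  n.+1%:R^-1 * (x.2 (inord j) x.1).+1%:R.
have v01 k x j : 0 <= v k x j <= 1.
  rewrite /v mulr_ge0//= mulrC ler_pdivrMr// mul1r ler_nat; exact: ltn_ord.
pose Yd k x : skorokhod (- T) T :=
  skorokhod_of (@step_cadlag R (- T) T k ab (v k x) `[- T, T]) (fun t _ => v01 k x (grid_index (- T) T k t)).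
pose h k w : 'I_n.+1 * {ffun 'I_k.+2 -> 'S_n.+1} :=
  (I w, [ffun j : 'I_k.+2 => sigma (expR (grid_point (- T) T k j / n.+1%:R)) w]).
apply: (@pointwise_limit_borel_measurable R _ _ _ _ (fun k w => Yd k (h k w))).
  move=> k B; apply: (measurable_finite_preimage (h := h k) _ [set x | B (Yd k x)]) => -[i s].
  rewrite (_ : _ @^-1` _ = I @^-1` [set i] `&` \bigcap_(j in [set: 'I_k.+2])
     (sigma (expR (grid_point (- T) T k j / n.+1%:R)) @^-1` [set s j])).
    apply: measurableI => //; apply: fin_bigcap_measurable => // j _.
    by apply: (mallows_measurable hs); exact: expR_ge0.
  apply/seteqP; split => w /=.
    by case=> -> <-; split => // j _ /=; rewrite ffunE.
  by case=> Iw hj; rewrite /h Iw; congr pair; apply/ffunP => j; rewrite ffunE; exact: hj.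
move=> w e e0; have [k0 hk] := step_J1_cvg (particle_path hs T I w) ab e0.
exists k0 => k kk; apply: (hk k kk) => t tab.
have tb : t <= T by move: tab; rewrite in_itv/= => /andP[].
rewrite skorokhod_ofE// skorokhod_ofE ?grid_point_itv//.
by rewrite /v /h /particle /= ffunE inordK// ltnS grid_index_le.
Qed.

End particle.

(** * Rounding the uniform pair to a grid *)

Section cells.
Variables (R : realType) (N : nat).

(** The minimum puts [x = 1] into the last cell, which is therefore closed on the right. *)
Definition cell (x : R) : 'I_N.+1 := inord (minn (Num.truncn (x * N.+1%:R)) N).

(** The right end of the cell: with positions and values counted from 1, this is the rescaled
    position or value with index [i]. *)
Definition cell_point (i : 'I_N.+1) : R := i.+1%:R / N.+1%:R.

Definition cell_itv (i : 'I_N.+1) : interval R :=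
  Interval (BLeft (i%:R / N.+1%:R)) (BSide (i < N)%N (i.+1%:R / N.+1%:R)).

Let N0 : 0 < N.+1%:R :> R. Proof. by []. Qed.

Lemma cell_point01 i : 0 <= cell_point i <= 1.
Proof. by rewrite divr_ge0//= ler_pdivrMr// mul1r ler_nat. Qed.

Lemma cellE x i : 0 <= x <= 1 -> (cell x == i) = (x \in cell_itv i).
Proof.
move=> /andP[x0 x1]; have y0 : 0 <= x * N.+1%:R by rewrite mulr_ge0.
have y1 : x * N.+1%:R <= N.+1%:R by rewrite ler_piMl.
rewrite -(inj_eq val_inj) /= inordK ?ltnS ?geq_minr// itv_boundlr /= .
rewrite !bnd_simp ler_pdivrMr// -truncn_ge_nat//.
have [iN|Ni] := ltnP i N.
  rewrite bnd_simp ltr_pdivlMr// -truncn_lt_nat// ltnS -eqn_leq.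
  by move: (Num.truncn _) => m; apply/eqP/eqP; lia.
rewrite bnd_simp ler_pdivlMr//.
have -> : (i : nat) = N by apply/eqP; rewrite eqn_leq Ni -ltnS ltn_ord.
by rewrite y1 andbT; move: (Num.truncn _) => m; apply/eqP/idP; lia.
Qed.

Lemma cell_dist x : 0 <= x <= 1 -> `|x - cell_point (cell x)| <= N.+1%:R^-1.
Proof.
move=> x01; have := cellE (cell x) x01; rewrite eqxx itv_boundlr => /esym/andP[].
rewrite bnd_simp => h1 h2.
have h3 : x <= (cell x).+1%:R / N.+1%:R.
  by move: h2; case: (_ < N)%N; rewrite bnd_simp// => /ltW.
rewrite /cell_point distrC ger0_norm ?subr_ge0// lerBlDr.
by rewrite -natr1 mulrDl mul1r addrC lerD2l.
Qed.

Lemma uniform_prob_cell i : uniform_prob (@ltr01 R) [set` cell_itv i] = (N.+1%:R^-1)%:E.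
Proof.
have sub : [set` cell_itv i] `<=` `[0, 1].
  move=> x /=; rewrite itv_boundlr in_itv/= => /andP[h1 h2]; apply/andP; split.
    by move: h1; rewrite bnd_simp; apply: le_trans; rewrite divr_ge0.
  have /andP[_] := cell_point01 i; apply: le_trans.
  by move: h2; case: (_ < N)%N; rewrite bnd_simp// => /ltW.
rewrite /uniform_prob (eq_integral (cst 1%E)); last first.
  move=> x /set_mem/sub /=; rewrite in_itv/= /uniform_pdf => ->.
  by rewrite subr0 invr1.
rewrite integral_cst//= mul1e lebesgue_measure_itv/= lte_fin ltr_pM2r ?invr_gt0//.
rewrite ltr_nat ltnSn -EFinB; congr EFin.
by rewrite -mulrBl -natr1 addrC addKr mul1r.
Qed.

End cells.

Section zpath_measurable.
Variables (R : realType) (T : R) (d : measure_display) (W : measurableType d).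
Variables (Q : probability W R) (X A : {RV Q >-> R}).
Hypotheses (X01 : forall w, 0 <= X w <= 1) (A01 : forall w, 0 <= A w <= 1).

Lemma cell_preimage N (Y : {RV Q >-> R}) (i : 'I_N.+1) : (forall w, 0 <= Y w <= 1) ->
  (fun w => cell N (Y w)) @^-1` [set i] = Y @^-1` [set` cell_itv R i].
Proof.
move=> Y01; apply/seteqP; split => w /=; first by move/eqP; rewrite cellE.
by rewrite -cellE// => /eqP.
Qed.

Definition cell_pair N (w : W) : 'I_N.+1 * 'I_N.+1 := (cell N (X w), cell N (A w)).

Lemma cell_pair_preimage N ij : cell_pair N @^-1` [set ij] =
  X @^-1` [set` cell_itv R ij.1] `&` A @^-1` [set` cell_itv R ij.2].
Proof.
rewrite -!cell_preimage//; case: ij => i j.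
by apply/seteqP; split => w /=; rewrite /cell_pair => -[-> ->].
Qed.

Lemma cell_pair_measurable N ij : measurable (cell_pair N @^-1` [set ij]).
Proof.
rewrite cell_pair_preimage; apply: measurableI; rewrite -[_ @^-1` _]setTI;
  by apply: measurable_funP => //; exact: measurable_itv.
Qed.

Lemma zpath_ball (x x' a a' e : R) (a01 : 0 <= a <= 1) (a01' : 0 <= a' <= 1) :
  0 <= T -> 0 <= x <= 1 -> 0 <= x' <= 1 ->
  expR T ^+ 6 * (T * `|x - x'| + `|a - a'|) < e -> 0 < e ->
  ball (zpath_of T x a01) e (zpath_of T x' a01').
Proof.
move=> T0 x01 x01' he e0; exists id; split.
  by split; [split => // t ?; exists t | move=> ? ? _ _].
move=> t tab; rewrite subrr normr0; split => //; rewrite !skorokhod_ofE//.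
apply: le_lt_trans he; apply: zpath_lipschitz => //.
by move: tab; rewrite in_itv/= ler_norml.
Qed.

Lemma zpath_of_measurable : 0 <= T ->
  borel_measurable (fun w => zpath_of T (X w) (A01 w)).
Proof.
move=> T0.
pose Zk k (ij : 'I_k.+1 * 'I_k.+1) : skorokhod (- T) T :=
  zpath_of T (cell_point R ij.1) (cell_point01 R ij.2).
apply: (@pointwise_limit_borel_measurable R _ _ _ _ (fun k w => Zk k (cell_pair k w))).
  move=> k B.
  exact: (measurable_finite_preimage (cell_pair_measurable (N := k)) [set ij | B (Zk k ij)]).
move=> w e e0; pose c := expR T ^+ 6 * (T + 1).
have c0 : 0 < c by rewrite mulr_gt0 ?exprn_gt0 ?expR_gt0//; lra.
exists (Num.truncn (c / e)) => k kk; apply: zpath_ball => //; first exact: cell_point01.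
have ck : c / e < k.+1%:R by apply: (lt_le_trans (truncnS_gt _)); rewrite ler_nat ltnS.
have h1 := cell_dist k (X01 w); have h2 := cell_dist k (A01 w).
apply: (@le_lt_trans _ _ (c / k.+1%:R)); last by rewrite ltr_pdivrMr// mulrC -ltr_pdivrMr.
rewrite /c -mulrA ler_wpM2l ?exprn_ge0 ?expR_ge0// mulrDl mul1r lerD//.
by rewrite ler_wpM2l.
Qed.

End zpath_measurable.

(** * Uniform closeness and convergence *)

Section uniform_closeness.
Variables (R : realType) (n : nat) (T : R) (d : measure_display) (W : measurableType d).
Variables (P : probability W R) (sigma : R -> W -> 'S_n.+1).
Hypothesis T0 : 0 < T.
Hypothesis hs : birth_mallows_process P sigma.
Local Notation pr := (prob P).
Local Notation B := (expR (2 * T)).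
Local Notation N := (n.+1%:R : R).
Local Notation time s := (expR (s / N)).
Local Notation hist := (history sigma [set t | 0 <= t]).

Definition quantile_dev (eta t : R) (i : 'I_n.+1) : set W :=
  [set w | eta <= `|tgeom_cdf i.+1 t (left_inv (sigma t w) i).+1 -
                    tgeom_cdf i.+1 1 (left_inv (sigma 1 w) i).+1|].

Definition rank_dev (eta t t' : R) (i : 'I_n.+1) : set W :=
  [set w | eta <= `|rank_ratio t n (mallows_chain (sigma t w) (sigma t' w) i) -
                    rank_ratio t i (left_inv (sigma t' w) i)|].

Lemma quantile_dev_history eta t i : 0 <= t -> hist (quantile_dev eta t i).
Proof.
move=> t0; rewrite /quantile_dev; exact: (@history_pair R n d W sigma t 1 (fun s s' =>
  eta <= `|tgeom_cdf i.+1 t (left_inv s i).+1 - tgeom_cdf i.+1 1 (left_inv s' i).+1|) t0 ler01).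
Qed.

Lemma rank_dev_history eta t t' i : 0 <= t -> 0 <= t' -> hist (rank_dev eta t t' i).
Proof.
move=> t0 t0'; rewrite /rank_dev; exact: (@history_pair R n d W sigma t t' (fun s s' =>
  eta <= `|rank_ratio t n (mallows_chain s s' i) - rank_ratio t i (left_inv s' i)|) t0 t0').
Qed.

Variable r : nat.
Local Notation gtime c := (time (grid_point (- T) T r c)).

(** The two orders of the end points of a cell serve the upper and the lower side of the sandwich;
    the event at times [1, 1] ties [l_i] to the start [sigma_1(i)]. *)
Definition deviation (eta : R) (i : 'I_n.+1) : set W :=
  rank_dev eta 1 1 i `|` \big[setU/set0]_(c < r.+1)
    (rank_dev eta (gtime c) (gtime c.+1) i `|` rank_dev eta (gtime c.+1) (gtime c) i `|`
     (quantile_dev eta (gtime c) i `|` quantile_dev eta (gtime c.+1) i)).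

Lemma history_setU (A A' : set W) : hist A -> hist A' -> hist (A `|` A').
Proof.
pose G := [set A : set W | exists t y, 0 <= t /\ A = sigma t @^-1` [set y]].
exact: (@measurableU _ (g_sigma_algebraType G)).
Qed.

Lemma deviation_history eta i : hist (deviation eta i).
Proof.
apply: history_setU; first by apply: rank_dev_history.
elim/big_ind: _ => [| |c _]; first exact: sigma_algebra0.
  exact: history_setU.
apply: history_setU; apply: history_setU; rewrite ?expR_ge0//.
- by apply: rank_dev_history; exact: expR_ge0.
- by apply: rank_dev_history; exact: expR_ge0.
- by apply: quantile_dev_history; exact: expR_ge0.
- by apply: quantile_dev_history; exact: expR_ge0.
Qed.

(** One rank event at time 1 and, in each of the [r.+1] cells, two rank events and two quantile
    events, with Chebyshev's [eta ^+ 2]. *)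
Definition deviation_const (eta : R) : R :=
  (B ^+ 4 + (B ^+ 4 + B ^+ 4 + (B ^+ 2 + 2 * T ^+ 2 * B ^+ 4 + (B ^+ 2 + 2 * T ^+ 2 * B ^+ 4))) * r.+1%:R) / eta ^+ 2.

Let ab : - T < T. Proof. by rewrite gtrN. Qed.

Lemma grid_point_norm c : (c <= r.+1)%N -> `|grid_point (- T) T r c| <= T.
Proof.
move=> cr; have m0 := mesh_gt0 r ab.
rewrite ler_norml /grid_point lerDl mulr_ge0 ?(ltW m0)//=.
rewrite -lerBrDl (_ : T - - T = r.+1%:R * mesh (- T) T r).
  by rewrite ler_wpM2r ?(ltW m0)// ler_nat.
by rewrite /mesh mulrC divfK// pnatr_eq0.
Qed.

Lemma prob_deviation eta i : 0 < eta ->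
  pr (deviation eta i) <= deviation_const eta / i.+1%:R.
Proof.
move=> eta0; have T0' := ltW T0; have w1 := window1 n T0'.
have wg c : (c <= r.+1)%N -> window n T (gtime c).
  by move=> cr; apply: window_exp; exact: grid_point_norm.
have mH A : hist A -> measurable A by exact: (mallows_history_measurable hs).
have mr t t' : 0 <= t -> 0 <= t' -> measurable (rank_dev eta t t' i).
  by move=> ? ?; apply: mH; exact: rank_dev_history.
have mq t : 0 <= t -> measurable (quantile_dev eta t i).
  by move=> ?; apply: mH; exact: quantile_dev_history.
set Cr := B ^+ 4.
have [Cq CqE] : exists Cq, Cq = B ^+ 2 + 2 * T ^+ 2 * B ^+ 4 by eexists.
have pU A A' (x y : R) : measurable A -> measurable A' -> pr A <= x -> pr A' <= y ->
    pr (A `|` A') <= x + y.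
  by move=> mA mA' hA hA'; apply: le_trans (prU P mA mA') _; exact: lerD.
pose S c := rank_dev eta (gtime c) (gtime c.+1) i `|` rank_dev eta (gtime c.+1) (gtime c) i `|`
     (quantile_dev eta (gtime c) i `|` quantile_dev eta (gtime c.+1) i).
have mS c : measurable (S c).
  apply: measurableU; apply: measurableU; try (apply: (mr); exact: expR_ge0);
    by apply: (mq); exact: expR_ge0.
have pS c : (c < r.+1)%N -> pr (S c) <= (Cr + Cr + (Cq + Cq)) / i.+1%:R / eta ^+ 2.
  move=> cr; have cr' := ltnW cr.
  rewrite !(mulrDl _ _ i.+1%:R^-1) !(mulrDl _ _ (eta ^+ 2)^-1).
  apply: (pU); [apply: measurableU; apply: (mr); exact: expR_ge0 |
              apply: measurableU; apply: (mq); exact: expR_ge0 | |].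
    apply: (pU); [apply: (mr); exact: expR_ge0 | apply: (mr); exact: expR_ge0 | |];
      by apply: (mallows_rank T0' hs) => //; exact: wg.
  apply: (pU); [apply: (mq); exact: expR_ge0 | apply: (mq); exact: expR_ge0 | |];
    by rewrite CqE; apply: (mallows_quantile T0' hs) => //; exact: wg.
have -> : deviation_const eta / i.+1%:R = Cr / i.+1%:R / eta ^+ 2 +
    \sum_(c < r.+1) (Cr + Cr + (Cq + Cq)) / i.+1%:R / eta ^+ 2.
  rewrite sumr_const card_ord -[_ *+ r.+1]mulr_natr /deviation_const -/Cr -CqE.
  by move: (r.+1%:R : R) (i.+1%:R^-1 : R) => x y; ring.
apply: (pU) => //.
- exact: mr.
- by apply: bigsetU_measurable => c _; exact: mS.
- exact: (mallows_rank T0' hs).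
- by apply: (le_trans (pr_bigU P _ (fun c : 'I_r.+1 => mS c))); apply: ler_sum => c _; exact: pS.
Qed.

Lemma grid_cell s : `|s| <= T -> exists2 c, (c < r.+1)%N &
  grid_point (- T) T r c <= s <= grid_point (- T) T r c.+1.
Proof.
move=> sT; have m0 := mesh_gt0 r ab; move: (sT); rewrite ler_norml => /andP[s1 s2].
have top : grid_point (- T) T r r.+1 = T.
  by rewrite /grid_point /mesh mulrC divfK ?pnatr_eq0// addrC subrK.
have [->|sneT] := eqVneq s T.
  exists r => //; rewrite top lexx andbT -[leRHS]top /grid_point lerD2l.
  by rewrite ler_wpM2r ?(ltW m0)// ler_nat.
have U0 : 0 <= (s - - T) / mesh (- T) T r by rewrite divr_ge0 ?(ltW m0)// subr_ge0.
have /andP[i1 i2] := truncn_itv U0.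
exists (grid_index (- T) T r s).
  rewrite -(ltr_nat R); apply: (le_lt_trans i1).
  rewrite ltr_pdivrMr// /mesh mulrC divfK ?pnatr_eq0// ltrD2r lt_neqAle sneT//.
rewrite grid_point_le//= /grid_point -lerBlDl -ler_pdivrMr//.
exact: ltW.
Qed.

Definition monotone_at (w : W) : Prop := forall c (i : 'I_n.+1) t, (c < r.+1)%N ->
  gtime c <= t <= gtime c.+1 ->
  (left_inv (sigma (gtime c) w) i <= left_inv (sigma t w) i <= left_inv (sigma (gtime c.+1) w) i)%N.

Lemma monotone_ae : exists Z : set W,
  [/\ measurable Z, pr Z = 0 & forall w, ~ Z w -> monotone_at w].
Proof.
have [l [bl _ ls]] := hs; have m0 := mesh_gt0 r ab.
have H (ci : 'I_r.+1 * 'I_n.+1) : exists Z : set W, [/\ measurable Z, pr Z = 0 &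
    forall w, ~ Z w -> forall t, gtime ci.1 <= t <= gtime ci.1.+1 ->
      (l ci.2 (gtime ci.1) w <= l ci.2 t w <= l ci.2 (gtime ci.1.+1) w)%N].
  apply: (birth_monotone (bl ci.2)); first exact: expR_ge0.
  rewrite ler_expR ler_pM2r ?invr_gt0// /grid_point lerD2l.
  by rewrite ler_wpM2r ?(ltW m0)// ler_nat.
have [Z hZ] := choice H.
exists (\big[setU/set0]_ci Z ci); split.
- by apply: bigsetU_measurable => ci _; have [] := hZ ci.
- apply/eqP; rewrite eq_le pr_ge0 andbT.
  apply: (le_trans (pr_bigU P _ _)) => [ci|]; first by have [] := hZ ci.
  by rewrite big1// => ci _; have [] := hZ ci.
move=> w nZ c i t cr tc; have [_ _ /(_ w)] := hZ (Ordinal cr, i).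
have nZ' : ~ Z (Ordinal cr, i) w.
  by move=> h; apply: nZ; rewrite -bigcup_seq/=; exists (Ordinal cr, i) => //=; rewrite mem_index_enum.
move=> /(_ nZ' t tc) /=.
have t0 : 0 <= t by case/andP: tc => h _; apply: le_trans h; exact: expR_ge0.
by rewrite !ls// expR_ge0.
Qed.

(** The later end of the cell for [l_i] and the earlier end for the following positions bound the
    chain from above, the opposite choice from below. [chain_near_zpath] concerns [M.+1], whereas
    the particle is [1 - m / N]; this shift by [1 / N] is the extra [eta]. *)
Lemma particle_near_zpath (eta : R) (i : 'I_n.+1) (w : W) (s : R) :
  0 < eta <= 1 -> i.+1%:R^-1 <= eta -> mesh (- T) T r <= eta ->
  monotone_at w -> ~ deviation eta i w -> `|s| <= T ->
  `|particle sigma w i s - zpath (i.+1%:R / N) ((sigma 1 w i).+1%:R / N) s| <=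
  (chain_const T + 1) * eta.
Proof.
move=> eta01 ieta meta mono ndev sT; have m0 := mesh_gt0 r ab.
have N0 : 0 < N by [].
have [c cr /andP[c1 c2]] := grid_cell sT.
have [nd1 nd2] : ~ rank_dev eta 1 1 i w /\ forall c, (c < r.+1)%N ->
    [/\ ~ rank_dev eta (gtime c) (gtime c.+1) i w, ~ rank_dev eta (gtime c.+1) (gtime c) i w,
        ~ quantile_dev eta (gtime c) i w & ~ quantile_dev eta (gtime c.+1) i w].
  split; first by move=> h; apply: ndev; left.
  move=> c' cr'; split=> h; apply: ndev; right; rewrite -bigcup_seq; exists (Ordinal cr');
    rewrite /= ?mem_index_enum//.
  - by left; left.
  - by left; right.
  - by right; left.
  - by right; right.
have [/negP e1 /negP e2 /negP e3 /negP e4] := nd2 c cr; move/negP: nd1 => e0.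
rewrite -ltNge in e0; rewrite -ltNge in e1; rewrite -ltNge in e2.
rewrite -ltNge in e3; rewrite -ltNge in e4.
have in_ : (i <= n)%N by rewrite -ltnS.
have gd : grid_point (- T) T r c.+1 = grid_point (- T) T r c + mesh (- T) T r.
  by rewrite /grid_point -natr1 mulrDl mul1r addrA.
have sa : `|s - grid_point (- T) T r c| <= eta.
  rewrite ger0_norm ?subr_ge0// lerBlDl; apply: (le_trans c2).
  by rewrite gd lerD2l.
have sb : `|s - grid_point (- T) T r c.+1| <= eta.
  rewrite distrC ger0_norm ?subr_ge0// lerBlDl addrC; rewrite gd.
  by rewrite addrC lerD.
have ga := grid_point_norm (ltnW cr); have gb := grid_point_norm cr.
have ms u v : (mallows_chain (sigma u w) (sigma v w) i <= n)%N.
  apply: (leq_trans (rank_chain_le _ _ _ _)).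
  by rewrite -[leqRHS](subnKC in_) leq_add2r left_inv_le.
have rank1 u : (sigma u w i + mallows_chain (sigma u w) (sigma u w) i = n)%N.
  exact: left_inv_rank.
have pE u : (sigma u w i).+1%:R / N = 1 - (mallows_chain (sigma u w) (sigma u w) i)%:R / N.
  have := rank1 u; move: (mallows_chain _ _ _) => m nE.
  have -> : N = (sigma u w i).+1%:R + m%:R by rewrite -natrD addSn nE.
  have : 0 < (sigma u w i).+1%:R :> R by [].
  have : 0 <= m%:R :> R by [].
  move: (m%:R : R) ((sigma u w i).+1%:R : R) => y x y0 x0.
  by field; rewrite gt_eqF// ltr_wpDr.
have tie : gtime c <= time s <= gtime c.+1.
  by rewrite !ler_expR !ler_pM2r ?invr_gt0// c1 c2.
have up : (mallows_chain (sigma (time s) w) (sigma (time s) w) i <=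
           mallows_chain (sigma (gtime c) w) (sigma (gtime c.+1) w) i)%N.
  apply: rank_chain_homo => [|k _]; first by have /andP[] := mono c i _ cr tie.
  by have /andP[] := mono c (inord k) _ cr tie.
have lo : (mallows_chain (sigma (gtime c.+1) w) (sigma (gtime c) w) i <=
           mallows_chain (sigma (time s) w) (sigma (time s) w) i)%N.
  apply: rank_chain_homo => [|k _]; first by have /andP[] := mono c i _ cr tie.
  by have /andP[] := mono c (inord k) _ cr tie.
have H1 := @chain_near_zpath R T (ltW T0) n i s _ _ eta _ _ _ _ sT ga gb sa sb eta01 ieta in_
  (left_inv_le _ _) (left_inv_le _ _) (ms 1 1) (ms _ _) (ltW e1) (ltW e4) (ltW e0).
have H2 := @chain_near_zpath R T (ltW T0) n i s _ _ eta _ _ _ _ sT gb ga sb sa eta01 ieta in_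
  (left_inv_le _ _) (left_inv_le _ _) (ms 1 1) (ms _ _) (ltW e2) (ltW e3) (ltW e0).
rewrite /particle mulrC !pE.
set z := zpath _ _ _ in H1 H2 *.
move: up lo H1 H2; move: (mallows_chain (sigma (gtime c) w) _ i)
  (mallows_chain (sigma (gtime c.+1) w) _ i) (mallows_chain (sigma (time s) w) _ i).
move=> U L m; rewrite -(ler_nat R m) -(ler_nat R L) => up lo.
have Neta : N^-1 <= eta.
  by apply: le_trans ieta; rewrite lef_pV2 ?posrE// ler_nat.
have Ni : 0 <= N^-1 by rewrite invr_ge0.
move: (ler_wpM2r Ni up) (ler_wpM2r Ni lo); rewrite -(natr1 U) -(natr1 L) !mulrDl !mul1r.
move: (U%:R * N^-1) (L%:R * N^-1) (m%:R * N^-1) N^-1 (chain_const T * eta) Neta Ni => u l' m' ni ce.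
move=> Neta Ni up' lo'; rewrite !ler_norml => /andP[a1 a2] /andP[b1 b2].
clear -Neta Ni up' lo' a1 a2 b1 b2.
apply/andP; split; lra.
Qed.

End uniform_closeness.

(** * Expectations of bounded functions *)

Section expectations.
Variables (R : realType) (d : measure_display) (W : measurableType d).
Variable P : probability W R.
Local Notation pr := (prob P).

Lemma bounded_integrable (F : W -> R) (M : R) : measurable_fun setT F ->
  (forall w, `|F w| <= M) -> P.-integrable setT (EFin \o F).
Proof.
move=> mF FM; apply: measurable_bounded_integrable => //.
  by rewrite -ge0_fin_numE // fin_num_measure.
exists M; split; first exact: num_real.
by move=> x Mx w _; apply: le_trans (FM w) (ltW Mx).
Qed.

Lemma expectationE (F : W -> R) (M : R) : measurable_fun setT F ->
  (forall w, `|F w| <= M) -> 'E_P[F]%E = (\int[P]_w F w)%:E.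
Proof.
move=> mF FM; rewrite unlock /Rintegral fineK//.
exact: integrable_fin_num (bounded_integrable mF FM).
Qed.

Lemma Rintegral_indic (A : set W) : measurable A -> \int[P]_w (\1_A w : R) = pr A.
Proof. by move=> mA; rewrite /Rintegral integral_indic// setIT. Qed.

Lemma Rintegral_close (F G : W -> R) (M delta : R) (A : set W) :
  measurable_fun setT F -> measurable_fun setT G ->
  (forall w, `|F w| <= M) -> (forall w, `|G w| <= M) -> measurable A ->
  0 <= delta -> (forall w, ~ A w -> `|F w - G w| <= delta) ->
  `|\int[P]_w F w - \int[P]_w G w| <= delta + 2 * M * pr A.
Proof.
move=> mF mG FM GM mA d0 FG.
have iF := bounded_integrable mF FM; have iG := bounded_integrable mG GM.
have FGM w : `|F w - G w| <= 2 * M.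
  by apply: (le_trans (ler_normB _ _)); have := FM w; have := GM w; lra.
have mFG : measurable_fun setT (fun w => F w - G w) by exact: measurable_funB.
have iFG := bounded_integrable mFG FGM.
have M0 : 0 <= M by apply: le_trans (FM point).
pose h w := delta + 2 * M * \1_A w : R.
have mh : measurable_fun setT h.
  apply: measurable_funD => //; apply: measurable_funM => //.
have hM w : `|h w| <= delta + 2 * M.
  rewrite /h indicE ger0_norm ?addr_ge0 ?mulr_ge0//.
  by rewrite lerD2l ler_piMr ?mulr_ge0// lern1 leq_b1.
rewrite -RintegralB//; apply: (le_trans (le_normr_Rintegral _ _)) => //.
apply: (@le_trans _ _ (\int[P]_w h w)).
  apply: le_Rintegral => //.
  - apply: (@bounded_integrable _ (2 * M)); first exact: measurableT_comp.
    by move=> w; rewrite normr_id.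
  - exact: (bounded_integrable mh hM).
  - move=> w _ /=; rewrite /h indicE; case: (boolP (w \in A)) => wA.
      by rewrite mulr1; have := FGM w; lra.
    by rewrite mulr0 addr0 FG// => Aw; rewrite mem_set in wA.
have ind1 : measurable_fun setT (\1_A : W -> R) by exact: measurable_indic.
have indM w : `|\1_A w : R| <= 1 by rewrite indicE ger0_norm// lern1 leq_b1.
rewrite /h RintegralD//.
- rewrite Rintegral_cst// RintegralZl//; last exact: (bounded_integrable ind1 indM).
  by rewrite Rintegral_indic// -/(pr setT) pr_setT mulr1.
- by apply: (@bounded_integrable _ delta) => // w; rewrite ger0_norm.
- apply: (@bounded_integrable _ (2 * M)).
    by apply: measurable_funM.
  by move=> w; rewrite normrM (ger0_norm (_ : 0 <= 2 * M)) ?mulr_ge0// ler_piMr ?mulr_ge0.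
Qed.

Section finite_valued.
Variables (T : finType) (h : W -> T) (g : T -> R).
Hypothesis mh : forall t, measurable (h @^-1` [set t]).

Lemma finite_comp_measurable : measurable_fun setT (g \o h).
Proof.
move=> _ B mB; rewrite setTI comp_preimage.
exact: (measurable_finite_preimage mh (g @^-1` B)).
Qed.

Lemma Rintegral_finite : \int[P]_w g (h w) = \sum_t g t * pr (h @^-1` [set t]).
Proof.
have E w : g (h w) = \sum_t g t * \1_(h @^-1` [set t]) w.
  rewrite (bigD1 (h w))//= indicE mem_set// mulr1 big1 ?addr0// => t th.
  by rewrite indicE memNset ?mulr0// => /esym/eqP; rewrite (negbTE th).
have mI t : measurable_fun setT (\1_(h @^-1` [set t]) : W -> R) by exact: measurable_indic.
rewrite /Rintegral.
under eq_integral => w _ do rewrite E -sumEFin.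
rewrite integral_sum//; last first.
  move=> t; apply: (@bounded_integrable _ `|g t|); first exact: measurable_funM.
  by move=> w; rewrite normrM ler_piMr// indicE ger0_norm// lern1 leq_b1.
transitivity (fine (\sum_t (g t * pr (h @^-1` [set t]))%:E)%E); last by rewrite sumEFin.
congr fine; apply: eq_bigr => t _.
under eq_integral => w _ do rewrite EFinM.
rewrite integralZl//; last exact: integrable_indic.
by rewrite integral_indic// setIT EFinM; congr (_ * _)%E; exact: prE.
Qed.

End finite_valued.

Lemma continuous_borel_measurable (S : topologicalType) (Y : W -> S) (f : S -> R) :
  borel_measurable Y -> continuous f -> measurable_fun setT (f \o Y).
Proof.
move=> mY cf mD; apply: (measurability _ (RGenOInfty.measurableE R)) => //.
move=> _ [_ [x ->] <-]; rewrite setTI comp_preimage; apply: mY.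
apply: sub_sigma_algebra => /=; apply: open_comp; first by move=> ? _; exact: cf.
exact: interval_open.
Qed.

End expectations.

Section uniform_near_limit.
Variables (R : realType) (T : R) (f : skorokhod (- T) T -> R).
Hypotheses (T0 : 0 <= T) (cf : continuous f).

(** The modulus of continuity of [f] depends on the path; compactness of the parameter square and
    the Lipschitz bound in [(x, a)] make it uniform over limit paths, while [y] remains
    arbitrary. *)
Lemma limit_paths_uniform (delta : R) : 0 < delta -> exists2 e : R, 0 < e &
  forall x a (a01 : 0 <= a <= 1) y, 0 <= x <= 1 ->
    ball (zpath_of T x a01) e y -> `|f (zpath_of T x a01) - f y| < delta.
Proof.
move=> delta0.
have cK : compact ([set` `[0, 1]] `*` [set` `[0, 1]] : set (R * R)).
  by apply: compact_setX; exact: segment_compact.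
pose Pr (e : R) (p : R * R) := forall (a01 : 0 <= p.2 <= 1) y, 0 <= p.1 <= 1 ->
    ball (zpath_of T p.1 a01) e y -> `|f (zpath_of T p.1 a01) - f y| < delta.
have := (compact_near_coveringP _).1 cK R (0 : R)^'+ Pr _ _.
have local : forall p : R * R, ([set` `[0, 1]] `*` [set` `[0, 1]]) p ->
    \forall p' \near p & e \near (0 : R)^'+, Pr e p'.
  move=> [x a] /= [/= x01 a01]; rewrite !in_itv/= in x01 a01.
  have /cvgrPdist_lt/(_ (delta / 2)) := cf (x := zpath_of T x a01).
  rewrite divr_gt0// => /(_ isT)/nbhs_ballP[e0 /= e00 he].
  pose c := expR T ^+ 6 * (T + 1).
  have c0 : 0 < c by rewrite mulr_gt0 ?exprn_gt0 ?expR_gt0// ltr_wpDl.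
  (* Half of [e0] is spent on moving [(x, a)], the other half on the distance from the moved path to
     [y]. *)
  pose r := e0 / 2 / c.
  have r0 : 0 < r by rewrite !divr_gt0.
  exists ([set p' : R * R | `|x - p'.1| < r /\ `|a - p'.2| < r], [set e | e < e0 / 2]).
    split; last by apply: nbhs_right_lt; rewrite divr_gt0.
    exists ([set y | `|x - y| < r], [set y | `|a - y| < r]) => /=.
      by split; apply/nbhs_ballP; exists r.
    by move=> [y z].
  move=> [[x' a'] e] /= [[xx' aa'] ee] a01' y x01' hb /=.
  have b1 : ball (zpath_of T x a01) (e0 / 2) (zpath_of T x' a01').
    apply: zpath_ball => //; last by rewrite divr_gt0.
    apply: (@lt_le_trans _ _ (c * r)); last by rewrite /r mulrC divfK// gt_eqF.
    rewrite /c -mulrA ltr_pM2l ?exprn_gt0 ?expR_gt0// mulrDl mul1r.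
    by rewrite ler_ltD// ler_wpM2l// ltW.
  have b2 : ball (zpath_of T x a01) e0 y.
    have := ball_triangle b1 hb; apply: le_ball; lra.
  have h1 := he _ b2.
  have h2 : `|f (zpath_of T x a01) - f (zpath_of T x' a01')| < delta / 2.
    by apply: he; apply: le_ball b1; lra.
  rewrite distrC in h2.
  by apply: (le_lt_trans (ler_distD (f (zpath_of T x a01)) _ _)); rewrite /= in h1 h2 *; lra.
move=> /(_ _ local)/nbhs_ballP[e /= e0 he].
exists (e / 2); first by rewrite divr_gt0.
move=> x a a01 y x01 hb.
have := he (e / 2); rewrite /ball/= sub0r normrN ger0_norm ?divr_ge0 ?(ltW e0)// => /(_ _ _ (x, a)).
by apply => //=; rewrite ?in_itv//=; lra.
Qed.

End uniform_near_limit.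

Section bad_event.
Variables (R : realType) (n : nat) (T : R) (d : measure_display) (W : measurableType d).
Variables (P : probability W R) (sigma : R -> W -> 'S_n.+1) (I : W -> 'I_n.+1).
Hypotheses (T0 : 0 < T) (hs : birth_mallows_process P sigma).
Hypotheses (hI : uniform_index P I) (hIs : index_independent P I sigma).
Local Notation pr := (prob P).
Local Notation N := (n.+1%:R : R).

Lemma index_event (i : 'I_n.+1) A : history sigma [set t | 0 <= t] A ->
  pr (I @^-1` [set i] `&` A) = N^-1 * pr A.
Proof.
move=> hA; have mA := mallows_history_measurable hs hA; have [mi pi] := hI i.
apply: EFin_inj; rewrite -prE; last exact: measurableI.
by rewrite hIs// pi prE// EFinM.
Qed.

(** Independence of the index weights each [D i] by [1 / N], so bounds of the form [const / i] add
    up to an arithmetic mean of the harmonic sequence. *)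
Lemma bad_event (r : nat) (eta : R) : 0 < eta <= 1 -> mesh (- T) T r <= eta ->
  exists A : set W, [/\ measurable A,
    pr A <= (deviation_const T r eta + eta^-1) * arithmetic_mean harmonic n &
    forall w, ~ A w -> forall s, `|s| <= T ->
      `|particle sigma w (I w) s -
        zpath ((I w).+1%:R / N) ((sigma 1 w (I w)).+1%:R / N) s| <=
      (chain_const T + 1) * eta].
Proof.
move=> eta01 meta; have [eta0 eta1] := andP eta01.
have [Z [mZ Z0 hZ]] := monotone_ae T0 hs r.
(* For [1 / i.+1 > eta] there is no estimate: the whole space is declared bad, and its probability 1
   is at most [eta^-1 / i.+1]. *)
pose D (i : 'I_n.+1) : set W := if i.+1%:R^-1 <= eta then deviation T sigma r eta i else setT.
have hD i : history sigma [set t | 0 <= t] (D i).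
  rewrite /D; case: ifP => _; first exact: deviation_history.
  by rewrite -setC0; apply: sigma_algebraC; exact: sigma_algebra0.
have mD i := mallows_history_measurable hs (hD i).
have mID (i : 'I_n.+1) : measurable (I @^-1` [set i] `&` D i).
  by apply: measurableI => //; have [] := hI i.
have c0 : 0 <= deviation_const T r eta.
  by rewrite /deviation_const divr_ge0 ?exprn_ge0 ?(ltW eta0)//
    !(addr_ge0, mulr_ge0) ?exprn_ge0 ?expR_ge0 ?(ltW T0).
have pD i : pr (D i) <= (deviation_const T r eta + eta^-1) / i.+1%:R.
  rewrite mulrDl /D; case: ifP => [ieta|/negbT]; last first.
    rewrite -ltNge => ieta; rewrite pr_setT.
    apply: (@le_trans _ _ (eta^-1 / i.+1%:R)); last by rewrite lerDr divr_ge0.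
    by rewrite ler_pdivlMl// mulr1 ltW.
  apply: (le_trans (prob_deviation T0 hs r i eta0)).
  by rewrite lerDl divr_ge0// invr_ge0 ltW.
exists (Z `|` \big[setU/set0]_(i < n.+1) (I @^-1` [set i] `&` D i)); split.
- by apply: measurableU => //; apply: bigsetU_measurable.
- apply: (le_trans (prU P _ _)) => //; first by apply: bigsetU_measurable.
  rewrite Z0 add0r; apply: (le_trans (pr_bigU P _ mID)).
  rewrite /arithmetic_mean /series /= mulrCA big_mkord mulr_sumr mulr_sumr.
  apply: ler_sum => i _; rewrite index_event// ler_wpM2l ?invr_ge0//; exact: pD.
move=> w nA s sT.
have nD : ~ D (I w) w.
  by move=> h; apply: nA; right; rewrite -bigcup_seq; exists (I w); rewrite /= ?mem_index_enum.
move: nD; rewrite /D; case: ifP => [ieta nD|_ /(_ Logic.I)//].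
apply: (particle_near_zpath T0 eta01 ieta meta) => //.
by apply: hZ => h; apply: nA; left.
Qed.

Lemma index_start_law (i j : 'I_n.+1) :
  measurable ((fun w => (I w, sigma 1 w (I w))) @^-1` [set (i, j)]) /\
  pr ((fun w => (I w, sigma 1 w (I w))) @^-1` [set (i, j)]) = N^-1 * N^-1.
Proof.
have -> : (fun w => (I w, sigma 1 w (I w))) @^-1` [set (i, j)] =
    I @^-1` [set i] `&` [set w | sigma 1 w i = j].
  by apply/seteqP; split => w /= [-> ->].
have hA : history sigma [set t | 0 <= t] [set w | sigma 1 w i = j].
  exact: (@history_pair R n d W sigma 1 1 (fun s _ => s i = j) ler01 ler01).
have mA := mallows_history_measurable hs hA.
split; first by apply: measurableI => //; have [] := hI i.
by rewrite index_event// (mallows_uniform hs).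
Qed.

End bad_event.

Lemma cell_pair_law (R : realType) (d : measure_display) (W : measurableType d)
    (Q : probability W R) (X A : {RV Q >-> R}) :
  (forall w, 0 <= X w <= 1) -> (forall w, 0 <= A w <= 1) ->
  uniform01 X -> uniform01 A -> independent_RV Q X A ->
  forall n ij, prob Q (cell_pair X A n @^-1` [set ij]) = n.+1%:R^-1 * n.+1%:R^-1.
Proof.
move=> X01 A01 hX hA hXA n ij; rewrite cell_pair_preimage//.
have mi (i : 'I_n.+1) : measurable [set` cell_itv R i] by exact: measurable_itv.
have := hX _ (mi ij.1); rewrite uniform_prob_cell => h1.
have := hA _ (mi ij.2); rewrite uniform_prob_cell => h2.
rewrite /prob hXA//.
by move: h1 h2; rewrite /distribution/= /pushforward => -> ->.
Qed.

(* The size of the permutations is n.+1, so that the index set is never empty. *)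
Theorem corollary1p2 (R : realType) (T : R) (hT : 0 < T)
    (d : nat -> measure_display) (W : forall n : nat, measurableType (d n))
    (P : forall n : nat, probability (W n) R)
    (sigma : forall n : nat, R -> W n -> 'S_n.+1)
    (hsigma : forall n : nat, birth_mallows_process (P n) (sigma n))
    (I : forall n : nat, W n -> 'I_n.+1)
    (hI : forall n : nat, uniform_index (P n) (I n))
    (hIsigma : forall n : nat, index_independent (P n) (I n) (sigma n))
    (d' : measure_display) (W' : measurableType d') (Q : probability W' R)
    (X A : {RV Q >-> R})
    (hX01 : forall w, 0 <= X w <= 1) (hA01 : forall w, 0 <= A w <= 1)
    (hX : uniform01 X) (hA : uniform01 A) (hXA : independent_RV Q X A) :
  cvg_in_distribution P (fun n => particle_path (hsigma n) T (I n))
    Q (fun w => zpath_of T (X w) (hA01 w)).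
Proof.
have T0 := ltW hT.
have mY n : borel_measurable (particle_path (hsigma n) T (I n)).
  by apply: particle_path_measurable => // i; have [] := hI n i.
have mZ : borel_measurable (fun w => zpath_of T (X w) (hA01 w)) by exact: zpath_of_measurable.
split=> // f cf [M fM].
have mfY n := continuous_borel_measurable (mY n) cf.
have mfZ := continuous_borel_measurable mZ cf.
pose u n := \int[P n]_w f (particle_path (hsigma n) T (I n) w).
pose v := \int[Q]_w f (zpath_of T (X w) (hA01 w)).
have uE n : 'E_(P n)[f \o particle_path (hsigma n) T (I n)]%E = (u n)%:E.
  by rewrite (@expectationE _ _ _ _ _ M)// => w; exact: fM.
have vE : 'E_Q[f \o (fun w => zpath_of T (X w) (hA01 w))]%E = v%:E.
  by rewrite (@expectationE _ _ _ _ _ M)// => w; exact: fM.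
rewrite vE.
rewrite (_ : (fun n => _) = EFin \o u); last by apply/funext.
suff uv : u n @[n --> \oo] --> v by apply: cvg_EFin => //; exact: nearW.
apply/cvgrPdist_le => eps eps0.
(* Three errors are each at most [delta]: the test function on the good event, the bad event, and
   the rounding of [(X, A)]. *)
pose delta := eps / 4; have delta0 : 0 < delta by rewrite divr_gt0.
have [e e0 he] := limit_paths_uniform T0 cf delta0.
have C0 : 0 < chain_const T + 1.
  by rewrite ltr_wpDl// /chain_const /chain_const1 !(addr_ge0, mulr_ge0, exprn_ge0, expR_ge0).
pose eta := Num.min 1 (e / 2 / (chain_const T + 1)).
have eta0 : 0 < eta by rewrite lt_min ltr01 !divr_gt0.
have eta01 : 0 < eta <= 1 by rewrite eta0 ge_min lexx.
have eta_e : (chain_const T + 1) * eta < e.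
  apply: (@le_lt_trans _ _ (e / 2)); last by rewrite gtr_pMr// invf_lt1// ltr1n.
  by rewrite mulrC -ler_pdivlMr// ge_min lexx orbT.
pose r := Num.truncn ((T - - T) / eta).
have meta : mesh (- T) T r <= eta.
  by rewrite /mesh ler_pdivrMr// mulrC -ler_pdivrMr// ltW// truncnS_gt.
pose D := 2 * M * (deviation_const T r eta + eta^-1).
have am0 : D * arithmetic_mean (@harmonic R) n @[n --> \oo] --> (0 : R).
  by rewrite -[0](mulr0 D); apply: cvgM; [exact: cvg_cst | exact: cesaro cvg_harmonic].
pose c := expR T ^+ 6 * (T + 1).
have c0 : 0 < c by rewrite mulr_gt0 ?exprn_gt0 ?expR_gt0// ltr_wpDl.
have hc0 : c * harmonic n @[n --> \oo] --> (0 : R).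
  by rewrite -[0](mulr0 c); apply: cvgM; [exact: cvg_cst | exact: cvg_harmonic].
near=> n.
have amn : D * arithmetic_mean (@harmonic R) n <= delta.
  have : `|0 - D * arithmetic_mean (@harmonic R) n| <= delta.
    by near: n; move/cvgrPdist_le : am0; exact.
  by rewrite sub0r normrN; apply: le_trans; exact: ler_norm.
have cn : c * harmonic n < e.
  have : `|0 - c * harmonic n| < e by near: n; move/cvgrPdist_lt : hc0; exact.
  by rewrite sub0r normrN; apply: le_lt_trans; exact: ler_norm.
pose g (ij : 'I_n.+1 * 'I_n.+1) : R :=
  f (zpath_of T (cell_point R ij.1) (cell_point01 R ij.2)).
have [A' [mA' pA' hA']] := bad_event hT (hsigma n) (hI n) (@hIsigma n) eta01 meta.
pose start w := (I n w, sigma n 1 w (I n w)).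
have mstart ij : measurable (start @^-1` [set ij]).
  by case: ij => i j; have [] := index_start_law (hsigma n) (hI n) (@hIsigma n) i j.
have gM ij : `|g ij| <= M by exact: fM.
have M0 : 0 <= M by apply: le_trans (gM (ord0, ord0)).
(* The pair of the index and its initial value, and the pair of cells of [(X, A)], are both uniform
   on the grid, so the finite sums agree term by term. *)
have sameG : \int[P n]_w g (start w) = \int[Q]_w g (cell_pair X A n w).
  rewrite (@Rintegral_finite _ _ _ (P n) _ start g mstart) (@Rintegral_finite _ _ _ Q _ (cell_pair X A n) g); last first.
    by move=> ij; exact: cell_pair_measurable.
  apply: eq_bigr => -[i j] _; rewrite cell_pair_law//.
  by have [_ ->] := index_start_law (hsigma n) (hI n) (@hIsigma n) i j.
have h1 : `|u n - \int[P n]_w g (start w)| <= delta + 2 * M * prob (P n) A'.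
  apply: (@Rintegral_close _ _ _ _ _ (g \o start)) => //.
  - exact: finite_comp_measurable.
  - by move=> w; exact: fM.
  - exact: ltW.
  - move=> w nA; rewrite distrC ltW//; apply: he; first exact: cell_point01.
    exists id; split.
      by split; [split => // t ?; exists t | move=> ? ? _ _].
    move=> t tab; rewrite subrr normr0 e0; split => //.
    rewrite !skorokhod_ofE// distrC; apply: le_lt_trans eta_e; apply: hA' => //.
    by move: tab; rewrite in_itv/= ler_norml.
have h2 : `|v - \int[Q]_w g (cell_pair X A n w)| <= delta + 2 * M * prob Q set0.
  apply: (@Rintegral_close _ _ _ _ _ (g \o cell_pair X A n)) => //.
  - by apply: finite_comp_measurable => ij; exact: cell_pair_measurable.
  - by move=> w; exact: fM.
  - exact: ltW.
  - move=> w _; rewrite ltW//; apply: he => //; apply: zpath_ball => //.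
      exact: cell_point01.
    apply: le_lt_trans cn; rewrite /c -mulrA ler_wpM2l ?exprn_ge0 ?expR_ge0//.
    rewrite mulrDl mul1r lerD ?cell_dist// ler_wpM2l// cell_dist//.
have p0 : prob Q set0 = 0 by rewrite /prob measure0.
rewrite p0 mulr0 addr0 in h2; rewrite sameG distrC in h1.
have h3 : 2 * M * prob (P n) A' <= delta.
  apply: le_trans amn; rewrite /D -(mulrA (2 * M)).
  by apply: ler_wpM2l => //; rewrite mulr_ge0.
apply: (le_trans (ler_distD (\int[Q]_w g (cell_pair X A n w)) _ _)).
have -> : eps = delta * 4 by rewrite /delta divfK.
lra.
Unshelve. all: by end_near. Qed.
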